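(* Let $G$ be a graph with property $( * )$ and let $\mathbf{r}=(f_1,\dots,f_q)$ be a reduction sequence for $G$. Consider a seed $\Sigma=(\mathbf{x},Q_G)$ and let $z$ be the cluster variable of $\mu_{f_q}\circ\cdots\circ\mu_{f_1}(\Sigma)$ labeling vertex $f_q$. Then $F^{Q_G}_z(y_1,\dots,y_n)=D_G(y_1,\dots,y_n)$, and the $g$-vector of $z$ with respect to $Q_G$ equals $\mathbf{h}^G_{\hat 0}$, where $\hat0$ is the minimal perfect matching of $G$.
   Context: Property $( * )$: $G$ is a finite connected bipartite plane graph with fixed proper black/white vertex coloring, every edge of which lies in some perfect matching. $\mathrm{faces}(G)$ denotes the bounded faces. For a bounded face $f$, an edge of $f$ is black-white if going clockwise around $f$ one meets its black endpoint first, white-black otherwise. If a perfect matching $M$ contains all black-white edges of $f$, the down-flip at $f$ replaces them by the white-black edges (inverse: up-flip). Perfect matchings with $M\le M'$ iff $M$ is obtained from $M'$ by down-flips form a distributive lattice with minimum $\hat0$. For a saturated chain $\hat0=M_0\lessdot\cdots\lessdot M_\ell=M$ with $M_{k-1},M_k$ related by a flip at $g_k$, $\mathrm{mrk}(M)=y_{g_1}\cdots y_{g_\ell}$ (chain-independent); $D_G=\sum_M \mathrm{mrk}(M)$. Dual quiver $Q_G$: one (mutable) vertex per bounded face; for each edge separating two distinct bounded faces, an arrow crossing it with the white endpoint on the right; then delete oriented 2-cycles one at a time. Moves: (E) edge contraction/uncontraction: a vertex of degree 2 whose two neighbors are distinct and of degree at least 2 may be contracted together with its two edges (merging its two neighbors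 into one vertex), and conversely. (S) square move at a face $f$ bounded by four edges whose four vertices all have degree at least 3: the local picture is replaced by the one in which the colors around $f$ are reversed (equivalently, up to (E) moves, delete the four edges of $f$ and insert a new 4-cycle bounding $f$ whose vertices have the opposite colors, each joined by an edge to the corresponding old vertex). (B) bigon removal at a face $f$ bounded by two parallel edges between vertices of degree at least 2: delete one of the two edges, so $f$ disappears. A reduction sequence is a sequence of such moves turning $G$ into a graph with a single edge, recorded as the list $(f_1,\dots,f_q)$ of faces at which (S) or (B) are performed, in order. Cluster algebras: mutation $\mu_k$ of quivers and seeds as usual ($x_kx_k'=\prod_{i\to k}x_i+\prod_{k\to i}x_i$). For a seed with mutable vertices $[r]$, its framing adds frozen vertices $1^\bullet,\dots,r^\bullet$ with arrows $i^\bullet\to i$ and frozen variables $y_1,\dots,y_r$ (removing old frozens); a mutable cluster variable $z$ corresponds to the cluster variable $z'$ obtained by the same mutation sequence in the framed seed, which is a polynomial in $x_1^{\pm1},\dots,x_r^{\pm1},y_1,\dots,y_r$ of the form $P(\mathbf{x},\mathbf{y})/\mathbf{x}^{\mathbf d}$ with $P$ not divisible by any variable; the $F$-polynomial is $F_z^Q(\mathbf y)=P(1,\dots,1,\mathbf{y})$. The $g$-vector $\mathbf g=(g_j)$ of $z$ is the unique vector with $z=x_1^{g_1}\cdots x_r^{g_r}F_z^Q(\hat y_1,\dots,\hat y_r)$, where $\hat y_j=\prod_{i\to j}x_i/\prod_{j\to i}x_i$. For a set $M$ of edges, $\mathbf{h}^G_M=(h_f)_{f\in\mathrm{faces}(G)}$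 with $h_f=|f|/2-|M\cap f|-1$, where $|f|$ is the number of edges bounding $f$ and $|M\cap f|$ the number of those in $M$. *)

(* Defs.v *)
From Stdlib Require Import ClassicalEpsilon.
From HB Require Import structures.
From mathcomp Require Import all_boot all_order all_fingroup all_algebra.
From mathcomp.multinomials Require Import mpoly.

Set Implicit Arguments.
Unset Strict Implicit.
Unset Printing Implicit Defensive.

Import GRing.Theory.
Local Open Scope ring_scope.

(** * Bipartite plane graphs *)

Definition color := bool.
Definition black : color := true.
Definition white : color := false.

(* A connected bipartite plane graph, given by its edges and its rotation
   system: [ccw c e] is the edge that follows [e] in counterclockwise order
   around the endpoint of [e] of color [c].  The vertices of color [c] are thus
   the cycles of [ccw c], and multiple edges are allowed.

   Go along [e] from its black to its white endpoint, keeping the face on the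
   right: the next edges met are [ccw white e] (from white to black) and then
   [ccw black (ccw white e)] (from black to white).  Hence faces correspond to
   the cycles of [ccw black \o ccw white], and planarity is Euler's formula
   V - E + F = 2.

   [face e] is the name of the face on the right of [e] directed from black to
   white; [None] is the unbounded face, and the bounded faces are named by
   elements of ['I_n].  A name may be unused, so that a face can disappear in a
   move while the other faces keep their names. *)
Record plane_bigraph (n : nat) := PlaneBigraph {
  edge : finType;
  ccw : color -> {perm edge};
  face : edge -> option 'I_n;
  ccw_connected : forall e e' : edge,
      connect [rel x y | [exists c, y \in porbit (ccw c) x]] e e';
  ccw_planar : (#|porbits (ccw black)| + #|porbits (ccw white)|
       + #|porbits (ccw white * ccw black)%g| = #|edge| + 2)%N;
  face_eq : forall e e' : edge,
      (face e == face e') = (e' \in porbit (ccw white * ccw black)%g e);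
  outer_face : exists e : edge, face e = None }.

Section Dimers.

Variables (n : nat) (G : plane_bigraph n).
Implicit Types (M N : {set edge G}) (f : 'I_n).

Definition degree (c : color) (e : edge G) : nat := #|porbit (ccw G c) e|.

(* The face on the left of [e], directed from black to white. *)
Definition lface (e : edge G) : option 'I_n := face ((ccw G white)^-1%g e).

Definition is_bounded_face f : Prop := exists e : edge G, face e = Some f.

(* Clockwise around a bounded face means with the face on the right. *)
Definition bw_edges f : {set edge G} := [set e | face e == Some f].
Definition wb_edges f : {set edge G} := [set e | lface e == Some f].
Definition face_edges f : {set edge G} := bw_edges f :|: wb_edges f.

Definition perfect_matching M : bool :=
  [forall c : color, forall e, #|M :&: porbit (ccw G c) e| == 1%N].

Definition property_star : Prop :=
  forall e : edge G, exists2 M, perfect_matching M & e \in M.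

(* [N] is the down-flip of [M] at [f]. *)
Definition down_flip f M N : bool :=
  [&& perfect_matching M, perfect_matching N, bw_edges f \subset M
    & N == (M :\: bw_edges f) :|: wb_edges f].

Definition pm_le M N : bool :=
  connect [rel M1 M2 | [exists f, down_flip f M1 M2]] N M.
Definition pm_lt M N : bool := (M != N) && pm_le M N.
Definition pm_covered M N : bool :=
  pm_lt M N && ~~ [exists N', pm_lt M N' && pm_lt N' N].

Definition is_minimum M : bool :=
  perfect_matching M && [forall N, perfect_matching N ==> pm_le M N].
Definition hat0 : {set edge G} := odflt set0 [pick M | is_minimum M].

(* A saturated chain from the first to the second matching, recorded by the
   faces of its successive flips. *)
Inductive saturated_chain : {set edge G} -> seq 'I_n -> {set edge G} -> Prop :=
| chain_nil M : saturated_chain M [::] M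
| chain_cons M N M' g gs :
    pm_covered M N -> down_flip g N M -> saturated_chain N gs M' ->
    saturated_chain M (g :: gs) M'.

(* The monomial does not depend on the chain chosen by [epsilon]. *)
Definition mrk M : {mpoly int[n]} :=
  \prod_(g <- epsilon (inhabits [::]) (fun gs => saturated_chain hat0 gs M)) 'X_g.

Definition dimer_poly : {mpoly int[n]} := \sum_(M | perfect_matching M) mrk M.

Definition hvec M : {ffun 'I_n -> int} :=
  [ffun f => (#|face_edges f|./2)%:Z - #|M :&: face_edges f|%:Z - 1].

End Dimers.

(** * Moves and reduction sequences *)

Section Moves.

Variable n : nat.
Implicit Types G H : plane_bigraph n.

(* The rotation [s] once the edges of [A] are removed, provided no two of them
   are consecutive. *)
Definition skip (T : finType) (s : {perm T}) (A : {set T}) (x : T) : T :=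
  if s x \in A then s (s x) else s x.

(* [H] is [G] where the vertex of color [c] with incident edges [e1], [e2] is
   contracted.  If the neighbors have counterclockwise rotations
   (e1 a1 .. ap) and (e2 b1 .. bq), the merged one has (a1 .. ap b1 .. bq). *)
Definition contraction G H : Prop :=
  exists (c : color) (e1 e2 : edge G) (i : edge H -> edge G),
    [/\ [/\ porbit (ccw G c) e1 = [set e1; e2], e1 != e2,
            e2 \notin porbit (ccw G (~~ c)) e1,
            (2 <= degree (~~ c) e1)%N & (2 <= degree (~~ c) e2)%N],
        injective i /\ (forall e, (e \in codom i) = (e \notin [set e1; e2])),
        forall x, i (ccw H c x) = ccw G c (i x),
        forall x, i (ccw H (~~ c) x) =
          let y := ccw G (~~ c) (i x) in
          if y == e1 then ccw G (~~ c) e2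
          else if y == e2 then ccw G (~~ c) e1 else y
      & forall x, face x = face (i x)].

(* The face [f] is bounded by the black-white edge [e] and the white-black edge
   [e'].  Deleting [e] keeps the right face of every other edge; deleting [e']
   instead gives an isomorphic graph. *)
Definition bigon_removal (f : 'I_n) G H : Prop :=
  exists (e e' : edge G) (i : edge H -> edge G),
    [/\ [/\ face e = Some f, e != e', ccw G white e = e' & ccw G black e' = e],
        (2 <= degree black e)%N /\ (2 <= degree white e)%N,
        injective i /\ (forall x, (x \in codom i) = (x != e)),
        forall c x, i (ccw H c x) = skip (ccw G c) [set e] (i x)
      & forall x, face x = face (i x)].

(* Going clockwise around [f] one meets b1 -a- w1 -b- b2 -c- w2 -d- b1.  Four
   new vertices u1, v1, u2, v2 (white, black, white, black) are placed inside
   [f], next to b1, w1, b2, w2 respectively, with the new cycle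
   u1 -a'- v1 -b'- u2 -c'- v2 -d'- u1 as boundary of [f].  The edges a, b, c, d
   are deleted, and their names are reused through [k] for the new edges
   joining the cycle to the old vertices:
     k a = b1 u1,   k b = v1 w1,   k c = b2 u2,   k d = v2 w2. *)
Definition square_move (f : 'I_n) G H : Prop :=
  exists (a b c d : edge G) (k : edge G -> edge H) (a' b' c' d' : edge H),
    [/\ [/\ face a = Some f, ccw G white a = b, ccw G black b = c,
            ccw G white c = d & ccw G black d = a],
        (* the four vertices are distinct and have degree at least 3 *)
        [/\ c \notin porbit (ccw G black) a, c \notin porbit (ccw G white) a &
          [/\ (3 <= degree black a)%N, (3 <= degree white a)%N,
              (3 <= degree black c)%N & (3 <= degree white c)%N]],
        [/\ injective k, uniq [:: a'; b'; c'; d'] &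
          forall y, (y \in codom k) = (y \notin [:: a'; b'; c'; d'])],
        [/\ (* old vertices *)
            forall x, x \notin [set b; d] ->
              ccw H black (k x) = k (skip (ccw G black) [set b; d] x),
            forall x, x \notin [set a; c] ->
              ccw H white (k x) = k (skip (ccw G white) [set a; c] x),
            (* new white vertices u1 = (d' a' ka) and u2 = (b' c' kc) *)
            [/\ ccw H white d' = a', ccw H white a' = k a,
                ccw H white (k a) = d' &
              [/\ ccw H white b' = c', ccw H white c' = k c
                & ccw H white (k c) = b']] &
            (* new black vertices v1 = (a' b' kb) and v2 = (c' d' kd) *)
            [/\ ccw H black a' = b', ccw H black b' = k b,
                ccw H black (k b) = a' &
              [/\ ccw H black c' = d', ccw H black d' = k d
                & ccw H black (k d) = c']]]
      & [/\ forall x, x \notin [set a; c] -> face (k x) = face x,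
            face (k a) = face d, face (k c) = face b &
          [/\ face a' = lface a, face c' = lface c,
              face b' = Some f & face d' = Some f]]].

Inductive reduction_seq : plane_bigraph n -> seq 'I_n -> Prop :=
| red_single G : #|edge G| = 1%N -> reduction_seq G [::]
| red_contract G H r :
    contraction G H -> reduction_seq H r -> reduction_seq G r
| red_uncontract G H r :
    contraction H G -> reduction_seq H r -> reduction_seq G r
| red_square f G H r :
    square_move f G H -> reduction_seq H r -> reduction_seq G (f :: r)
| red_bigon f G H r :
    bigon_removal f G H -> reduction_seq H r -> reduction_seq G (f :: r).

End Moves.

(** * Quivers and seeds *)

(* [Q u v] is the number of arrows from [u] to [v]. *)
Definition quiver (V : finType) := V -> V -> nat.

Definition cancel_2cycles (V : finType) (Q : quiver V) : quiver V :=
  fun u v => (Q u v - Q v u)%N.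

(* An arrow crossing [e] with the white endpoint on its right goes from the
   right to the left of [e] directed from black to white. *)
Definition dual_quiver (n : nat) (G : plane_bigraph n) : quiver 'I_n :=
  cancel_2cycles (fun f g =>
    if f == g then 0%N
    else #|[set e : edge G | (face e == Some f) && (lface e == Some g)]|).

Record seed (V : finType) (K : fieldType) := Seed {
  cluster : V -> K;
  seed_quiver : quiver V }.

Section Mutation.

Variables (V : finType) (K : fieldType).

(* Arrows between frozen vertices are kept; they play no role in mutations at
   mutable vertices. *)
Definition mutate_quiver (k : V) (Q : quiver V) : quiver V :=
  cancel_2cycles (fun u v =>
    if (u == k) || (v == k) then Q v u else (Q u v + Q u k * Q k v)%N).

Definition mutate (S : seed V K) (k : V) : seed V K :=
  let x := cluster S in let Q := seed_quiver S in
  Seed (fun v => if v == k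
                 then (\prod_u x u ^+ Q u k + \prod_u x u ^+ Q k u) / x k
                 else x v)
       (mutate_quiver k Q).

Definition mutate_seq (S : seed V K) (s : seq V) : seed V K := foldl mutate S s.

End Mutation.

Section ClusterInvariants.

Variable n : nat.
Implicit Types (Q : quiver 'I_n) (s : seq 'I_n) (k : 'I_n).

(* [inl i] is the mutable vertex i and [inr i] the frozen vertex i^bullet. *)
Definition framed_quiver Q : quiver ('I_n + 'I_n)%type :=
  fun u v => match u, v with
             | inl i, inl j => Q i j
             | inr i, inl j => nat_of_bool (i == j)
             | _, inr _ => 0%N
             end.

(* In [{mpoly int[n + n]}] the variables x_i come first, then the y_i. *)
Definition framed_var (v : 'I_n + 'I_n) : {fraction {mpoly int[n + n]}} :=
  tofrac 'X_(unsplit v).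

Definition framed_seed Q := Seed framed_var (framed_quiver Q).

Definition subst_x1 (P : {mpoly int[n + n]}) : {mpoly int[n]} :=
  P \mPo [tuple if split i is inr j then 'X_j else 1 | i < n + n].

(* [F] is the F-polynomial, with respect to [Q], of the cluster variable that
   labels [k] after the mutations [s]. *)
Definition is_Fpoly Q s k (F : {mpoly int[n]}) : Prop :=
  exists (P : {mpoly int[n + n]}) (d : 'I_n -> int),
    [/\ cluster (mutate_seq (framed_seed Q) (map inl s)) (inl k)
          = tofrac P / \prod_i framed_var (inl i) ^ d i,
        forall i P', P <> 'X_i * P'
      & F = subst_x1 P].

Definition alg_independent (K : fieldType) (x : 'I_n -> K) : Prop :=
  forall p : {mpoly int[n]}, mmap intr x p = 0 -> p = 0.

Definition yhat (K : fieldType) (x : 'I_n -> K) Q (j : 'I_n) : K :=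
  \prod_i x i ^+ Q i j / \prod_i x i ^+ Q j i.

(* [g] is the g-vector, with respect to [Q], of the cluster variable that
   labels [k] after the mutations [s] of the seed [(x, Q)]. *)
Definition is_gvector (K : fieldType) (x : 'I_n -> K) Q s k
    (g : {ffun 'I_n -> int}) : Prop :=
  exists2 F, is_Fpoly Q s k F &
    cluster (mutate_seq (Seed x Q) s) k
      = (\prod_j x j ^ g j) * mmap intr (yhat x Q) F.

End ClusterInvariants.

(* Main.v *)
(* The difference of two perfect matchings is the coboundary of a unique integral
   function on the bounded faces, their relative height: by Euler's formula closed
   and exact 1-forms have the same dimension.  Flips change one height by one, so
   [hat0] is the matching of least height and [mrk M] is the product of the
   [y_f ^ height M hat0 f].

   For a seed whose quiver extends that of G, put
     Z = (monomial) * sum over M of the product of the [yhat_f ^ height M N f],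
   where the monomial makes the least exponent of a cluster variable -1 at a face of
   G and 0 at a deleted or frozen vertex.  In any commutative semiring, a square move
   or bigon removal at f multiplies the sum by a monomial in y_f and 1 + y_f once the
   y's are mutated at f.  Applied to the field, and to the tropical semiring, where it
   controls the least exponents, this shows that Z is unchanged by the move combined
   with the mutation at f.  At the last bigon Z is the new cluster variable.
   For the original seed the exponents are [hvec hat0]; for the framed one, frozen
   exponents are the heights themselves. *)

Require Import Defs.
From Stdlib Require Import ClassicalEpsilon.
From HB Require Import structures.
From mathcomp Require Import all_boot all_order all_fingroup all_algebra.
From mathcomp.multinomials Require Import mpoly.
From mathcomp Require Import zify ring.

Set Implicit Arguments.
Unset Strict Implicit.
Unset Printing Implicit Defensive.

Import Order.TTheory GRing.Theory Num.Theory.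
Local Open Scope ring_scope.

(** * Exactness and height functions *)

(** In the induction the reference matching [N] is arbitrary, since a move need not carry the
    minimal matching to the minimal one; [hat0] is substituted only at the end. The sum identities
    hold over all commutative semirings, so their proofs cannot subtract, and inverses exist only as
    negative exponents of [pw] and [q]. Moves are not bijections of matchings: a bigon merges two of
    them, and a square relates one to two in either direction. Such multiplicities are resolved by
    computing one sum along two correspondences and comparing.

    At a bigon the value changes by a power of the new variable [z] whose exponent is minus the
    least value, over the matchings of the smaller graph, of the indicator of the surviving edge.
    This is 0 unless that edge is forced, and a forced edge is the only edge of its graph. In that
    case the smaller graph has value 1 and the exponent -1 gives [Z = z].

    Faces deleted by a bigon remain vertices of the quiver, and framing adds further vertices. Hence
    seed and graph are compared only on the surviving faces. *)

Section PermOrbits.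

Variable T : finType.
Implicit Types (s : {perm T}) (x y : T) (A : {set T}).

Lemma porbit_step s x y : (s y \in porbit s x) = (y \in porbit s x).
Proof. by rewrite -!eq_porbit_mem (porbit_perm s 1). Qed.

Lemma porbit_stepV s x y : ((s^-1)%g y \in porbit s x) = (y \in porbit s x).
Proof. by rewrite -{2}(permKV s y) porbit_step. Qed.

Lemma porbit_self s x : s x \in porbit s x.
Proof. by rewrite porbit_step porbit_id. Qed.

Lemma porbit_trans s x y z :
  y \in porbit s x -> z \in porbit s y -> z \in porbit s x.
Proof. by rewrite -!eq_porbit_mem => /eqP <-. Qed.

Lemma porbit_eq s x y : y \in porbit s x -> porbit s y = porbit s x.
Proof. by rewrite -eq_porbit_mem => /eqP. Qed.

Lemma porbit_subset s x A :
  x \in A -> (forall y, y \in A -> s y \in A) -> porbit s x \subset A.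
Proof.
move=> xA sA; apply/subsetP => _ /porbitP[i ->].
elim: i => [|i IH]; first by rewrite perm1.
by rewrite expgSr permM sA.
Qed.

Lemma sum_porbit_shift (R : nmodType) s x (F : T -> R) :
  \sum_(y in porbit s x) F (s y) = \sum_(y in porbit s x) F y.
Proof.
rewrite [RHS](reindex_inj (@perm_inj _ s)) /=.
by apply: eq_bigl => y; rewrite porbit_step.
Qed.

Lemma sum_porbit_shiftV (R : nmodType) s x (F : T -> R) :
  \sum_(y in porbit s x) F ((s^-1)%g y) = \sum_(y in porbit s x) F y.
Proof.
rewrite -sum_porbit_shift; apply: eq_bigr => y _; by rewrite permK.
Qed.

End PermOrbits.

Section Exactness.

Variables (n : nat) (G : plane_bigraph n).
Notation E := (edge G).
Notation cb := (ccw G black).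
Notation cw := (ccw G white).
Notation phi := (cw * cb)%g.

(** This is the form in which connectivity of the graph is used throughout. *)
Lemma ccw_invariant_const (T : Type) (F : E -> T) :
  (forall e, F (cb e) = F e) -> (forall e, F (cw e) = F e) ->
  forall e e', F e = F e'.
Proof.
move=> Fb Fw e e'.
have Fc c x : F (ccw G c x) = F x by case: c.
have Fo c x y : y \in porbit (ccw G c) x -> F y = F x.
  case/porbitP=> i ->; elim: i => [|i IH]; first by rewrite perm1.
  by rewrite expgSr permM Fc.
case/connectP: (ccw_connected e e') => p.
elim: p e => [|y p IH] e /=; first by move=> _ ->.
case/andP=> /existsP[c yc] py el; rewrite -(Fo c _ _ yc); exact: IH.
Qed.

(** Rational entries, because the comparison of dimensions needs a field; integrality is recovered
    later from the integral jumps. *)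
Definition orbit_mx (s : {perm E}) : 'M[rat]_(#|porbits s|, #|E|) :=
  \matrix_(i < #|porbits s|, j < #|E|) ((enum_val j : E) \in (enum_val i : {set E}))%:R.

Lemma mem_porbits_eq (s : {perm E}) (i : 'I_#|porbits s|) (e : E) :
  (e \in (enum_val i : {set E})) = (porbit s e == enum_val i).
Proof.
have /imsetP[x _ ->] := enum_valP i.
by rewrite eq_porbit_mem.
Qed.

Lemma rank_orbit_mx s : \rank (orbit_mx s) = #|porbits s|.
Proof.
apply/eqP; rewrite -[_ == _]/(row_free _) -kermx_eq0; apply/rowV0P => u.
move/sub_kermxP => uA0; apply/rowP => i; rewrite mxE.
have /imsetP[x _ ix] := enum_valP i.
have := congr1 (fun A : 'rV_#|E| => A 0 (enum_rank x)) uA0.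
rewrite !mxE (bigD1 i) //= big1 ?addr0.
  by rewrite mxE enum_rankK mem_porbits_eq -ix eqxx mulr1.
move=> j ji; rewrite mxE enum_rankK mem_porbits_eq -ix.
by rewrite (inj_eq enum_val_inj) eq_sym (negbTE ji) mulr0.
Qed.

Lemma sub_orbit_mx s (v : 'rV_#|E|) : (v <= orbit_mx s)%MS ->
  forall e, v 0 (enum_rank (s e)) = v 0 (enum_rank e).
Proof.
case/submxP=> D -> e; rewrite !mxE; apply: eq_bigr => i _.
rewrite !mxE !enum_rankK !mem_porbits_eq.
by rewrite (porbit_perm s 1).
Qed.

Lemma sub_const_mx (v : 'rV[rat]_#|E|) (e0 : E) :
  (forall e, v 0 (enum_rank (cb e)) = v 0 (enum_rank e)) ->
  (forall e, v 0 (enum_rank (cw e)) = v 0 (enum_rank e)) ->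
  (v <= (const_mx 1 : 'rV[rat]_#|E|))%MS.
Proof.
move=> vb vw.
suff -> : v = v 0 (enum_rank e0) *: const_mx 1 by apply: scalemx_sub.
apply/rowP => j; rewrite !mxE mulr1 -[j in LHS]enum_valK.
exact: (ccw_invariant_const (F := fun e => v 0 (enum_rank e)) vb vw).
Qed.

(** Right multiplication by it composes a function on edges with the inverse of [cw]. Since the left
    face of [e] is the right face of [(cw^-1)%g e], the matrix [1%:M - shift_mx] takes the value on
    the right minus the value on the left. *)
Definition shift_mx : 'M[rat]_#|E| :=
  \matrix_(i, j) (enum_val i == (cw^-1)%g (enum_val j))%:R.

Lemma mul_shift_mx m (v : 'M[rat]_(m, #|E|)) i e :
  (v *m shift_mx) i (enum_rank e) = v i (enum_rank ((cw^-1)%g e)).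
Proof.
rewrite mxE (bigD1 (enum_rank ((cw^-1)%g e))) //= big1 ?addr0.
  by rewrite mxE !enum_rankK eqxx mulr1.
move=> j ne; rewrite mxE enum_rankK.
case: eqP => [ej|]; last by rewrite mulr0.
by rewrite -ej enum_valK eqxx in ne.
Qed.

Lemma mul_sub_shift_mx m (v : 'M[rat]_(m, #|E|)) i e :
  (v *m (1%:M - shift_mx)) i (enum_rank e) =
  v i (enum_rank e) - v i (enum_rank ((cw^-1)%g e)).
Proof. by rewrite mulmxBr mulmx1 -mul_shift_mx !mxE. Qed.

Definition coboundary_mx := orbit_mx phi *m (1%:M - shift_mx).

Lemma coboundary_mxE i e : coboundary_mx i (enum_rank e) =
  orbit_mx phi i (enum_rank e) - orbit_mx phi i (enum_rank ((cw^-1)%g e)).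
Proof. exact: mul_sub_shift_mx. Qed.

(** A combination of face indicators killed by [1%:M - shift_mx] is invariant under [phi] and [cw],
    hence under [cb], hence constant. The coboundary therefore loses at most one dimension. *)
Lemma rank_coboundary_mx : (#|porbits phi| <= (\rank coboundary_mx).+1)%N.
Proof.
have [e0 _] := outer_face G.
apply: (@leq_trans (\rank (orbit_mx phi))); first by rewrite rank_orbit_mx.
rewrite -(mxrank_mul_ker (orbit_mx phi) (1%:M - shift_mx)).
rewrite -addn1 leq_add2l; apply: leq_trans (rank_leq_row (const_mx 1 : 'rV[rat]_#|E|)).
apply/mxrankS/row_subP => i.
set v := row i _.
have : (v <= orbit_mx phi :&: kermx (1%:M - shift_mx))%MS by exact: row_sub.
rewrite sub_capmx => /andP[/sub_orbit_mx vphi /sub_kermxP vk].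
have vw e : v 0 (enum_rank (cw e)) = v 0 (enum_rank e).
  have := congr1 (fun A : 'rV_#|E| => A 0 (enum_rank (cw e))) vk.
  rewrite mul_sub_shift_mx permK [RHS]mxE.
  by move/eqP; rewrite subr_eq0 => /eqP.
apply: (sub_const_mx e0 _ vw) => e.
rewrite -{2}(permKV cw e) vw -(vphi ((cw^-1)%g e)).
by rewrite permM permKV.
Qed.

(** A function in the span of the black and in the span of the white vertices is invariant under
    both rotations, hence constant, so the two spans meet in at most a line. *)
Lemma rank_vertex_mx :
  (#|porbits cb| + #|porbits cw| <= (\rank (col_mx (orbit_mx cb) (orbit_mx cw))).+1)%N.
Proof.
have [e0 _] := outer_face G.
apply: (@leq_trans (\rank (orbit_mx cb) + \rank (orbit_mx cw))).
  by rewrite !rank_orbit_mx.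
rewrite -mxrank_sum_cap -addsmxE.
rewrite -addn1 leq_add2l; apply: leq_trans (rank_leq_row (const_mx 1 : 'rV[rat]_#|E|)).
apply/mxrankS/row_subP => i.
have : (row i (orbit_mx cb :&: orbit_mx cw)%MS <= orbit_mx cb :&: orbit_mx cw)%MS.
  exact: row_sub.
rewrite sub_capmx => /andP[/sub_orbit_mx vb /sub_orbit_mx vw].
exact: sub_const_mx.
Qed.

Lemma mul_orbit_mxT m s (v : 'M[rat]_(m, #|E|)) i (k : 'I_#|porbits s|) x :
  porbit s x = enum_val k ->
  (v *m (orbit_mx s)^T) i k = \sum_(z in porbit s x) v i (enum_rank z).
Proof.
move=> xk; rewrite mxE (reindex (@enum_rank E)) /=; last first.
  by exists enum_val => z _; rewrite ?enum_rankK ?enum_valK.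
rewrite [RHS]big_mkcond /=; apply: eq_bigr => z _.
by rewrite !mxE enum_rankK -xk; case: ifP; rewrite ?mulr1 ?mulr0.
Qed.

(** Around a vertex the left faces of the edges are their right faces in rotated order, so the two
    sums cancel. *)
Lemma coboundary_closed :
  (coboundary_mx <= kermx (col_mx (orbit_mx cb) (orbit_mx cw))^T)%MS.
Proof.
apply/sub_kermxP; rewrite tr_col_mx mul_mx_row.
have inv i e : orbit_mx phi i (enum_rank ((cw^-1)%g e)) =
               orbit_mx phi i (enum_rank (cb e)).
  rewrite !mxE !enum_rankK !mem_porbits_eq -(porbit_perm phi 1).
  by rewrite expg1 permM permKV.
apply/matrixP => i j; rewrite [RHS]mxE; case: (split_ordP j) => k ->.
  rewrite row_mxEl; have /imsetP[x _ kx] := enum_valP k.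
  rewrite (mul_orbit_mxT _ _ (esym kx)).
  under eq_bigr do rewrite coboundary_mxE inv.
  by rewrite sumrB (sum_porbit_shift cb x (fun z => orbit_mx phi i (enum_rank z))) subrr.
rewrite row_mxEr; have /imsetP[x _ kx] := enum_valP k.
rewrite (mul_orbit_mxT _ _ (esym kx)).
under eq_bigr do rewrite coboundary_mxE.
by rewrite sumrB (sum_porbit_shiftV cw x (fun z => orbit_mx phi i (enum_rank z))) subrr.
Qed.

(* Both spaces have dimension F - 1 = E - V + 1 by Euler's formula. *)
Lemma closed_sub_coboundary :
  (kermx (col_mx (orbit_mx cb) (orbit_mx cw))^T <= coboundary_mx)%MS.
Proof.
have [_ <-] := mxrank_leqif_sup coboundary_closed.
rewrite eqn_leq (mxrankS coboundary_closed) /= mxrank_ker mxrank_tr.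
have := rank_coboundary_mx; have := rank_vertex_mx; have := ccw_planar G.
move: (\rank coboundary_mx) => r1.
move: (\rank (col_mx _ _)) => r2.
move: #|porbits cb| #|porbits cw| #|porbits phi| #|E| => p1 p2 p3 q.
lia.
Qed.

Lemma closed_exact (F : E -> rat) :
  (forall c e, \sum_(z in porbit (ccw G c) e) F z = 0) ->
  exists2 H : E -> rat, forall e, H (cb (cw e)) = H e
    & forall e, F e = H e - H ((cw^-1)%g e).
Proof.
move=> F0; pose v : 'rV[rat]_#|E| := \row_j F (enum_val j).
have : (v <= kermx (col_mx (orbit_mx cb) (orbit_mx cw))^T)%MS.
  apply/sub_kermxP; rewrite tr_col_mx mul_mx_row.
  apply/matrixP => i j; rewrite [RHS]mxE; case: (split_ordP j) => k ->.
    rewrite row_mxEl; have /imsetP[x _ kx] := enum_valP k.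
    rewrite (mul_orbit_mxT _ _ (esym kx)) -[RHS](F0 black x).
    by apply: eq_bigr => z _; rewrite mxE enum_rankK.
  rewrite row_mxEr; have /imsetP[x _ kx] := enum_valP k.
  rewrite (mul_orbit_mxT _ _ (esym kx)) -[RHS](F0 white x).
  by apply: eq_bigr => z _; rewrite mxE enum_rankK.
move/submx_trans/(_ closed_sub_coboundary); case/submxP => D vD.
exists (fun e => (D *m orbit_mx phi) 0 (enum_rank e)) => e.
  rewrite -permM -[(cw * cb)%g]/phi; apply: sub_orbit_mx; exact: submxMl.
have := congr1 (fun A : 'rV_#|E| => A 0 (enum_rank e)) vD.
rewrite mxE enum_rankK => ->.
by rewrite /coboundary_mx mulmxA mul_sub_shift_mx.
Qed.

End Exactness.

(** * Integral height functions of pairs of matchings *)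

Section Heights.

Variables (n : nat) (G : plane_bigraph n).
Notation E := (edge G).
Notation cb := (ccw G black).
Notation cw := (ccw G white).
Implicit Types (M N P : {set E}) (h : 'I_n -> int) (e : E) (f : 'I_n).

Definition ind M e : int := (e \in M : nat)%:Z.

Definition used f : bool := [exists e : E, face e == Some f].

Definition outer_ext h (o : option 'I_n) : int := if o is Some f then h f else 0.

Definition is_height M N h : Prop :=
  (forall e, ind M e - ind N e = outer_ext h (face e) - outer_ext h (lface e)) /\
  (forall f, ~~ used f -> h f = 0).

Definition height M N : 'I_n -> int :=
  epsilon (inhabits (fun=> 0)) (is_height M N).

Lemma face_step e : face (cb (cw e)) = face e.
Proof.
apply/eqP; rewrite eq_sym face_eq -permM; exact: porbit_self.
Qed.

Lemma lface_cw e : lface (cw e) = face e.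
Proof. by rewrite /lface permK. Qed.

Lemma lface_cbV e : lface ((cb^-1)%g e) = face e.
Proof.
by rewrite /lface -(face_step ((cw^-1)%g _)) !permKV.
Qed.

Lemma face_cb e : face (cb e) = lface e.
Proof. by rewrite -lface_cbV permK. Qed.

Lemma face_invariant_const (T : Type) (F : option 'I_n -> T) :
  (forall e, F (face e) = F (lface e)) -> forall e, F (face e) = F None.
Proof.
move=> Frl e; have [e0 <-] := outer_face G.
apply: (@ccw_invariant_const _ G _ (F \o @face n G)) => x /=.
  by rewrite face_cb Frl.
by rewrite Frl lface_cw.
Qed.

Lemma used_face e f : face e = Some f -> used f.
Proof. by move=> ef; apply/existsP; exists e; rewrite ef. Qed.

Lemma used_lface e f : lface e = Some f -> used f.
Proof. exact: used_face. Qed.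

(** The difference of two heights does not jump across any edge, so everywhere it has its value 0 at
    the unbounded face. *)
Lemma is_height_unique M N h h' : is_height M N h -> is_height M N h' -> h =1 h'.
Proof.
move=> [H1 H2] [H1' H2'] f.
case: (boolP (used f)) => [/existsP[e /eqP ef]|uf]; last by rewrite H2 ?H2'.
apply/eqP; rewrite -subr_eq0; apply/eqP.
pose F o := outer_ext h o - outer_ext h' o.
have FE : forall e, F (face e) = F (lface e).
  move=> x; rewrite /F; move: (H1 x) (H1' x); move: (outer_ext _ _) (outer_ext _ _)
   (outer_ext _ _) (outer_ext _ _); lia.
by have := face_invariant_const FE e; rewrite /F ef /= subrr.
Qed.

Lemma perfect_matchingP M :
  reflect (forall c e, (\sum_(z in porbit (ccw G c) e) (z \in M : nat) = 1)%N)
          (perfect_matching M).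
Proof.
have cardE c e : #|M :&: porbit (ccw G c) e| =
    (\sum_(z in porbit (ccw G c) e) (z \in M : nat))%N.
  rewrite -sum1_card big_mkcond [RHS]big_mkcond /=; apply: eq_bigr => z _.
  by rewrite inE; case: (z \in M); case: (z \in porbit _ _).
apply: (iffP forallP) => [H c e|H c].
  by have /forallP/(_ e)/eqP := H c; rewrite cardE.
by apply/forallP => e; rewrite cardE H.
Qed.

Lemma matching_sum M c e : perfect_matching M ->
  \sum_(z in porbit (ccw G c) e) ind M z = 1.
Proof.
move/perfect_matchingP/(_ c e) => H.
by rewrite /ind -(big_morph Posz PoszD (erefl 0%:Z)) H.
Qed.

Lemma matching_uniq M c e e' : perfect_matching M -> e \in M -> e' \in M ->
  e' \in porbit (ccw G c) e -> e' = e.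
Proof.
move/perfect_matchingP/(_ c e) => H eM e'M e'e; apply/eqP; apply: contraT => ne.
move: H; rewrite (bigD1 e) ?porbit_id //= eM (bigD1 e') /=; last by rewrite e'e.
by rewrite e'M.
Qed.

Lemma matching_ex M c e : perfect_matching M ->
  exists2 e', e' \in porbit (ccw G c) e & e' \in M.
Proof.
move/perfect_matchingP/(_ c e) => H.
have : (\sum_(z in porbit (ccw G c) e) (z \in M : nat))%N != 0%N by rewrite H.
rewrite sum_nat_eq0 negb_forall => /existsP[z].
rewrite negb_imply => /andP[zo]; rewrite eqb0 negbK => zM; by exists z.
Qed.

(** Both matchings have sum 1 at every vertex, so the difference of their indicators is closed and
    has a rational potential. Subtracting its value at an edge of the unbounded face makes it vanish
    there; its jumps are integers, so by connectivity all its values are. *)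
Lemma height_exists M N : perfect_matching M -> perfect_matching N ->
  exists h, is_height M N h.
Proof.
move=> pM pN.
have [|H Hphi HE] := @closed_exact n G (fun e => (ind M e - ind N e)%:~R).
  move=> c e; rewrite -[LHS](big_morph (fun z : int => z%:~R : rat) (fun x y => intrD _ x y) (erefl : 0%:~R = 0)).
  by rewrite sumrB !matching_sum.
have [e0 fe0] := outer_face G.
pose H' e := H e - H e0.
have H'w e : H' e - H' ((cw^-1)%g e) = (ind M e - ind N e)%:~R.
  by rewrite HE /H'; ring.
have H'f e e' : face e = face e' -> H' e = H' e'.
  move/eqP; rewrite face_eq => /porbitP[i ->].
  elim: i => [|i IH]; first by rewrite perm1.
  by rewrite expgSr permM IH permM /H' Hphi.
have H'b e : H' ((cw^-1)%g e) = H' (cb e).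
  by apply: H'f; rewrite face_cb.
have H'0 : H' e0 = 0 by rewrite /H' subrr.
have H'int e : H' e \is a Num.int.
  have -> : (H' e \is a Num.int) = (H' e0 \is a Num.int); last by rewrite H'0.
  have intD e1 e2 : (exists z : int, H' e1 - H' e2 = z%:~R) ->
    (H' e1 \is a Num.int) = (H' e2 \is a Num.int).
    case=> z /eqP; rewrite subr_eq => /eqP ->.
    by rewrite rpredDl ?intr_int // rpredDr ?intr_int.
  apply: (@ccw_invariant_const _ G _ (fun x => H' x \is a Num.int)) => x.
    apply: intD; exists (ind N x - ind M x).
    by rewrite -H'b -opprB H'w -rmorphN opprB.
  by apply: intD; exists (ind M (cw x) - ind N (cw x)); rewrite -H'w permK.
pose h f : int := if [pick e : E | face e == Some f] is Some e then Num.floor (H' e) else 0.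
have hE e : (outer_ext h (face e))%:~R = H' e.
  case fe: (face e) => [f|] /=; last by rewrite (H'f e e0) ?H'0 ?fe.
  rewrite /h; case: pickP => [e' /eqP fe'|/(_ e)]; last by rewrite fe eqxx.
  rewrite (H'f e e') ?fe //; apply/eqP; rewrite -intrEfloor; exact: H'int.
exists h; split=> [e|f uf].
  apply: (@intr_inj rat); rewrite -H'w rmorphB /= hE.
  by rewrite /lface hE.
rewrite /h; case: pickP => // e /eqP fe.
by rewrite (used_face fe) in uf.
Qed.

Lemma heightP M N : perfect_matching M -> perfect_matching N ->
  is_height M N (height M N).
Proof. by move=> pM pN; apply: epsilon_spec; apply: height_exists. Qed.

Lemma height_eq M N h : is_height M N h -> height M N =1 h.
Proof.
move=> Hh; apply: is_height_unique (Hh).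
by apply: epsilon_spec; exists h.
Qed.

Lemma heightE M N e : perfect_matching M -> perfect_matching N ->
  ind M e - ind N e =
  outer_ext (height M N) (face e) - outer_ext (height M N) (lface e).
Proof. by move=> pM pN; case: (heightP pM pN). Qed.

Lemma height_unused M N f : perfect_matching M -> perfect_matching N ->
  ~~ used f -> height M N f = 0.
Proof. by move=> pM pN; case: (heightP pM pN) => _; apply. Qed.

Lemma outer_extD h h' o :
  outer_ext (fun f => h f + h' f) o = outer_ext h o + outer_ext h' o.
Proof. by case: o. Qed.

Lemma height_refl M : height M M =1 fun=> 0.
Proof.
apply: height_eq; split=> // e; rewrite subrr.
by case: (face e) (lface e) => [?|] [?|].
Qed.

Lemma height_trans M N P f : perfect_matching M -> perfect_matching N ->
  perfect_matching P -> height M P f = height M N f + height N P f.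
Proof.
move=> pM pN pP; move: f; apply: height_eq; split=> [e|f uf].
  rewrite !outer_extD; move: (heightE e pM pN) (heightE e pN pP).
  move: (outer_ext _ _) (outer_ext _ _) (outer_ext _ _) (outer_ext _ _); lia.
by rewrite !height_unused.
Qed.

Lemma height_sym M N f : perfect_matching M -> perfect_matching N ->
  height N M f = - height M N f.
Proof.
move=> pM pN; have := height_trans f pM pN pM.
by rewrite height_refl => /eqP; rewrite eq_sym addr_eq0 => /eqP ->; rewrite opprK.
Qed.

Lemma height0_eq M N : perfect_matching M -> perfect_matching N ->
  (forall f, height M N f = 0) -> M = N.
Proof.
move=> pM pN h0; apply/setP => e; have := heightE e pM pN.
have oh0 o : outer_ext (height M N) o = 0 by case: o => //=.
by rewrite !oh0 /ind; case: (e \in M); case: (e \in N).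
Qed.

(** Adding a coboundary leaves the sums at the vertices unchanged, because the left and right faces
    at a vertex agree up to rotation; the bounds say that the result is still an indicator. The
    value of [k] at the unbounded face is arbitrary. *)
Lemma matching_of_height N (k : option 'I_n -> int) : perfect_matching N ->
  (forall e, 0 <= ind N e + k (face e) - k (lface e) <= 1) ->
  exists2 M, perfect_matching M &
    forall e, ind M e = ind N e + k (face e) - k (lface e).
Proof.
move=> pN kb; pose M := [set e | ind N e + k (face e) - k (lface e) == 1].
have ME e : ind M e = ind N e + k (face e) - k (lface e).
  by rewrite {1}/ind inE; have := kb e; case: eqP => /= ?; lia.
exists M => //; apply/perfect_matchingP => c e.
have eq1 (m : nat) : m%:Z = 1 -> m = 1%N by case.
apply: eq1.
rewrite (big_morph Posz PoszD (erefl 0%:Z)) -[RHS](matching_sum c e pN).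
rewrite -/(ind M) (eq_bigr (fun z => ind N z + (k (face z) - k (lface z)))); last first.
  by move=> z _; rewrite -[LHS]/(ind M z) ME addrA.
rewrite big_split /= sumrB.
suff -> : \sum_(z in porbit (ccw G c) e) k (face z) =
          \sum_(z in porbit (ccw G c) e) k (lface z) by rewrite subrr addr0.
case: c.
  rewrite -(sum_porbit_shift cb); apply: eq_bigr => z _; by rewrite face_cb.
rewrite -[RHS](sum_porbit_shift cw); apply: eq_bigr => z _; by rewrite lface_cw.
Qed.

End Heights.

(** * Flips and the minimal matching *)

Lemma exists_minimizer (T : finType) (P : pred T) (F : T -> int) x0 :
  P x0 -> exists2 x, P x & forall y, P y -> F x <= F y.
Proof. by move=> Px0; case: (arg_minP F Px0) => x Px Hx; exists x. Qed.

Section Flips.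

Variables (n : nat) (G : plane_bigraph n).
Notation E := (edge G).
Notation cb := (ccw G black).
Notation cw := (ccw G white).
Implicit Types (M N P : {set E}) (e : E) (f : 'I_n).

Lemma ind_le1 M e : 0 <= ind M e <= 1.
Proof. by rewrite /ind; case: (e \in M). Qed.

Lemma ind_flip f M e : perfect_matching M -> bw_edges G f \subset M ->
  ind ((M :\: bw_edges G f) :|: wb_edges G f) e =
  ind M e - (face e == Some f : nat)%:Z + (lface e == Some f : nat)%:Z.
Proof.
move=> pM /subsetP sub.
have bwM x : face x = Some f -> x \in M by move=> fx; apply: sub; rewrite inE fx.
rewrite /ind !inE.
case: (eqVneq (face e) (Some f)) => [fe|nfe] /=.
  by rewrite (bwM _ fe); case: (_ == _).
case: (eqVneq (lface e) (Some f)) => [le|nle] /=; last by rewrite orbF subr0 addr0.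
rewrite orbT; suff /negbTE -> : e \notin M by [].
(* At its white endpoint [e] follows an edge with [f] on its right. That edge belongs to [M], which
   leaves no room for [e]. *)
apply/negP => eM; move: nfe; rewrite (@matching_uniq _ _ M white ((cw^-1)%g e) e) //.
- by rewrite -[face _]/(lface e) le eqxx.
- exact: bwM.
- by rewrite porbit_sym porbit_stepV porbit_id.
Qed.

(** The flip is the change of potential by -1 at [f] and 0 elsewhere; the vertex conditions then
    follow from [matching_of_height]. *)
Lemma down_flip_ex f M : perfect_matching M -> bw_edges G f \subset M ->
  exists N, down_flip f M N.
Proof.
move=> pM sub; set N := (M :\: bw_edges G f) :|: wb_edges G f.
exists N; rewrite /down_flip pM sub eqxx !andbT /=.
pose k o := - (o == Some f : nat)%:Z.
have kE e : ind N e = ind M e + k (face e) - k (lface e).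
  by rewrite ind_flip // /k opprK.
have [e|N' pN' N'E] := matching_of_height (k := k) pM.
  by rewrite -kE ind_le1.
suff -> : N = N' by [].
apply/setP => e; move: (kE e); rewrite -N'E /ind.
by case: (e \in N); case: (e \in N').
Qed.

Lemma down_flip_height f M N : used G f -> down_flip f M N ->
  height M N =1 fun g => (g == f : nat)%:Z.
Proof.
move=> uf /and4P[pM pN sub /eqP NE]; apply: height_eq; split=> [e|g ug].
  rewrite NE ind_flip //.
  have oE o : outer_ext (fun g => (g == f : nat)%:Z) o = (o == Some f : nat)%:Z.
    by case: o.
  rewrite !oE; lia.
by case: eqP ug => [->|//]; rewrite uf.
Qed.

Lemma down_flip_unused f M N : ~~ used G f -> down_flip f M N -> N = M.
Proof.
move=> uf /and4P[_ _ _ /eqP ->]; apply/setP => e; rewrite !inE.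
case: eqP => [/used_face|_]; first by move=> u; rewrite u in uf.
by case: eqP => [/used_lface|_]; rewrite ?orbF // => u; rewrite u in uf.
Qed.

Lemma down_flip_height_ge0 f M N g : down_flip f M N -> 0 <= height M N g.
Proof.
case: (boolP (used G f)) => uf df; first by rewrite (down_flip_height uf df).
by rewrite (down_flip_unused uf df) height_refl.
Qed.

Lemma pm_le_height M N : perfect_matching N -> pm_le M N ->
  perfect_matching M /\ forall f, 0 <= height N M f.
Proof.
move=> pN /connectP[p].
elim: p N pN => [|N' p IH] N pN /=.
  by move=> _ ->; split=> // f; rewrite height_refl.
case/andP=> /existsP[g df] pth lst.
have pN' : perfect_matching N' by case/and4P: df.
have [pM H] := IH _ pN' pth lst; split=> // f.
by rewrite (height_trans f pN pN' pM) addr_ge0 // (down_flip_height_ge0 _ df).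
Qed.

Definition total_height M N : int := \sum_f height M N f.

Lemma total_height_trans M N P : perfect_matching M -> perfect_matching N ->
  perfect_matching P ->
  total_height M P = total_height M N + total_height N P.
Proof.
move=> pM pN pP; rewrite -big_split; apply: eq_bigr => f _; exact: height_trans.
Qed.

Lemma pm_lt_total M N : perfect_matching N -> pm_lt M N ->
  perfect_matching M /\ 1 <= total_height N M.
Proof.
move=> pN /andP[ne /(pm_le_height pN)[pM H]]; split=> //.
rewrite -gtz0_ge1 lt_neqAle sumr_ge0 // andbT.
apply: contra ne => /eqP/esym t0; apply/eqP/esym; apply: height0_eq => // f.
by apply: (psumr_eq0P _ t0) => // g _.
Qed.

Lemma down_flip_total f M N : used G f -> down_flip f M N -> total_height M N = 1.
Proof.
move=> uf df; rewrite /total_height (bigD1 f) //= big1 ?addr0.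
  by rewrite (down_flip_height uf df) eqxx.
by move=> g /negbTE gf; rewrite (down_flip_height uf df) gf.
Qed.

(** The total height drops by exactly one at a flip and by at least one at every strict step, so no
    matching fits in between. *)
Lemma down_flip_covered f M N : used G f -> down_flip f N M -> pm_covered M N.
Proof.
move=> uf df; have [pN pM _ _] := and4P df.
have neMN : M != N.
  apply/eqP => eMN; have := down_flip_total uf df; rewrite eMN.
  by rewrite /total_height big1 // => g _; rewrite height_refl.
have leMN : pm_le M N by apply: connect1; apply/existsP; exists f.
rewrite /pm_covered /pm_lt neMN leMN /=.
apply/existsP => -[P /andP[ltMP ltPN]].
have [pP t1] := pm_lt_total pN ltPN.
have [_ t2] := pm_lt_total pP ltMP.
have := total_height_trans pN pP pM; rewrite (down_flip_total uf df).
lia.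
Qed.

End Flips.

(** * Descent to the minimal matching and monomials of chains *)

Section Lattice.

Variables (n : nat) (G : plane_bigraph n).
Hypothesis star : property_star G.
Notation E := (edge G).
Notation cb := (ccw G black).
Notation cw := (ccw G white).
Implicit Types (M N P : {set E}) (e : E) (f : 'I_n).

(* Among the faces of maximal height, one minimising the sum of all heights
   relative to N is flippable: across an edge outside N that sum drops strictly
   from right to left, since some matching contains the edge. *)
Lemma flip_exists M N f0 : perfect_matching M -> perfect_matching N ->
  0 < height N M f0 ->
  exists f, exists2 N', used G f /\ 0 < height N M f & down_flip f N N'.
Proof.
move=> pM pN h0.
have [fm _ Hm] := @exists_minimizer _ predT (fun f => - height N M f) f0 isT.
pose pot f : int := \sum_(P | perfect_matching P) height P N f.
have [f /eqP fmax fmin] := @exists_minimizer _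
  (fun f => height N M f == height N M fm) pot fm (eqxx _).
have hle g : height N M g <= height N M f by rewrite fmax; have := Hm g isT; lia.
have hf : 0 < height N M f by exact: lt_le_trans h0 (hle _).
have uf : used G f.
  by apply: contraLR hf => uf; rewrite height_unused // ltxx.
suff sub : bw_edges G f \subset N.
  by have [N' df] := down_flip_ex pN sub; exists f; exists N'.
apply/subsetP => e; rewrite inE => /eqP fe; apply: contraT => eN.
have := heightE e pN pM; rewrite fe /= /ind (negbTE eN) /= => He.
case le: (lface e) => [g|]; last by move: He hf; rewrite le /=; lia.
have hg : height N M g = height N M f.
  by have := hle g; move: He; rewrite le /=; lia.
have := fmin g; rewrite hg fmax eqxx => /(_ isT).
suff : pot g < pot f by move=> /lt_geF ->.
have [P0 pP0 eP0] := star e.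
have dif P : perfect_matching P -> height P N f = height P N g + ind P e.
  move=> pP; have := heightE e pP pN; rewrite fe le /= {2}/ind (negbTE eN) /=; lia.
rewrite /pot (bigD1 P0) //= [X in _ < X](bigD1 P0) //= ltr_leD //.
  by rewrite dif // /ind eP0; lia.
apply: ler_sum => P /andP[pP _]; rewrite dif //.
by have := ind_le1 P e; lia.
Qed.

(** A matching of least total height over a fixed reference works: a negative relative height
    somewhere would allow a further down-flip by [flip_exists]. *)
Lemma minimal_matching_ex : exists2 M, perfect_matching M &
  forall N f, perfect_matching N -> 0 <= height N M f.
Proof.
have [e0 _] := outer_face G; have [P0 pP0 _] := star e0.
have [M pM Mmin] := @exists_minimizer _ (@perfect_matching n G)
  (fun M => total_height M P0) P0 pP0.
exists M => // N f pN; rewrite leNgt; apply/negP => hneg.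
have hpos : 0 < height M N f by rewrite height_sym // oppr_gt0.
have [g [M' [ug _] df]] := flip_exists pN pM hpos.
have pM' : perfect_matching M' by case/and4P: df.
have := Mmin _ pM'; rewrite (total_height_trans pM pM' pP0) (down_flip_total ug df).
lia.
Qed.

(** As long as [N] differs from [M], some height is positive and [flip_exists] provides a down-flip
    of [N]. The total height over [M] is nonnegative and drops by one each time, so the descent
    ends. *)
Lemma chain_of_height M N : perfect_matching M -> perfect_matching N ->
  (forall P f, perfect_matching P -> 0 <= height P M f) ->
  exists gs, saturated_chain M gs N /\ pm_le M N.
Proof.
move=> pM pN Mmin.
have [k] := ubnP (absz (total_height N M)); elim: k N pN => // k IH N pN tk.
case: (eqVneq N M) => [->|neNM].
  by exists [::]; split; [apply: chain_nil | apply: connect0].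
have [f hf] : exists f, 0 < height N M f.
  apply/existsP; apply: contraT; rewrite negb_exists => /forallP H.
  case/negP: neNM; apply/eqP; apply: height0_eq => // f.
  by have := H f; have := Mmin N f pN; lia.
have [g [N' [ug _] df]] := flip_exists pM pN hf.
have pN' : perfect_matching N' by case/and4P: df.
have tN' := total_height_trans pN pN' pM.
rewrite (down_flip_total ug df) in tN'.
have t0 : 0 <= total_height N' M by apply: sumr_ge0 => x _; exact: Mmin.
have [|gs [ch le]] := IH N' pN'; first by lia.
(* Chains are read upwards from [M], so the flip that starts the descent comes last. *)
exists (rcons gs g); split.
  elim: ch df {hf tN' t0 le tk IH pN' neNM} => [L|L1 L2 L3 g' gs' cov df' _ IH'] df.
    exact: chain_cons (down_flip_covered ug df) df (chain_nil _).
  by rewrite rcons_cons; apply: chain_cons cov df' _; apply: IH'.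
apply: connect_trans le; apply: connect1; by apply/existsP; exists g.
Qed.

Lemma hat0_min : is_minimum (hat0 G).
Proof.
have [M pM Mmin] := minimal_matching_ex.
have minM : is_minimum M.
  rewrite /is_minimum pM; apply/forallP => N; apply/implyP => pN.
  by have [gs []] := chain_of_height pM pN Mmin.
by rewrite /hat0; case: pickP => [//|/(_ M)]; rewrite minM.
Qed.

Lemma hat0_pm : perfect_matching (hat0 G).
Proof. by case/andP: hat0_min. Qed.

Lemma hat0_height N f : perfect_matching N -> 0 <= height N (hat0 G) f.
Proof.
move=> pN; have /andP[_ /forallP/(_ N)] := hat0_min.
by rewrite pN => /(pm_le_height pN)[_].
Qed.

Definition height_monom M N : {mpoly int[n]} :=
  \prod_f 'X_f ^+ absz (height M N f).

(** Heights add up along the chain and each flip contributes 1 at its own face, so the product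
    depends only on the endpoints. This is the independence of chains that makes the choice in [mrk]
    harmless. *)
Lemma saturated_chain_monom M gs N : saturated_chain M gs N -> perfect_matching M ->
  [/\ perfect_matching N, forall f, 0 <= height N M f &
      \prod_(g <- gs) 'X_g = height_monom N M].
Proof.
elim=> {M gs N} [M|M N M' g gs cov df _ IH] pM.
  split=> // [f|]; first by rewrite height_refl.
  by rewrite big_nil /height_monom big1 // => f _; rewrite height_refl expr0.
have pN : perfect_matching N by case/and4P: df.
have [pM' h0 eq] := IH pN.
have ug : used G g.
  apply: contraT => /down_flip_unused/(_ df) eNM; move: cov.
  by rewrite eNM /pm_covered /pm_lt eqxx.
split=> // [f|].
  by rewrite (height_trans f pM' pN pM) addr_ge0 // (down_flip_height_ge0 _ df).
rewrite big_cons eq /height_monom (bigD1 g) //= mulrA [RHS](bigD1 g) //=.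
congr (_ * _).
  rewrite -exprS (height_trans g pM' pN pM) (down_flip_height ug df) eqxx.
  by congr (_ ^+ _); have := h0 g; lia.
apply: eq_bigr => f /negbTE fg.
by rewrite (height_trans f pM' pN pM) (down_flip_height ug df) fg addr0.
Qed.

Lemma mrkE M : perfect_matching M -> mrk M = height_monom M (hat0 G).
Proof.
move=> pM; rewrite /mrk.
have [gs [ch _]] := chain_of_height hat0_pm pM (fun P f => @hat0_height P f).
have chE : saturated_chain (hat0 G)
  (epsilon (inhabits [::]) (fun gs => saturated_chain (hat0 G) gs M)) M.
  by apply: (epsilon_spec (inhabits [::]) (fun gs => saturated_chain (hat0 G) gs M)); exists gs.
by have [_ _] := saturated_chain_monom chE hat0_pm.
Qed.

Lemma dimer_polyE :
  dimer_poly G = \sum_(M | perfect_matching M) height_monom M (hat0 G).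
Proof. by apply: eq_bigr => M; exact: mrkE. Qed.

(** If [M] has positive height at [f] over [hat0], the descent from [M] to [hat0] must flip [f] at
    some moment, and just before it all black-white edges of [f] are present. It remains to find
    such an [M]. *)
Lemma flippable_ex f : used G f ->
  exists2 M, perfect_matching M & bw_edges G f \subset M.
Proof.
move=> uf; suff [M pM hM] : exists2 M, perfect_matching M & 0 < height M (hat0 G) f.
  have [k] := ubnP (absz (total_height M (hat0 G))); elim: k M pM hM => // k IH M pM hM tk.
  have [g [N [ug _] df]] := flip_exists hat0_pm pM hM.
  have pN : perfect_matching N by case/and4P: df.
  case: (eqVneq f g) => [->|fg]; first by exists M => //; case/and4P: df.
  apply: (IH N pN).
    move: hM; rewrite (height_trans f pM pN hat0_pm) (down_flip_height ug df).
    by rewrite (negbTE fg) add0r.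
  have := total_height_trans pM pN hat0_pm; rewrite (down_flip_total ug df) => tE.
  have t0 : 0 <= total_height N (hat0 G) by apply: sumr_ge0 => x _; exact: hat0_height.
  by lia.
case: (boolP [exists M, perfect_matching M && (0 < height M (hat0 G) f)]).
  by case/existsP=> M /andP[pM hM]; exists M.
rewrite negb_exists => /forallP H.
(* Suppose that all heights at [f] vanish. Comparing [hat0] with a matching through a black-white
   edge of [f], whose height at the left face is nonnegative, shows that this edge is in [hat0].
   Then [hat0] can be flipped down at [f], to height -1. *)
have h0 M : perfect_matching M -> height M (hat0 G) f = 0.
  by move=> pM; have := H M; have := hat0_height f pM; rewrite pM /=; lia.
have sub : bw_edges G f \subset hat0 G.
  apply/subsetP => e; rewrite inE => /eqP fe.
  have [M pM eM] := star e; have := heightE e pM hat0_pm.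
  rewrite fe /= h0 // {1}/ind eM /=.
  have : 0 <= outer_ext (height M (hat0 G)) (lface e).
    by case: (lface e) => //= g; exact: hat0_height.
  by rewrite /ind; case: (e \in hat0 G) => //=; lia.
have [N df] := down_flip_ex hat0_pm sub.
have pN : perfect_matching N by case/and4P: df.
have := hat0_height f pN; rewrite height_sym ?hat0_pm //.
by rewrite (down_flip_height uf df) eqxx.
Qed.

End Lattice.

(** * Forced edges, arrows between faces and the vectors [hvec] *)

Section StarFacts.

Variables (n : nat) (G : plane_bigraph n).
Hypothesis star : property_star G.
Notation E := (edge G).
Notation cb := (ccw G black).
Notation cw := (ccw G white).
Implicit Types (M N P : {set E}) (e : E) (f g : 'I_n).

(** An edge adjacent to [e] lies in some matching, which also contains [e]; hence it equals [e].
    Connectivity does the rest. *)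
Lemma forced_single e : (forall M, perfect_matching M -> e \in M) ->
  forall e', e' = e.
Proof.
move=> eM e'.
have fixe c : ccw G c e = e.
  have [M pM zM] := star (ccw G c e).
  exact: (matching_uniq pM (eM _ pM) zM (porbit_self _ _)).
have inv c x : (ccw G c x == e) = (x == e).
  by rewrite -{1}(fixe c) (inj_eq perm_inj).
by apply/eqP; rewrite (@ccw_invariant_const _ G _ (fun x => x == e) _ _ e' e) // => x; exact: inv.
Qed.

Lemma const_forced e :
  (forall M N, perfect_matching M -> perfect_matching N -> ind M e = ind N e) ->
  forall M, perfect_matching M -> e \in M.
Proof.
move=> H M pM; have [N pN eN] := star e.
by have := H M N pM pN; rewrite /ind eN; case: (e \in M).
Qed.

(** Equal faces on both sides mean that no height jumps across [e], so [e] is in all matchings or in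
    none, hence in all. The graph is then this single edge, whose face is unbounded. *)
Lemma lface_neq_face e f : face e = Some f -> lface e <> Some f.
Proof.
move=> fe le; have [e0 fe0] := outer_face G.
suff e0E : e0 = e by rewrite e0E fe in fe0.
apply: forced_single; apply: const_forced => M N pM pN.
by have := heightE e pM pN; rewrite fe le; lia.
Qed.

Lemma wb_edgesE f : wb_edges G f = [set cw e | e in bw_edges G f].
Proof.
apply/setP => e; apply/idP/imsetP => [|[x]]; rewrite inE.
  by move=> le; exists ((cw^-1)%g e); rewrite ?permKV // inE.
by move=> fx ->; rewrite inE lface_cw.
Qed.

Lemma card_wb_edges f : #|wb_edges G f| = #|bw_edges G f|.
Proof. by rewrite wb_edgesE card_imset //; exact: perm_inj. Qed.

Lemma disjoint_bw_wb f : [disjoint bw_edges G f & wb_edges G f].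
Proof.
rewrite -setI_eq0; apply/eqP/setP => e; rewrite !inE.
by apply/negbTE/andP => -[/eqP fe /eqP le]; exact: lface_neq_face fe le.
Qed.

Lemma card_face_edges f : #|face_edges G f|./2 = #|bw_edges G f|.
Proof.
rewrite /face_edges cardsU; have := disjoint_bw_wb f.
by rewrite -setI_eq0 => /eqP ->; rewrite cards0 subn0 card_wb_edges addnn doubleK.
Qed.

Lemma card_matching_face M f : #|M :&: face_edges G f|%:Z =
  \sum_(e in bw_edges G f) ind M e + \sum_(e in wb_edges G f) ind M e.
Proof.
have cE (A : {set E}) : \sum_(e in A) ind M e = #|M :&: A|%:Z.
  rewrite -sum1_card (big_morph Posz PoszD (erefl 0%:Z)) /=.
  rewrite [LHS]big_mkcond [RHS]big_mkcond /=; apply: eq_bigr => e _.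
  by rewrite inE /ind andbC; case: (e \in A); case: (e \in M).
rewrite !cE /face_edges setIUr cardsU.
have -> : M :&: bw_edges G f :&: (M :&: wb_edges G f) = set0.
  apply/eqP; rewrite setI_eq0; apply: disjointW (disjoint_bw_wb f);
  exact: subsetIr.
by rewrite cards0 subn0 PoszD.
Qed.

Definition arrows f g : nat :=
  #|[set e : E | (face e == Some f) && (lface e == Some g)]|.

(** The net number of arrows, which is all that contractions preserve. *)
Definition beta f g : int := (arrows f g)%:Z - (arrows g f)%:Z.

Lemma outer_ext_sum (h : 'I_n -> int) o :
  outer_ext h o = \sum_g (o == Some g : nat)%:Z * h g.
Proof.
case: o => [f|] /=; last by rewrite big1 // => g _; rewrite mul0r.
rewrite (bigD1 f) //= big1 ?eqxx ?mul1r ?addr0 // => g /negbTE gf.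
by rewrite -[Some f == _]/(f == g) eq_sym gf mul0r.
Qed.

Lemma sum_bw_lface (h : 'I_n -> int) f :
  \sum_(e in bw_edges G f) outer_ext h (lface e) = \sum_g (arrows f g)%:Z * h g.
Proof.
under eq_bigr do rewrite outer_ext_sum.
rewrite exchange_big /=; apply: eq_bigr => g _.
rewrite -mulr_suml; congr (_ * _).
rewrite /arrows -sum1_card (big_morph Posz PoszD (erefl 0%:Z)) /=.
rewrite [LHS]big_mkcond [RHS]big_mkcond /=; apply: eq_bigr => e _.
by rewrite !inE; case: (face e == _); case: (lface e == _).
Qed.

Lemma sum_wb_face (h : 'I_n -> int) f :
  \sum_(e in wb_edges G f) outer_ext h (face e) = \sum_g (arrows g f)%:Z * h g.
Proof.
under eq_bigr do rewrite outer_ext_sum.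
rewrite exchange_big /=; apply: eq_bigr => g _.
rewrite -mulr_suml; congr (_ * _).
rewrite /arrows -sum1_card (big_morph Posz PoszD (erefl 0%:Z)) /=.
rewrite [LHS]big_mkcond [RHS]big_mkcond /=; apply: eq_bigr => e _.
by rewrite !inE; case: (face e == _); case: (lface e == _).
Qed.

(** Summing the jumps of the height over the boundary of [f], the multiples of the height at [f]
    cancel, as there are equally many edges of both kinds. For the quiver of [G] this says that
    multiplication by the product of the [yhat_g ^ height M N g] moves the exponents of the cluster
    from [hvec N] to [hvec M]. *)
Lemma hvec_height M N f : perfect_matching M -> perfect_matching N ->
  hvec M f - hvec N f = \sum_g beta f g * height M N g.
Proof.
move=> pM pN; rewrite !ffunE !card_matching_face.
set h := height M N.
have bwE : \sum_(e in bw_edges G f) ind M e = \sum_(e in bw_edges G f) ind N e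
    + #|bw_edges G f|%:Z * h f - \sum_g (arrows f g)%:Z * h g.
  rewrite -sum_bw_lface -addrA -sum1_card (big_morph Posz PoszD (erefl 0%:Z)) /=.
  rewrite mulr_suml -sumrB -big_split /=; apply: eq_bigr => e; rewrite inE => /eqP fe.
  by have := heightE e pM pN; rewrite fe -/h /=; lia.
have wbE : \sum_(e in wb_edges G f) ind M e = \sum_(e in wb_edges G f) ind N e
    - #|bw_edges G f|%:Z * h f + \sum_g (arrows g f)%:Z * h g.
  rewrite -sum_wb_face -card_wb_edges -addrA -sum1_card (big_morph Posz PoszD (erefl 0%:Z)) /=.
  rewrite mulr_suml -sumrN -!big_split /=; apply: eq_bigr => e; rewrite inE => /eqP le.
  by have := heightE e pM pN; rewrite le -/h /=; lia.
have -> : \sum_g beta f g * h g =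
   \sum_g (arrows f g)%:Z * h g - \sum_g (arrows g f)%:Z * h g.
  by rewrite -sumrB; apply: eq_bigr => g _; rewrite /beta mulrBl.
by rewrite bwE wbE; ring.
Qed.

(** The boundary of [f] splits into pairs [e], [cw e] sharing a white vertex, and a matching
    contains at most one edge of each pair. *)
Lemma hvec_ge M f : perfect_matching M -> -1 <= hvec M f.
Proof.
move=> pM; rewrite ffunE card_matching_face card_face_edges wb_edgesE.
rewrite big_imset /=; last by move=> x y _ _; exact: perm_inj.
rewrite -big_split /=; set s := (X in _ - X - 1).
suff : s <= #|bw_edges G f|%:Z by clearbody s; lia.
rewrite {}/s.
rewrite -sum1_card (big_morph Posz PoszD (erefl 0%:Z)) /=; apply: ler_sum => e.
rewrite inE => /eqP fe.
rewrite /ind; case: (boolP (e \in M)) => eM; case: (boolP (cw e \in M)) => cM //.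
have cE := matching_uniq pM eM cM (porbit_self _ _).
by case: (lface_neq_face fe); rewrite -{1}cE lface_cw.
Qed.

Lemma hvec_flippable M f : perfect_matching M -> bw_edges G f \subset M ->
  hvec M f = -1.
Proof.
move=> pM /subsetP sub; apply/eqP; rewrite eq_le hvec_ge // andbT.
rewrite ffunE card_matching_face card_face_edges.
have -> : \sum_(e in bw_edges G f) ind M e = #|bw_edges G f|%:Z.
  rewrite -sum1_card (big_morph Posz PoszD (erefl 0%:Z)) /=.
  by apply: eq_bigr => e /sub eM; rewrite /ind eM.
have : 0 <= \sum_(e in wb_edges G f) ind M e.
  by apply: sumr_ge0 => e _; case/andP: (ind_le1 M e).
by lia.
Qed.

Lemma hvec_min f : used G f -> exists2 M : {set E}, perfect_matching M & hvec M f = -1.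
Proof.
move=> uf; have [M pM sub] := flippable_ex star uf.
by exists M; rewrite ?hvec_flippable.
Qed.

(** Without bounded faces all heights vanish, so there is only one matching and every edge is
    forced. *)
Lemma no_used_single : (forall f, ~~ used G f) -> #|E| = 1%N.
Proof.
move=> nu; have [e0 _] := outer_face G.
apply/eqP; rewrite -cardsT; apply/cards1P; exists e0; apply/setP => e; rewrite !inE.
apply/esym/eqP; apply: forced_single; apply: const_forced => M N pM pN.
suff -> : M = N by [].
by apply: height0_eq => // f; apply: height_unused.
Qed.

End StarFacts.

(** * Moves *)

Lemma sum_codom (T T' : finType) (R : nmodType) (i : T' -> T) (P : pred T) (F : T -> R) :
  injective i -> (forall e, (e \in codom i) = P e) ->
  \sum_(e | P e) F e = \sum_x F (i x).
Proof.
move=> iI iP; have -> : \sum_x F (i x) = \sum_(x in [set: T']) F (i x).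
  by apply: eq_bigl => x; rewrite inE.
rewrite -(big_imset _ (in2W iI)) /=; apply: eq_bigl => e; rewrite -iP.
apply/codomP/imsetP => [[x ->]|[x _ ->]]; last by exists x.
by exists x.
Qed.

(** Reindexing along a relation: moves relate matchings by agreement on common edges, without a
    preferred map in either direction. *)
Lemma sum_rel (I J : finType) (R : nmodType) (P : pred I) (Q : pred J)
    (r : I -> J -> bool) (F : I -> R) (F' : J -> R) :
  (forall i, P i -> exists2 j, Q j & r i j) ->
  (forall j, Q j -> exists2 i, P i & r i j) ->
  (forall i j j', P i -> Q j -> Q j' -> r i j -> r i j' -> j = j') ->
  (forall i i' j, P i -> P i' -> Q j -> r i j -> r i' j -> i = i') ->
  (forall i j, P i -> Q j -> r i j -> F i = F' j) ->
  \sum_(i | P i) F i = \sum_(j | Q j) F' j.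
Proof.
move=> exQ exP fun_r inj_r FF'.
transitivity (\sum_(i | P i) \sum_(j | Q j && r i j) F' j).
  apply: eq_bigr => i Pi; have [j0 Qj0 rj0] := exQ i Pi.
  rewrite (big_pred1 j0) => [|j /=]; first exact: FF'.
  apply/andP/eqP => [[Qj rj]|-> //]; exact: (fun_r i).
rewrite (exchange_big_dep Q) /=; last by move=> i j _ /andP[].
apply: eq_bigr => j Qj; have [i0 Pi0 ri0] := exP j Qj.
rewrite (big_pred1 i0) // => i /=; rewrite Qj /=.
apply/andP/eqP => [[Pi ri]|-> //]; exact: (inj_r i i0 j).
Qed.

(** Injectivity and functionality need not be demanded: equal heights imply them, because matchings
    of relative height 0 coincide. *)
Definition matching_corr n (G H : plane_bigraph n) (r : {set edge G} -> {set edge H} -> bool) :=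
  [/\ forall M, perfect_matching M -> exists2 M', perfect_matching M' & r M M',
      forall M', perfect_matching M' -> exists2 M, perfect_matching M & r M M'
    & forall M N M' N', perfect_matching M -> perfect_matching N ->
        perfect_matching M' -> perfect_matching N' -> r M M' -> r N N' ->
        height M' N' =1 height M N].

(* [pw g k] stands for [y_g ^ k].  Over a field this is the dimer polynomial; over
   the tropical semiring it computes the minimal exponents of a cluster. *)
Definition dimer_sum n (R : comPzSemiRingType) (pw : 'I_n -> int -> R)
    (G : plane_bigraph n) (N : {set edge G}) : R :=
  \sum_(M | perfect_matching M) \prod_g pw g (height M N g).

Lemma dimer_sum_corr n (R : comPzSemiRingType) (pw : 'I_n -> int -> R)
    (G H : plane_bigraph n) r N N' :
  @matching_corr n G H r -> perfect_matching N -> perfect_matching N' -> r N N' ->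
  dimer_sum pw N = dimer_sum pw N'.
Proof.
move=> [exH exG hE] pN pN' rN; apply: (@sum_rel _ _ _ _ _ r) => //.
- move=> M M' N1 pM pM' pN1 r1 r2; apply: height0_eq => // f.
  by rewrite (hE M M) // height_refl.
- move=> M M1 M' pM pM1 pM' r1 r2; apply: height0_eq => // f.
  by rewrite -(hE M M1 M' M') // height_refl.
by move=> M M' pM pM' rM; apply: eq_bigr => g _; rewrite (hE M N M' N').
Qed.

Lemma arrowsE n (G : plane_bigraph n) f g : arrows G f g =
  (\sum_(e : edge G) ((face e == Some f) && (lface e == Some g) : nat))%N.
Proof.
rewrite /arrows -sum1_card big_mkcond /=; apply: eq_bigr => e _; rewrite inE.
by case: (_ && _).
Qed.

Lemma degree_gt1_neq n (G : plane_bigraph n) (d : color) (e : edge G) : (2 <= degree d e)%N -> ccw G d e != e.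
Proof.
apply: contraL => /eqP fe; rewrite -ltnNge ltnS /degree.
suff -> : porbit (ccw G d) e = [set e] by rewrite cards1.
apply/setP => x; rewrite inE; apply/idP/eqP => [|->]; last exact: porbit_id.
have /subsetP sub : porbit (ccw G d) e \subset [set e].
  by apply: porbit_subset => [|y]; rewrite !inE // => /eqP ->; rewrite fe.
by move/sub; rewrite inE => /eqP.
Qed.

(** * Contraction of a vertex of degree 2 *)

Section Contraction.

Variables (n : nat) (G H : plane_bigraph n) (c : color) (e1 e2 : edge G).
Variable i : edge H -> edge G.
Notation s := (ccw G c).
Notation t := (ccw G (~~ c)).
Notation s' := (ccw H c).
Notation t' := (ccw H (~~ c)).
Hypothesis orb12 : porbit s e1 = [set e1; e2].
Hypothesis neq12 : e1 != e2.
Hypothesis diff12 : e2 \notin porbit t e1.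
Hypothesis deg1 : (2 <= degree (~~ c) e1)%N.
Hypothesis deg2 : (2 <= degree (~~ c) e2)%N.
Hypothesis i_inj : injective i.
Hypothesis i_codom : forall e, (e \in codom i) = (e \notin [set e1; e2]).
Hypothesis i_s : forall x, i (s' x) = s (i x).
Hypothesis i_t : forall x, i (t' x) =
  let y := t (i x) in if y == e1 then t e2 else if y == e2 then t e1 else y.
Hypothesis i_face : forall x, face x = face (i x).

Lemma s12 : s e1 = e2.
Proof.
have : s e1 \in [set e1; e2] by rewrite -orb12 porbit_self.
rewrite !inE => /orP[/eqP fe|/eqP //].
have /subsetP/(_ e2) : porbit s e1 \subset [set e1].
  by apply: porbit_subset => [|y]; rewrite !inE // => /eqP ->; rewrite fe.
by rewrite orb12 !inE eqxx orbT eq_sym (negbTE neq12) => /(_ isT).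
Qed.

Lemma s21 : s e2 = e1.
Proof.
have : s e2 \in [set e1; e2] by rewrite -orb12 -s12 !porbit_step porbit_id.
rewrite !inE => /orP[/eqP //|/eqP]; rewrite -{2}s12 => /perm_inj e21.
by case/eqP: neq12.
Qed.

Lemma face_e1 : face e1 = lface e2.
Proof.
case: (c) s12 s21 => [a b|a b]; first by rewrite -face_cb b.
by rewrite -lface_cw a.
Qed.

Lemma face_e2 : face e2 = lface e1.
Proof.
case: (c) s12 s21 => [a b|a b]; first by rewrite -face_cb a.
by rewrite -lface_cw b.
Qed.

Lemma codom_iP e : e \notin [set e1; e2] -> exists x, e = i x.
Proof. by rewrite -i_codom => /codomP. Qed.

Lemma i_notin x : i x \notin [set e1; e2].
Proof. by rewrite -i_codom codom_f. Qed.

Lemma t_e1 : t e1 \notin [set e1; e2].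
Proof.
rewrite !inE (negbTE (degree_gt1_neq deg1)) /=.
by apply: contraNneq diff12 => <-; exact: porbit_self.
Qed.

Lemma t_e2 : t e2 \notin [set e1; e2].
Proof.
rewrite !inE (negbTE (degree_gt1_neq deg2)) orbF.
apply: contraNneq diff12 => te; rewrite porbit_sym.
by rewrite -[in X in X \in _]te porbit_self.
Qed.

Lemma s_notin e : (s e \in [set e1; e2]) = (e \in [set e1; e2]).
Proof. by rewrite -orb12 porbit_step. Qed.

Lemma contraction_lface x : lface x = lface (i x).
Proof.
rewrite -face_cb i_face -(face_cb (i x)).
move: i_s i_t face_e1 face_e2; case: (c) => Hs Ht f1 f2; first by rewrite Hs.
rewrite Ht /=; case: eqP => [->|_]; first by rewrite f1 -face_cb.
by case: eqP => [->|_] //; rewrite f2 -face_cb.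
Qed.

Lemma contraction_used f : used G f = used H f.
Proof.
apply/existsP/existsP => [[e /eqP fe]|[x /eqP fx]]; last first.
  by exists (i x); rewrite -i_face fx.
have viaP e' : e' \notin [set e1; e2] -> face e' = Some f ->
    exists x : edge H, face x == Some f.
  by case/codom_iP=> x ->; rewrite -i_face => fx; exists x; rewrite fx.
case: (boolP (e \in [set e1; e2])) => [|/viaP]; last exact.
rewrite !inE; case/orP => /eqP eE; rewrite eE in fe.
  rewrite -face_step in fe.
  move: fe t_e1 t_e2 s12 s_notin; case: (c) viaP => viaP fe T1 T2 S12 S;
    apply: (viaP _ _ fe); first by rewrite S.
  by rewrite S12.
rewrite -face_step in fe.
move: fe t_e1 t_e2 s21 s_notin; case: (c) viaP => viaP fe T1 T2 S12 S;
  apply: (viaP _ _ fe); first by rewrite S.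
by rewrite S12.
Qed.

Lemma sum_contraction (R : nmodType) (F : edge G -> R) :
  \sum_e F e = F e1 + F e2 + \sum_x F (i x).
Proof.
rewrite (bigD1 e1) //= (bigD1 e2) /=; last by rewrite eq_sym.
rewrite addrA; congr (_ + _); apply: sum_codom => // e.
by rewrite i_codom !inE negb_or.
Qed.

(** Each of [e1], [e2] has on its right the face that the other has on its left. Their arrows are
    opposite and cancel in [beta], although [arrows] may change. *)
Lemma contraction_beta f g : beta G f g = beta H f g.
Proof.
rewrite /beta !arrowsE !sum_contraction /=.
under [in RHS]eq_bigr do rewrite i_face contraction_lface.
under [X in _ = _ - X%:Z]eq_bigr do rewrite i_face contraction_lface.
rewrite face_e1 face_e2 ![(lface e1 == Some f) && _]andbC.
rewrite ![(lface e2 == Some f) && _]andbC.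
set a := (_ && _); set b := (_ && _).
move: (\sum_x _)%N (\sum_x _)%N => u v; move: a b => a b.
lia.
Qed.

Lemma i_porbit_s x : i @: porbit s' x = porbit s (i x).
Proof.
apply/eqP; rewrite eqEsubset; apply/andP; split.
  apply/subsetP => _ /imsetP[y yx ->].
  have /subsetP/(_ y yx) : porbit s' x \subset [set z | i z \in porbit s (i x)].
    apply: porbit_subset => [|z]; rewrite !inE ?porbit_id //.
    by rewrite i_s porbit_step.
  by rewrite inE.
apply: porbit_subset => [|_ /imsetP[y yx ->]]; first by rewrite imset_f ?porbit_id.
by rewrite -i_s imset_f // porbit_step.
Qed.

Definition merged := porbit t e1 :|: porbit t e2.

Lemma merged_step e : (t e \in merged) = (e \in merged).
Proof. by rewrite !inE !porbit_step. Qed.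

Lemma mem_merged1 : e1 \in merged. Proof. by rewrite inE porbit_id. Qed.
Lemma mem_merged2 : e2 \in merged. Proof. by rewrite inE porbit_id orbT. Qed.

Lemma i_porbit_t_out x : i x \notin merged -> i @: porbit t' x = porbit t (i x).
Proof.
move=> ixm.
have out z : z \in porbit t (i x) -> z \notin merged.
  move=> zx; apply: contra ixm; rewrite !inE => /orP[] zm; apply/orP; [left|right];
  apply: porbit_trans zm _; by rewrite porbit_sym.
have it z : i z \in porbit t (i x) -> i (t' z) = t (i z).
  move=> zx; rewrite i_t /=.
  have m := out (t (i z)); rewrite porbit_step in m.
  case: eqP => [E1|_]; first by have := m zx; rewrite E1 mem_merged1.
  by case: eqP => [E2|//]; have := m zx; rewrite E2 mem_merged2.
have sub z : z \in porbit t' x -> i z \in porbit t (i x).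
  move=> zx.
  have /subsetP/(_ z zx) : porbit t' x \subset [set z | i z \in porbit t (i x)].
    apply: porbit_subset => [|y]; rewrite !inE ?porbit_id // => yx.
    by rewrite it // porbit_step.
  by rewrite inE.
apply/eqP; rewrite eqEsubset; apply/andP; split.
  by apply/subsetP => _ /imsetP[y /sub yx ->].
apply: porbit_subset => [|_ /imsetP[y yx ->]]; first by rewrite imset_f ?porbit_id.
by rewrite -it ?sub // imset_f // porbit_step.
Qed.

(* The orbit cannot avoid the predecessor of [e1], hence contains [t e2]. *)
Lemma merged_cross x d d' : d \in [set e1; e2] -> d' \in [set e1; e2] -> d' != d ->
  d' \notin porbit t d ->
  (forall z, t (i z) = d -> i (t' z) = t d') ->
  (exists2 z, z \in porbit t' x & i z \in porbit t d) ->
  exists2 z, z \in porbit t' x & i z = t d'.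
Proof.
move=> dd dd' dne dn it [y yx yd].
case: (boolP [exists w, (w \in porbit t' x) && (t (i w) == d)]).
  case/existsP=> w /andP[wx /eqP wd]; exists (t' w); first by rewrite porbit_step.
  exact: it.
rewrite negb_exists => /forallP noW.
have : porbit t (i y) \subset [set z | (z \in porbit t d) && (z \in i @: porbit t' x)].
  apply: porbit_subset => [|z]; first by rewrite inE yd imset_f.
  rewrite !inE => /andP[zd /imsetP[w wx zw]]; rewrite porbit_step zd /= zw.
  have := noW w; rewrite wx /= => ntd.
  suff <- : i (t' w) = t (i w) by rewrite imset_f // porbit_step.
  have ntd' : t (i w) != d'.
    by apply: contraNneq dn => <-; rewrite porbit_step -zw.
  rewrite i_t /=; move: dd dd' dne ntd ntd'; rewrite !inE.
  by case/orP=> /eqP -> /orP[] /eqP ->; rewrite ?eqxx // => _ /negbTE -> /negbTE ->.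
move/subsetP/(_ d); rewrite porbit_sym => /(_ yd); rewrite inE porbit_id /=.
by case/imsetP=> z _ dz; move: dd; rewrite dz (negbTE (i_notin z)).
Qed.

(** Where the old rotation would meet [e1], the new one continues with [t e2], and where it would
    meet [e2], with [t e1]. By [merged_cross] an orbit touching one old vertex passes to the other
    and back; together with [e1] and [e2] it is then closed under [t], so it exhausts both. *)
Lemma i_porbit_t_in x : i x \in merged ->
  i @: porbit t' x = merged :\: [set e1; e2].
Proof.
move=> ixm; apply/eqP; rewrite eqEsubset; apply/andP; split.
  apply/subsetP => _ /imsetP[y yx ->]; rewrite inE i_notin /=.
  have /subsetP/(_ y yx) : porbit t' x \subset [set z | i z \in merged].
    apply: porbit_subset => [|z]; rewrite [_ \in [set _ | _]]inE // => zm; rewrite inE.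
    rewrite i_t /=; case: eqP => _; first by rewrite merged_step mem_merged2.
    case: eqP => _; first by rewrite merged_step mem_merged1.
    by rewrite merged_step.
  by rewrite inE.
have m1 : e1 \in [set e1; e2] by rewrite !inE eqxx.
have m2 : e2 \in [set e1; e2] by rewrite !inE eqxx orbT.
have n21 : e2 != e1 by rewrite eq_sym.
have d21 : e1 \notin porbit t e2 by rewrite porbit_sym.
have it1 z : t (i z) = e1 -> i (t' z) = t e2 by move=> E1; rewrite i_t /= E1 eqxx.
have it2 z : t (i z) = e2 -> i (t' z) = t e1.
  by move=> E2; rewrite i_t /= E2 (negbTE n21) eqxx.
have c1 := @merged_cross x e1 e2 m1 m2 n21 diff12 it1.
have c2 := @merged_cross x e2 e1 m2 m1 neq12 d21 it2.
have [[z1 z1x z1E] [z2 z2x z2E]] :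
   (exists2 z, z \in porbit t' x & i z = t e1) /\
   (exists2 z, z \in porbit t' x & i z = t e2).
  move: ixm; rewrite inE => /orP[] xm.
    have h2 : exists2 z, z \in porbit t' x & i z = t e2.
      by apply: c1; exists x; rewrite ?porbit_id.
    split=> //; apply: c2; have [z zx zE] := h2.
    by exists z => //; rewrite zE porbit_self.
  have h1 : exists2 z, z \in porbit t' x & i z = t e1.
    by apply: c2; exists x; rewrite ?porbit_id.
  split=> //; apply: c1; have [z zx zE] := h1.
  by exists z => //; rewrite zE porbit_self.
have cl : forall z, z \in i @: porbit t' x :|: [set e1; e2] ->
    t z \in i @: porbit t' x :|: [set e1; e2].
  move=> z; rewrite inE => /orP[/imsetP[w wx ->]|].
    have := i_t w; rewrite /=; case: eqP => [->|_]; first by rewrite inE m1 orbT.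
    case: eqP => [->|_]; first by rewrite inE m2 orbT.
    by move=> <-; rewrite inE imset_f // porbit_step.
  rewrite !inE => /orP[/eqP -> | /eqP ->]; first by rewrite -z1E imset_f.
  by rewrite -z2E imset_f.
apply/subsetP => z; rewrite inE => /andP[zn].
have sub d : d \in [set e1; e2] -> porbit t d \subset i @: porbit t' x :|: [set e1; e2].
  by move=> dm; apply: porbit_subset => //; rewrite inE dm orbT.
rewrite inE => /orP[] zm.
  by have := subsetP (sub _ m1) z zm; rewrite inE (negbTE zn) orbF.
by have := subsetP (sub _ m2) z zm; rewrite inE (negbTE zn) orbF.
Qed.

Definition contraction_rel (M : {set edge G}) (M' : {set edge H}) :=
  [forall x, (x \in M') == (i x \in M)].

Section Rel.
Variables (M : {set edge G}) (M' : {set edge H}).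
Hypothesis MM' : forall x, (x \in M') = (i x \in M).

Lemma sum_s_rel x : (\sum_(z in porbit s' x) (z \in M' : nat) =
  \sum_(z in porbit s (i x)) (z \in M : nat))%N.
Proof.
rewrite -i_porbit_s big_imset /=; last exact: in2W.
by apply: eq_bigr => z _; rewrite MM'.
Qed.

Lemma sum_t_rel_out x : i x \notin merged ->
  (\sum_(z in porbit t' x) (z \in M' : nat) =
   \sum_(z in porbit t (i x)) (z \in M : nat))%N.
Proof.
move=> xm; rewrite -i_porbit_t_out // big_imset /=; last exact: in2W.
by apply: eq_bigr => z _; rewrite MM'.
Qed.

(** The two old neighbours lose [e1] and [e2] when they merge; writing the loss on the left avoids
    truncated subtraction. *)
Lemma sum_t_rel_in x : i x \in merged ->
  (\sum_(z in porbit t' x) (z \in M' : nat) + (e1 \in M) + (e2 \in M) =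
   \sum_(z in porbit t e1) (z \in M : nat) + \sum_(z in porbit t e2) (z \in M : nat))%N.
Proof.
move=> xm.
have -> : (\sum_(z in porbit t' x) (z \in M' : nat) =
    \sum_(z in merged :\: [set e1; e2]) (z \in M : nat))%N.
  rewrite -(i_porbit_t_in xm) big_imset /=; last exact: in2W.
  by apply: eq_bigr => z _; rewrite MM'.
have -> : (\sum_(z in porbit t e1) (z \in M : nat) + \sum_(z in porbit t e2) (z \in M : nat)
    = \sum_(z in merged) (z \in M : nat))%N.
  rewrite /merged [RHS]big_mkcond [X in (X + _)%N]big_mkcond [X in (_ + X)%N]big_mkcond.
  rewrite -big_split /=; apply: eq_bigr => z _; rewrite inE.
  case: (boolP (z \in porbit t e1)) => z1; case: (boolP (z \in porbit t e2)) => z2 //=.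
    case/negP: diff12; apply: porbit_trans z1 _; by rewrite porbit_sym.
  by rewrite addn0.
rewrite [RHS](bigD1 e1) ?mem_merged1 //= [X in _ = (_ + X)%N](bigD1 e2) /=; last first.
  by rewrite mem_merged2 eq_sym.
rewrite -addnA addnC -addnA; congr (_ + (_ + _))%N.
apply: eq_bigl => z; rewrite !inE negb_or.
by case: (_ == _); case: (_ == _); rewrite ?andbT ?andbF.
Qed.
End Rel.

Lemma contraction_relP (M : {set edge G}) (M' : {set edge H}) :
  reflect (forall x, (x \in M') = (i x \in M)) (contraction_rel M M').
Proof. by apply: (iffP forallP) => H' x; apply/eqP. Qed.

Lemma sum_s12 (M : {set edge G}) : (\sum_(z in porbit s e1) (z \in M : nat) = (e1 \in M) + (e2 \in M))%N.
Proof.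
rewrite orb12 big_setU1 ?big_set1 //=; by rewrite inE.
Qed.

Lemma contraction_pm M M' : contraction_rel M M' -> perfect_matching M ->
  perfect_matching M'.
Proof.
move/contraction_relP=> MM' /perfect_matchingP pM; apply/perfect_matchingP => d x.
have [->|->] : d = c \/ d = ~~ c by case: (d) (c) => [] []; auto.
  by rewrite (sum_s_rel MM') pM.
case: (boolP (i x \in merged)) => xm; last by rewrite (sum_t_rel_out MM') // pM.
have := sum_t_rel_in MM' xm; rewrite !pM.
have := pM c e1; rewrite sum_s12.
lia.
Qed.

Lemma contraction_pm_ex M' : perfect_matching M' ->
  exists2 M, perfect_matching M & contraction_rel M M'.
Proof.
move=> /perfect_matchingP pM'.
(* The lift takes [e1], or [e2], exactly when no surviving edge of the matching covers its endpoint
   of color [~~ c]. *)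
pose out d := (\sum_(z in porbit t d | z != d) (z \in i @: M' : nat))%N.
pose M := [set z | if z == e1 then out e1 == 0%N else
   if z == e2 then out e2 == 0%N else z \in i @: M'].
have n1 x : (i x == e1) = false by have := i_notin x; rewrite !inE; case: eqP.
have n2 x : (i x == e2) = false by have := i_notin x; rewrite !inE orbC; case: eqP.
have MM' x : (x \in M') = (i x \in M).
  by rewrite inE n1 n2 mem_imset.
have n21 : (e2 == e1) = false by rewrite eq_sym (negbTE neq12).
have outE d : d \in [set e1; e2] -> (\sum_(z in porbit t d) (z \in M : nat) = (d \in M) + out d)%N.
  move=> dm; rewrite (bigD1 d) ?porbit_id //=; congr (_ + _)%N.
  apply: eq_bigr => z /andP[zd zn]; rewrite inE.
  case: eqP => [z1|_].
    move: dm zd zn; rewrite z1 !inE => /orP[]/eqP ->; rewrite ?eqxx //.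
    by rewrite porbit_sym (negbTE diff12).
  case: eqP => [z2|//].
  move: dm zd zn; rewrite z2 !inE => /orP[]/eqP ->; rewrite ?eqxx //.
  by rewrite (negbTE diff12).
have e1M : (e1 \in M) = (out e1 == 0%N) by rewrite inE eqxx.
have e2M : (e2 \in M) = (out e2 == 0%N) by rewrite inE n21 eqxx.
(* The merged vertex is covered once, so exactly one of the old neighbours is covered by a surviving
   edge, and exactly one of [e1], [e2] is taken. *)
have out12 : (out e1 + out e2 = 1)%N.
  have [x xE] := codom_iP t_e1.
  have xm : i x \in merged by rewrite -xE merged_step mem_merged1.
  have := sum_t_rel_in MM' xm; rewrite pM' !outE ?inE ?eqxx ?orbT //.
  lia.
exists M; last by apply/contraction_relP.
apply/perfect_matchingP => d e.
have [->|->] : d = c \/ d = ~~ c by case: (d) (c) => [] []; auto.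
  case: (boolP (e \in [set e1; e2])) => [|/codom_iP[x ->]]; last first.
    by rewrite -(sum_s_rel MM') pM'.
  rewrite -orb12 => /porbit_eq ->; rewrite sum_s12 e1M e2M.
  by move: out12; case: (out e1) => [|[|k]]; case: (out e2) => [|[|k']] //; lia.
case: (boolP (e \in merged)) => em; last first.
  have [x xE] : exists x, e = i x.
    apply: codom_iP; apply: contra em; rewrite !inE => /orP[] /eqP ->;
    by rewrite porbit_id ?orbT.
  by rewrite xE -(sum_t_rel_out MM') ?pM' -?xE.
have m1 : e1 \in [set e1; e2] by rewrite !inE eqxx.
have m2 : e2 \in [set e1; e2] by rewrite !inE eqxx orbT.
move: em; rewrite inE => /orP[] /porbit_eq ->; rewrite outE //.
  by rewrite e1M; move: out12; case: (out e1) => [|[|k]] //; lia.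
by rewrite e2M; move: out12; case: (out e2) => [|[|k]] //; lia.
Qed.

Lemma contraction_corr : matching_corr contraction_rel.
Proof.
split=> [M pM|M' pM'|M N M' N' pM pN pM' pN' /contraction_relP rM /contraction_relP rN].
- exists [set x | i x \in M]; last by apply/contraction_relP => x; rewrite inE.
  apply: (@contraction_pm M) => //; apply/contraction_relP => x; by rewrite inE.
- exact: contraction_pm_ex.
apply: height_eq; split=> [x|f]; last by rewrite -contraction_used; exact: height_unused.
by rewrite /ind rM rN i_face contraction_lface -heightE.
Qed.

(** The only new edges to reach are [e1] and [e2]. A matching through the surviving edge [t e2]
    omits [e2], hence contains [e1] at the vertex of degree 2; likewise with the indices
    exchanged. *)
Lemma contraction_star : property_star G <-> property_star H.
Proof.
split=> star.
  move=> x; have [M pM xM] := star (i x).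
  have [exH _ _] := contraction_corr; have [M' pM' rM] := exH M pM.
  by exists M' => //; rewrite (contraction_relP _ _ rM).
have old x : exists2 M, perfect_matching M & i x \in M.
  have [M' pM' xM] := star x.
  have [_ exG _] := contraction_corr; have [M pM rM] := exG M' pM'.
  by exists M => //; rewrite -(contraction_relP _ _ rM).
have other M : perfect_matching M -> (e1 \in M) = ~~ (e2 \in M).
  move/perfect_matchingP/(_ c e1); rewrite sum_s12.
  by case: (e1 \in M); case: (e2 \in M).
move=> e; case: (boolP (e \in [set e1; e2])) => [|/codom_iP[x ->]]; last exact: old.
rewrite !inE => /orP[] /eqP ->.
  have [x xE] := codom_iP t_e2; have [M pM xM] := old x; exists M => //.
  rewrite other //; apply: contra (degree_gt1_neq deg2) => e2M; apply/eqP.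
  by apply: (matching_uniq pM e2M _ (porbit_self _ _)); rewrite xE.
have [x xE] := codom_iP t_e1; have [M pM xM] := old x; exists M => //.
apply: contraT; rewrite -other // => e1M; case/eqP: (degree_gt1_neq deg1).
by apply: (matching_uniq pM e1M _ (porbit_self _ _)); rewrite xE.
Qed.

End Contraction.

Lemma porbit_skip (T T' : finType) (s : {perm T}) (s' : {perm T'}) (D : {set T})
    (k : T -> T') :
  (forall x, x \notin D -> skip s D x \notin D) ->
  (forall x, x \notin D -> s' (k x) = k (skip s D x)) ->
  forall x, x \notin D -> porbit s' (k x) = k @: (porbit s x :\: D).
Proof.
move=> skD ks x xD.
have skip_in z : z \in porbit s x -> skip s D z \in porbit s x.
  by rewrite /skip; case: ifP; rewrite !porbit_step.
apply/eqP; rewrite eqEsubset; apply/andP; split.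
  apply: porbit_subset => [|_ /imsetP[z zx ->]].
    by rewrite imset_f // inE xD porbit_id.
  by move: zx; rewrite inE => /andP[zD zx]; rewrite ks // imset_f // inE skD ?skip_in.
(* A deleted element has no image and is represented by a surviving predecessor. The set is closed
   under [s] because no two deleted elements are consecutive. *)
pose A := [set z | if z \in D then [exists w, [&& w \notin D, k w \in porbit s' (k x) & s w == z]]
                   else k z \in porbit s' (k x)].
have /subsetP sub : porbit s x \subset A.
  apply: porbit_subset => [|z]; first by rewrite inE (negbTE xD) porbit_id.
  rewrite inE; case: (boolP (z \in D)) => zD.
    case/existsP=> w /and3P[wD wx /eqP swz].
    have skw : skip s D w = s z by rewrite /skip swz zD.
    by rewrite inE -skw (negbTE (skD _ wD)) -ks // porbit_step.
  move=> zx; rewrite inE; case: (boolP (s z \in D)) => szD.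
    by apply/existsP; exists z; rewrite zD zx eqxx.
  have -> : s z = skip s D z by rewrite /skip (negbTE szD).
  by rewrite -ks // porbit_step.
apply/subsetP => _ /imsetP[z zx ->]; move: zx; rewrite inE => /andP[zD /sub].
by rewrite inE (negbTE zD).
Qed.

Lemma sum_porbit_skip (T T' : finType) (s : {perm T}) (s' : {perm T'}) (D : {set T})
    (k : T -> T') (R : nmodType) (F : T' -> R) :
  {in ~: D &, injective k} ->
  (forall x, x \notin D -> skip s D x \notin D) ->
  (forall x, x \notin D -> s' (k x) = k (skip s D x)) ->
  forall x, x \notin D -> \sum_(y in porbit s' (k x)) F y =
    \sum_(z in porbit s x | z \notin D) F (k z).
Proof.
move=> kI skD ks x xD; rewrite (porbit_skip skD ks xD) big_imset /=.
  by apply: eq_bigl => z; rewrite inE andbC.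
move=> y z; rewrite !inE => /andP[yD _] /andP[zD _]; apply: kI; by rewrite inE.
Qed.

(** Elements of a semiring need not have inverses, so [y] and [1 + y] enter as whole families of
    integral powers. *)
Definition exponential (R : pzSemiRingType) (p : int -> R) :=
  p 0 = 1 /\ forall i j, p (i + j) = p i * p j.

Lemma exponential_sum (R : comPzSemiRingType) (p : int -> R) (I : finType) (P : pred I)
    (F : I -> int) :
  exponential p -> \prod_(i | P i) p (F i) = p (\sum_(i | P i) F i).
Proof. by case=> p0 pD; rewrite (big_morph p pD p0). Qed.

(* The mutation at [f] of the coefficients [pw g 1], with [q k] in the role of
   [(1 + pw f 1) ^ k]. *)
Definition mut_pw n (R : comPzSemiRingType) (pw : 'I_n -> int -> R) (q : int -> R)
    (f : 'I_n) (b : 'I_n -> int) (g : 'I_n) (k : int) : R :=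
  if g == f then pw f (- k)
  else pw g k * pw f (k * Num.max 0 (b g)) * q (- (k * b g)).

(** * The weight of a matching under mutated coefficients *)

Section MutationWeight.

Variables (n : nat) (G : plane_bigraph n) (f : 'I_n).
Variables (R : comPzSemiRingType) (pw : 'I_n -> int -> R) (q : int -> R).
Variable b : 'I_n -> int.
Hypothesis pw_exp : forall g, exponential (pw g).
Hypothesis q_exp : exponential q.
Hypothesis bE : forall g, used G g -> b g = beta G f g.
Hypothesis no2 : forall g, arrows G f g = 0%N \/ arrows G g f = 0%N.

(** Mutation changes the weight by powers of [y_f] and [1 + y_f] whose exponents are sums of heights
    over the neighbours of [f]. These are sums over the boundary of [f], where jumps of the height
    are differences of indicators, so the correction is local. The new height at [f] stays free as
    [h' f], being the only height that a move alters. *)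
Lemma mut_weight (M N : {set edge G}) (h' : 'I_n -> int) :
  perfect_matching M -> perfect_matching N ->
  (forall g, g != f -> h' g = height M N g) ->
  \prod_g mut_pw pw q f b g (h' g) = (\prod_g pw g (height M N g)) *
    (pw f ((#|bw_edges G f|%:Z - 1) * height M N f - h' f
           - \sum_(e in bw_edges G f) (ind M e - ind N e)) *
     q (\sum_(e in bw_edges G f) (ind M e - ind N e)
        + \sum_(e in wb_edges G f) (ind M e - ind N e))).
Proof.
move=> pM pN hE; set h := height M N.
have uh g : ~~ used G g -> h g = 0 by exact: height_unused.
have aff : arrows G f f = 0%N by case: (no2 f).
have bwE : \sum_(e in bw_edges G f) (ind M e - ind N e) =
    #|bw_edges G f|%:Z * h f - \sum_g (arrows G f g)%:Z * h g.
  rewrite -sum_bw_lface -sum1_card (big_morph Posz PoszD (erefl 0%:Z)) /=.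
  rewrite mulr_suml -sumrB /=; apply: eq_bigr => e; rewrite inE => /eqP fe.
  by rewrite (heightE e pM pN) fe -/h /= mul1r.
have wbE : \sum_(e in wb_edges G f) (ind M e - ind N e) =
    \sum_g (arrows G g f)%:Z * h g - #|bw_edges G f|%:Z * h f.
  rewrite -sum_wb_face -card_wb_edges -sum1_card (big_morph Posz PoszD (erefl 0%:Z)) /=.
  rewrite mulr_suml -sumrB /=; apply: eq_bigr => e; rewrite inE => /eqP fe.
  by rewrite (heightE e pM pN) fe -/h /= mul1r.
(* Without 2-cycles at [f], the positive part of [beta G f g] counts the arrows from [f] to [g]. *)
have maxE : \sum_(g | g != f) h g * Num.max 0 (b g) = \sum_g (arrows G f g)%:Z * h g.
  rewrite [RHS](bigD1 f) //= aff mul0r add0r; apply: eq_bigr => g _.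
  case: (boolP (used G g)) => [/bE ->|/uh ->]; last by rewrite mul0r mulr0.
  rewrite mulrC; congr (_ * _); rewrite /beta.
  by case: (no2 g) => ->; lia.
have bsumE : \sum_(g | g != f) - (h g * b g) =
    \sum_g (arrows G g f)%:Z * h g - \sum_g (arrows G f g)%:Z * h g.
  rewrite [\sum_g (arrows G g f)%:Z * h g](bigD1 f) //=.
  rewrite [\sum_g (arrows G f g)%:Z * h g](bigD1 f) //=.
  rewrite aff !mul0r !add0r -sumrB; apply: eq_bigr => g _.
  case: (boolP (used G g)) => [/bE ->|/uh ->]; last by rewrite !mulr0 mul0r oppr0.
  by rewrite /beta; ring.
rewrite (bigD1 f) //= {1}/mut_pw eqxx.
rewrite (eq_bigr (fun g => pw g (h g) * pw f (h g * Num.max 0 (b g)) * q (- (h g * b g)))); last first.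
  by move=> g gf; rewrite /mut_pw (negbTE gf) hE.
rewrite 2!big_split /= (exponential_sum _ _ (pw_exp f)) (exponential_sum _ _ q_exp).
rewrite maxE bsumE [\prod_g pw g (h g)](bigD1 f) //= bwE wbE.
have [_ pwD] := pw_exp f.
set X := \prod_(_ | _) _.
have -> : (#|bw_edges G f|%:Z - 1) * h f - h' f -
   (#|bw_edges G f|%:Z * h f - \sum_g (arrows G f g)%:Z * h g) =
   - h f + (- h' f + \sum_g (arrows G f g)%:Z * h g) by ring.
have -> : #|bw_edges G f|%:Z * h f - \sum_g (arrows G f g)%:Z * h g +
   (\sum_g (arrows G g f)%:Z * h g - #|bw_edges G f|%:Z * h f) =
   \sum_g (arrows G g f)%:Z * h g - \sum_g (arrows G f g)%:Z * h g by ring.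
rewrite pwD [pw f (- h' f + _)]pwD !mulrA.
have -> : pw f (h f) * X * pw f (- h f) = X.
  by rewrite mulrAC -pwD subrr (pw_exp f).1 mul1r.
by congr (_ * _ * _); rewrite mulrC.
Qed.

End MutationWeight.

(** The common interface of square moves and bigon removals. The rule in [step_arrows] is quiver
    mutation before the cancellation of 2-cycles. In [step_sum] the numbers [t g] are prescribed
    only at used faces, since a seed may have other arrows at vertices that are no longer faces. *)
Record mutation_step n (f : 'I_n) (G H : plane_bigraph n) (N : {set edge G})
    (N' : {set edge H}) (c : int) : Prop := MutationStep {
  step_star : property_star H;
  step_used : used G f;
  step_used_other : forall g, g != f -> used H g = used G g;
  step_no2 : forall g, arrows G f g = 0%N \/ arrows G g f = 0%N;
  step_arrows : forall u v, u != f -> v != f ->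
    arrows H u v = (arrows G u v + arrows G u f * arrows G f v)%N;
  step_sum : forall (R : comPzSemiRingType) (pw : 'I_n -> int -> R) (q : int -> R)
      (t : 'I_n -> int),
    (forall g, exponential (pw g)) -> exponential q -> q 1 = 1 + pw f 1 ->
    (forall g, used G g -> t g = beta G f g) ->
    dimer_sum (mut_pw pw q f t) N' = pw f c * q (hvec N f) * dimer_sum pw N }.

(** * Removal of a bigon *)

Section Bigon.

Variables (n : nat) (G H : plane_bigraph n) (f : 'I_n) (e e' : edge G).
Variable i : edge H -> edge G.
Notation cb := (ccw G black).
Notation cw := (ccw G white).
Hypothesis fe : face e = Some f.
Hypothesis nee' : e != e'.
Hypothesis cwe : cw e = e'.
Hypothesis cbe' : cb e' = e.
Hypothesis degb : (2 <= degree black e)%N.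
Hypothesis degw : (2 <= degree white e)%N.
Hypothesis i_inj : injective i.
Hypothesis i_codom : forall x, (x \in codom i) = (x != e).
Hypothesis i_ccw : forall c x, i (ccw H c x) = skip (ccw G c) [set e] (i x).
Hypothesis i_face : forall x, face x = face (i x).

Lemma bigon_face z : (face z == Some f) = (z == e).
Proof.
rewrite -fe eq_sym face_eq; apply/idP/eqP => [|->]; last exact: porbit_id.
have /subsetP sub : porbit (cw * cb)%g e \subset [set e].
  by apply: porbit_subset => [|y]; rewrite !inE // => /eqP ->; rewrite permM cwe cbe'.
by move/sub; rewrite inE => /eqP.
Qed.

Lemma bigon_lface z : (lface z == Some f) = (z == e').
Proof. by rewrite /lface bigon_face -(inj_eq (@perm_inj _ cw)) permKV cwe. Qed.

Lemma bigon_inv : exists2 k : edge G -> edge H, cancel i k &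
  forall z, z != e -> i (k z) = z.
Proof.
have [x0 _] := outer_face H.
pose k z := odflt x0 [pick x | i x == z].
have ik : cancel i k.
  by move=> x; rewrite /k; case: pickP => [y /eqP/i_inj //|/(_ x)]; rewrite eqxx.
by exists k => // z; rewrite -i_codom => /codomP[x ->]; rewrite ik.
Qed.

Variable k : edge G -> edge H.
Hypothesis ik : cancel i k.
Hypothesis ki : forall z, z != e -> i (k z) = z.

Lemma i_neq x : i x != e.
Proof. by rewrite -i_codom codom_f. Qed.

Lemma ike' : i (k e') = e'.
Proof. by rewrite ki // eq_sym. Qed.

Lemma i_eq_e' x : (i x == e') = (x == k e').
Proof. by rewrite -{1}ike' (inj_eq i_inj). Qed.

Lemma bigon_skip_notin c z : z \notin [set e] -> skip (ccw G c) [set e] z \notin [set e].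
Proof.
rewrite !inE => ze; rewrite /skip; case: ifP => [|/negbT]; rewrite inE => // /eqP ->.
by apply: degree_gt1_neq; case: c.
Qed.

Lemma bigon_skip c z : z \notin [set e] -> ccw H c (k z) = k (skip (ccw G c) [set e] z).
Proof.
move=> ze; apply: i_inj; rewrite i_ccw [in RHS]ki; first by rewrite ki // -in_set1.
by rewrite -in_set1 bigon_skip_notin.
Qed.

Lemma bigon_lfaceH x : lface x = if x == k e' then lface e else lface (i x).
Proof.
rewrite -face_cb i_face i_ccw /skip inE -i_eq_e'.
have -> : (cb (i x) == e) = (i x == e') by rewrite -{1}cbe' (inj_eq perm_inj).
by case: eqP => [->|_]; rewrite ?cbe' face_cb.
Qed.

Lemma bigon_used g : used H g = (g != f) && used G g.
Proof.
apply/existsP/andP => [[x /eqP fx]|[gf /existsP[z /eqP fz]]].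
  split; last by apply/existsP; exists (i x); rewrite -i_face fx.
  by apply: contraTneq (i_neq x) => gf; rewrite -bigon_face -i_face fx gf eqxx.
exists (k z); rewrite i_face ki ?fz // -bigon_face fz.
by apply: contra gf => /eqP[->].
Qed.

Lemma sum_bigon (R : nmodType) (F : edge G -> R) : \sum_z F z = F e + \sum_x F (i x).
Proof. by rewrite (bigD1 e) //=; congr (_ + _); apply: sum_codom. Qed.

Lemma sum_bigon_nat (F : edge G -> nat) :
  (\sum_z F z = F e + \sum_x F (i x))%N.
Proof. exact: sum_bigon. Qed.

Lemma bigon_arrows_from g : arrows G f g = (lface e == Some g).
Proof.
rewrite arrowsE (bigD1 e) //= big1 ?addn0; first by rewrite fe eqxx.
by move=> z /negbTE ze; rewrite bigon_face ze.
Qed.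

Lemma bigon_arrows_to g : arrows G g f = (face e' == Some g).
Proof.
rewrite arrowsE (bigD1 e') //= big1 ?addn0; first by rewrite bigon_lface eqxx andbT.
by move=> z /negbTE ze; rewrite bigon_lface ze andbF.
Qed.

Lemma bigon_arrows u v : u != f -> v != f ->
  arrows H u v = (arrows G u v + arrows G u f * arrows G f v)%N.
Proof.
move=> uf vf; rewrite bigon_arrows_to bigon_arrows_from !arrowsE sum_bigon_nat /=.
have -> : (face e == Some u) = false.
  by rewrite fe; apply/negbTE; apply: contra uf => /eqP[->].
rewrite add0n (bigD1 (k e')) //= [in RHS](bigD1 (k e')) //= ike' bigon_lfaceH eqxx.
rewrite i_face ike'.
have -> : (lface e' == Some v) = false.
  have /eqP -> : lface e' == Some f by rewrite bigon_lface.
  by apply/negbTE; apply: contra vf => /eqP[->].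
rewrite andbF add0n addnC mulnb; congr (_ + _)%N.
by apply: eq_bigr => x /negbTE xk; rewrite i_face bigon_lfaceH xk.
Qed.

(** Two matchings of [G] lie over a matching of [H] that contains the surviving edge [k e'], and one
    over any other. *)
Definition bigon_rel (M : {set edge G}) (M' : {set edge H}) :=
  [forall x, (x \in M') == if x == k e' then (e \in M) || (e' \in M) else i x \in M].

Lemma bigon_relP (M : {set edge G}) (M' : {set edge H}) :
  reflect ((k e' \in M') = (e \in M) || (e' \in M) /\
           (forall z, z != e -> z != e' -> (k z \in M') = (z \in M)))
          (bigon_rel M M').
Proof.
apply: (iffP forallP) => [Hx|[H1 H2] x].
  split=> [|z ze ze']; first by have /eqP := Hx (k e'); rewrite eqxx.
  have /eqP := Hx (k z); rewrite -i_eq_e' ki // (negbTE ze'); exact.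
case: (eqVneq x (k e')) => [->|nx]; first by rewrite H1.
by rewrite -{1}(ik x) H2 ?i_neq // i_eq_e'.
Qed.

Lemma mem_e_e' c z : (e \in porbit (ccw G c) z) = (e' \in porbit (ccw G c) z).
Proof.
case: c; last by rewrite -cwe porbit_step.
by rewrite -{1}cbe' porbit_step.
Qed.

Lemma bigon_sum (M : {set edge G}) (M' : {set edge H}) c z :
  bigon_rel M M' -> ~~ ((e \in M) && (e' \in M)) -> z != e ->
  (\sum_(y in porbit (ccw H c) (k z)) (y \in M' : nat) =
   \sum_(y in porbit (ccw G c) z) (y \in M : nat))%N.
Proof.
move=> /bigon_relP[rel1 rel2] nb ze.
rewrite (@sum_porbit_skip _ _ (ccw G c) _ [set e]); last 4 first.
- by move=> x y; rewrite !inE => xe ye kxy; rewrite -(ki xe) kxy ki.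
- exact: bigon_skip_notin.
- exact: bigon_skip.
- by rewrite inE.
have eqD y : (y \in porbit (ccw G c) z) && (y \notin [set e]) =
             (y \in porbit (ccw G c) z) && (y != e) by rewrite inE.
rewrite (eq_bigl _ _ eqD).
case: (boolP (e \in porbit (ccw G c) z)) => ez; last first.
  have e'z : e' \notin porbit (ccw G c) z by rewrite -mem_e_e'.
  apply: eq_big => [y|y /andP[yz ye]].
    by case: (boolP (y \in _)) => //= yz; apply: contraNneq ez => <-.
  by rewrite rel2 //; apply: contraNneq e'z => <-.
have e'z : e' \in porbit (ccw G c) z by rewrite -mem_e_e'.
rewrite [RHS](bigD1 e) //= [in RHS](bigD1 e') /=; last by rewrite e'z eq_sym.
rewrite (bigD1 e') /=; last by rewrite e'z eq_sym.
rewrite rel1 addnA; congr (_ + _)%N; first by move: nb; case: (e \in M); case: (e' \in M).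
by apply: eq_bigr => y /andP[/andP[yz ye] ye']; rewrite rel2.
Qed.

Lemma not_both (M : {set edge G}) : perfect_matching M -> ~~ ((e \in M) && (e' \in M)).
Proof.
move=> pM; apply/andP => -[eM e'M]; case/eqP: nee'.
apply: (matching_uniq pM e'M eM (c := black)); rewrite -{1}cbe'; exact: porbit_self.
Qed.

Lemma bigon_pm M M' : bigon_rel M M' -> ~~ ((e \in M) && (e' \in M)) ->
  perfect_matching M' = perfect_matching M.
Proof.
move=> rel nb; apply/perfect_matchingP/perfect_matchingP => pm c z.
  case: (eqVneq z e) => [->|ze].
    have -> : porbit (ccw G c) e = porbit (ccw G c) e'.
      by apply: porbit_eq; rewrite mem_e_e' porbit_id.
    by rewrite -(bigon_sum c rel nb) ?pm // eq_sym.
  by rewrite -(bigon_sum c rel nb).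
by rewrite -(ik z) (bigon_sum c rel nb) ?i_neq // pm.
Qed.

Lemma bigon_ex M : perfect_matching M -> exists2 M', perfect_matching M' & bigon_rel M M'.
Proof.
move=> pM.
pose M' := [set x | if x == k e' then (e \in M) || (e' \in M) else i x \in M].
have rel : bigon_rel M M' by apply/forallP => x; rewrite inE.
by exists M' => //; rewrite (bigon_pm rel) // not_both.
Qed.

(** The flag [d] selects which edge of the bigon replaces [k e']. *)
Lemma bigon_lift M' (d : bool) : perfect_matching M' -> exists2 M, perfect_matching M &
  bigon_rel M M' /\ (e \in M) = (k e' \in M') && d /\ (e' \in M) = (k e' \in M') && ~~ d.
Proof.
move=> pM'.
pose M := [set z | if z == e then (k e' \in M') && d
                   else if z == e' then (k e' \in M') && ~~ d else k z \in M'].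
have eM : (e \in M) = (k e' \in M') && d by rewrite inE eqxx.
have e'M : (e' \in M) = (k e' \in M') && ~~ d.
  by rewrite inE eq_sym (negbTE nee') eqxx.
have rel : bigon_rel M M'.
  apply/bigon_relP; rewrite eM e'M; split; first by case: (_ \in _); case: (d).
  by move=> z ze ze'; rewrite inE (negbTE ze) (negbTE ze').
have nb : ~~ ((e \in M) && (e' \in M)).
  by rewrite eM e'M; case: (d); rewrite ?andbF // !andbT.
by exists M; rewrite -?(bigon_pm rel).
Qed.

Lemma bigon_star : property_star G -> property_star H.
Proof.
move=> star x; have [M pM xM] := star (i x); have [M' pM' /bigon_relP[rel1 rel2]] := bigon_ex pM.
exists M' => //; case: (eqVneq x (k e')) => [xE|xk].
  by rewrite xE rel1 -[in X in _ || X]ike' -xE xM orbT.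
by rewrite -(ik x) rel2 ?i_neq // i_eq_e'.
Qed.

Lemma ind_bigon M M' : perfect_matching M -> bigon_rel M M' ->
  ind M' (k e') = ind M e + ind M e'.
Proof.
move=> pM /bigon_relP[rel1 _]; move: (not_both pM); rewrite /ind rel1.
by case: (e \in M); case: (e' \in M).
Qed.

Lemma bigon_height M N M' N' : perfect_matching M -> perfect_matching N ->
  bigon_rel M M' -> bigon_rel N N' ->
  height M' N' =1 fun g => if g == f then 0 else height M N g.
Proof.
move=> pM pN rM rN; set h := height M N; apply: height_eq; split=> [x|g]; last first.
  by rewrite bigon_used negb_and negbK => /orP[->//|ug]; case: ifP => // _; exact: height_unused.
have hE o : o != Some f -> outer_ext (fun g => if g == f then 0 else h g) o = outer_ext h o.
  by case: o => //= g; rewrite -[Some g == _]/(g == f) => /negbTE ->.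
have [fe'] : face e' != Some f by rewrite bigon_face eq_sym.
have le : lface e != Some f by rewrite bigon_lface.
have le' : lface e' = Some f by apply/eqP; rewrite bigon_lface.
case: (eqVneq x (k e')) => [->|xk].
  rewrite !(ind_bigon _ rM, ind_bigon _ rN) // bigon_lfaceH eqxx i_face ike' !hE //.
  have := heightE e pM pN; have := heightE e' pM pN; rewrite fe le' -/h /=; lia.
have xe' : i x != e' by rewrite i_eq_e'.
have mE K K' : bigon_rel K K' -> ind K' x = ind K (i x).
  by case/bigon_relP=> _ r2; rewrite /ind -{1}(ik x) r2 ?i_neq.
rewrite !(mE _ _ rM, mE _ _ rN) bigon_lfaceH (negbTE xk) i_face (heightE _ pM pN) !hE //.
  by rewrite bigon_lface.
by rewrite bigon_face i_neq.
Qed.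

Lemma bigon_bw : bw_edges G f = [set e].
Proof. by apply/setP => z; rewrite !inE bigon_face. Qed.

Lemma bigon_wb : wb_edges G f = [set e'].
Proof. by apply/setP => z; rewrite !inE bigon_lface. Qed.

Lemma bigon_hvec M : hvec M f = - (ind M e + ind M e').
Proof.
rewrite ffunE /face_edges bigon_bw bigon_wb.
have -> : #|[set e] :|: [set e']| = 2%N by rewrite cards2 nee'.
have -> : #|M :&: ([set e] :|: [set e'])|%:Z = ind M e + ind M e'.
  rewrite -sum1_card (big_morph Posz PoszD (erefl 0%:Z)) /= big_mkcond /=.
  rewrite (bigD1 e) //= (bigD1 e') 1?eq_sym //= big1 ?addr0.
    by rewrite !inE eqxx /ind eqxx orbT !andbT; case: (e \in M); case: (e' \in M).
  by move=> z /andP[/negbTE ze /negbTE ze']; rewrite !inE ze ze' andbF.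
by rewrite /=; lia.
Qed.

Section Star.
Hypothesis star : property_star G.

(** A 2-cycle between [f] and [g] would put [g] on both sides of the surviving edge in [H], which
    [lface_neq_face] excludes. *)
Lemma bigon_no2 g : arrows G f g = 0%N \/ arrows G g f = 0%N.
Proof.
rewrite bigon_arrows_from bigon_arrows_to.
case: eqP => [le|_]; last by left.
case: eqP => [fe'|_]; last by right.
have := @lface_neq_face _ _ (bigon_star star) (k e') g.
by rewrite i_face ike' bigon_lfaceH eqxx; case.
Qed.

(** The matchings through [e] and those through [e'] lie over the same matchings of [H]. Both ways
    of writing that one sum show that the first class weighs [y_f] times the second, so together
    they weigh [1 + y_f = q 1] times the second. Matchings missing the bigon are in bijection and
    keep their weight up to [K]. *)
Lemma bigon_dimer_sum (R : comPzSemiRingType) (pw : 'I_n -> int -> R) (q : int -> R)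
    (b : 'I_n -> int) N N' :
  (forall g, exponential (pw g)) -> exponential q -> q 1 = 1 + pw f 1 ->
  (forall g, used G g -> b g = beta G f g) ->
  perfect_matching N -> perfect_matching N' -> bigon_rel N N' ->
  dimer_sum (mut_pw pw q f b) N' =
    pw f (ind N e) * q (- (ind N e + ind N e')) * dimer_sum pw N.
Proof.
move=> pw_exp q_exp q1 bE pN pN' rN.
set K := pw f _ * q _.
have [p0 pD] := pw_exp f; have [q0 qD] := q_exp.
pose w M := \prod_g pw g (height M N g).
pose w' M' := \prod_g mut_pw pw q f b g (height M' N' g).
have wE M M' : perfect_matching M -> perfect_matching M' -> bigon_rel M M' ->
    w' M' = K * (pw f (- ind M e) * q (ind M e + ind M e') * w M).
  move=> pM pM' rM; rewrite /w' (mut_weight pw_exp q_exp bE bigon_no2 pM pN); last first.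
    by move=> g /negbTE gf; rewrite (bigon_height pM pN rM rN) gf.
  rewrite (bigon_height pM pN rM rN) eqxx bigon_bw bigon_wb cards1 !big_set1.
  rewrite subrr mul0r subr0 sub0r opprB.
  have -> : ind M e - ind N e + (ind M e' - ind N e') =
     - (ind N e + ind N e') + (ind M e + ind M e') by ring.
  by rewrite -/(w M) pD (qD (- (ind N e + ind N e'))) /K; ring.
have split_sum : dimer_sum pw N =
   \sum_(M | perfect_matching M && (e \in M)) w M
   + \sum_(M | perfect_matching M && (e' \in M)) w M
   + \sum_(M | perfect_matching M && ~~ ((e \in M) || (e' \in M))) w M.
  rewrite /dimer_sum (bigID (fun M : {set edge G} => (e \in M) || (e' \in M))) /=.
  congr (_ + _); rewrite (bigID (fun M : {set edge G} => e \in M)) /=; congr (_ + _).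
    apply: eq_bigl => M; by case: (e \in M); rewrite ?andbT ?andbF.
  apply: eq_bigl => M; case: (boolP (perfect_matching M)) => //= pM.
  by have := not_both pM; case: (e \in M); case: (e' \in M).
have uniqr M1 M2 M' : perfect_matching M1 -> perfect_matching M2 ->
    bigon_rel M1 M' -> bigon_rel M2 M' -> (e \in M1) = (e \in M2) -> M1 = M2.
  move=> p1 p2 /bigon_relP[r1 s1] /bigon_relP[r2 s2] eM; apply/setP => z.
  have [->//|ze] := eqVneq z e; have [->|ze'] := eqVneq z e'; last by rewrite -s1 // s2.
  move: r1 (not_both p1) (not_both p2); rewrite r2 eM.
  by case: (e \in M2); case: (e' \in M1); case: (e' \in M2).
have uniql M M1 M2 : bigon_rel M M1 -> bigon_rel M M2 -> M1 = M2.
  move=> /forallP r1 /forallP r2; apply/setP => x.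
  by move: (r1 x) (r2 x) => /eqP -> /eqP ->.
rewrite -[LHS]/(\sum_(M' | perfect_matching M') w' M').
rewrite (bigID (fun M' : {set edge H} => k e' \in M')) /=.
have sum0 : \sum_(M' | perfect_matching M' && (k e' \notin M')) w' M' =
    K * \sum_(M | perfect_matching M && ~~ ((e \in M) || (e' \in M))) w M.
  rewrite big_distrr /=; apply/esym; apply: (@sum_rel _ _ _ _ _ bigon_rel).
  - move=> M /andP[pM nM]; have [M' pM' rM] := bigon_ex pM; exists M' => //.
    by have /bigon_relP[-> _] := rM; rewrite pM' nM.
  - move=> M' /andP[pM' nM']; have [M pM [rM _]] := bigon_lift true pM'; exists M => //.
    by rewrite pM; have /bigon_relP[<- _] := rM.
  - by move=> M M1 M2 _ _ _; exact: uniql.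
  - move=> M1 M2 M' /andP[p1 n1] /andP[p2 n2] _ r1 r2; apply: uniqr r1 r2 _ => //.
    by move: n1 n2; case: (e \in M1); case: (e \in M2).
  move=> M M' /andP[pM nM] /andP[pM' _] rM; rewrite (wE M M') //.
  by move: nM; rewrite /ind negb_or => /andP[/negbTE -> /negbTE ->]; rewrite oppr0 p0 q0 !mul1r.
have sum1 (d : bool) (P := fun M => perfect_matching M && (if d then e \in M else e' \in M)) :
    \sum_(M' | perfect_matching M' && (k e' \in M')) w' M' =
    K * (pw f (- (d : nat)%:Z) * q 1 * \sum_(M | P M) w M).
  rewrite !big_distrr /=; apply/esym; apply: (@sum_rel _ _ _ _ _ bigon_rel).
  - move=> M /andP[pM nM]; have [M' pM' rM] := bigon_ex pM; exists M' => //.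
    by have /bigon_relP[-> _] := rM; rewrite pM'; case: (d) nM => ->; rewrite ?orbT.
  - move=> M' /andP[pM' nM']; have [M pM [rM [E1 E2]]] := bigon_lift d pM'; exists M => //.
    by rewrite /P pM; case: (d) E1 E2; rewrite nM' /= => E1 E2; rewrite ?E1 ?E2.
  - by move=> M M1 M2 _ _ _; exact: uniql.
  - move=> M1 M2 M' /andP[p1 n1] /andP[p2 n2] _ r1 r2; apply: uniqr r1 r2 _ => //.
    move: n1 n2 (not_both p1) (not_both p2).
    by case: (d); case: (e \in M1); case: (e \in M2); case: (e' \in M1); case: (e' \in M2).
  move=> M M' /andP[pM nM] /andP[pM' _] rM; rewrite (wE M M') //.
  have [-> ->] : ind M e = (d : nat)%:Z /\ ind M e' = (~~ d : nat)%:Z.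
    move: nM (not_both pM); rewrite /ind.
    by case: (d); case: (e \in M); case: (e' \in M).
  by case: (d).
rewrite sum0 split_sum.
set X0 := \sum_(M : {set edge G} | _ && ~~ _) w M.
have := sum1 false; have := sum1 true; rewrite /=.
set X1 := \sum_(M : {set edge G} | _ && (e \in M)) w M.
set X2 := \sum_(M : {set edge G} | _ && (e' \in M)) w M.
move=> -> KE.
(* Cancelling [K] is possible even in a semiring, because it is a product of powers and the opposite
   exponents give its inverse. *)
have KK : pw f (- ind N e) * q (ind N e + ind N e') * K = 1.
  by rewrite /K mulrACA -pD -qD addNr subrr p0 q0 mulr1.
have pp : pw f 1 * pw f (-1) = 1 by rewrite -pD subrr.
have qq : q (-1) * q 1 = 1 by rewrite -qD addNr.
have X21 : X1 = pw f 1 * X2.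
  set Ki := pw f (- ind N e) * q (ind N e + ind N e') in KK.
  transitivity (Ki * K * (pw f 1 * pw f (-1)) * (q (-1) * q 1) * X1).
    by rewrite KK pp qq !mul1r.
  transitivity (Ki * pw f 1 * q (-1) * (K * (pw f (-1) * q 1 * X1))); first by ring.
  rewrite KE oppr0 p0 mul1r.
  transitivity (Ki * K * (q (-1) * q 1) * (pw f 1 * X2)); first by ring.
  by rewrite KK qq !mul1r.
by rewrite KE oppr0 p0 X21 q1; ring.
Qed.


Lemma bigon_step N N' : perfect_matching N -> perfect_matching N' -> bigon_rel N N' ->
  mutation_step f N N' (ind N e).
Proof.
move=> pN pN' rN; split.
- exact: bigon_star.
- exact: used_face fe.
- by move=> g gf; rewrite bigon_used gf.
- exact: bigon_no2.
- exact: bigon_arrows.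
by move=> *; rewrite bigon_hvec; apply: bigon_dimer_sum.
Qed.

(** After mutation the arrows at the deleted vertex [f] are given by [- beta G f g]. The sum is thus
    the exponent that a matching contributes at the new variable, and it only sees the surviving
    edge. *)
Lemma bigon_height_sum M' N' : perfect_matching M' -> perfect_matching N' ->
  \sum_g - beta G f g * height M' N' g = ind M' (k e') - ind N' (k e').
Proof.
move=> pM' pN'; rewrite (heightE _ pM' pN') i_face ike' bigon_lfaceH eqxx.
rewrite !outer_ext_sum -sumrB; apply: eq_bigr => g _.
by rewrite /beta bigon_arrows_from bigon_arrows_to; ring.
Qed.

End Star.

End Bigon.

Lemma porbit3 (T : finType) (s : {perm T}) x y z : s x = y -> s y = z -> s z = x ->
  porbit s x = [set x; y; z].
Proof.
move=> xy yz zx; apply/eqP; rewrite eqEsubset; apply/andP; split.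
  apply: porbit_subset => [|w]; rewrite !inE ?eqxx // -orbA.
  by case/or3P=> /eqP ->; rewrite ?xy ?yz ?zx eqxx ?orbT.
by apply/subsetP => w; rewrite !inE -orbA => /or3P[] /eqP ->;
  rewrite -?yz -?xy ?porbit_step porbit_id.
Qed.

Lemma sum_set3 (T : finType) (F : T -> nat) x y z : x != y -> y != z -> x != z ->
  (\sum_(w in [set x; y; z]) F w = F x + F y + F z)%N.
Proof.
move=> xy yz xz.
rewrite -setUA big_setU1 /=; last by rewrite !inE negb_or xy xz.
by rewrite big_setU1 ?inE //= big_set1 addnA.
Qed.

Lemma sum_set2 (T : finType) (F : T -> int) x y : x != y ->
  \sum_(w in [set x; y]) F w = F x + F y.
Proof. by move=> xy; rewrite big_setU1 ?inE //= big_set1. Qed.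

Section SkipPair.

Variables (T T' : finType) (s : {perm T}) (s' : {perm T'}) (k : T -> T') (p q : T).
Variables (m : T -> nat) (m' : T' -> nat).
Hypothesis k_inj : injective k.
Hypothesis skip_notin : forall x, x \notin [set p; q] -> skip s [set p; q] x \notin [set p; q].
Hypothesis k_skip : forall x, x \notin [set p; q] -> s' (k x) = k (skip s [set p; q] x).
Hypothesis pq : p != q.
Hypothesis spp : s p \notin [set p; q].
Hypothesis sqq : s q \notin [set p; q].
Hypothesis mE : forall z, z \notin [set p; q] -> z != s p -> z != s q -> m' (k z) = m z.

Lemma sum_pair (P : pred T) (F : T -> nat) :
  (\sum_(z | P z) F z = \sum_(z | P z && (z \notin [set p; q])) F z + P p * F p + P q * F q)%N.
Proof.
have E z : (if P z then F z else 0)%N = ((if P z && (z \notin [set p; q]) then F z else 0) +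
   (if z == p then P p * F p else 0) + (if z == q then P q * F q else 0))%N.
  rewrite !inE negb_or; case: (eqVneq z p) => [->|zp]; last first.
    by case: (eqVneq z q) => [->|zq]; case: (P _); rewrite ?mul1n ?mul0n ?addn0.
  by rewrite (negbTE pq) andbF; case: (P p); rewrite ?mul1n ?mul0n ?addn0.
rewrite big_mkcond (eq_bigr _ (fun z _ => E z)) !big_split /= -!big_mkcond /=.
by rewrite !big_pred1_eq.
Qed.

(** The successors of the deleted edges [p] and [q] take over their weights, so nothing is lost at
    any vertex. *)
Lemma skip_pair_sum : m' (k (s p)) = (m (s p) + m p)%N -> m' (k (s q)) = (m (s q) + m q)%N ->
  forall x, x \notin [set p; q] ->
  (\sum_(y in porbit s' (k x)) m' y = \sum_(z in porbit s x) m z)%N.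
Proof.
move=> mp mq x xD; rewrite (sum_porbit_skip _ (in2W k_inj) skip_notin k_skip xD).
rewrite [RHS]sum_pair /=.
have -> : (\sum_(z in porbit s x | z \notin [set p; q]) m' (k z) =
  \sum_(z in porbit s x | z \notin [set p; q])
    (m z + ((z == s p) * m p + (z == s q) * m q)))%N.
  apply: eq_bigr => z /andP[_ zD].
  case: (eqVneq z (s p)) => [->|zp].
    by rewrite (inj_eq perm_inj) (negbTE pq) mul1n mul0n addn0.
  by case: (eqVneq z (s q)) => [->|zq]; rewrite ?mp ?mq ?mE // ?mul1n ?mul0n ?addn0.
rewrite !big_split /= -addnA; congr (_ + _)%N.
have one y r : y \notin [set p; q] ->
    (\sum_(z in porbit s x | z \notin [set p; q]) (z == y) * r = (y \in porbit s x) * r)%N.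
  move=> yD; rewrite -big_distrl /=; congr (_ * _)%N; case: (boolP (y \in porbit s x)) => yx.
    rewrite (bigD1 y) ?yx //= eqxx big1 ?addn0 // => z /andP[_ /negbTE ->] //.
  rewrite big1 // => z /andP[zx _]; apply/eqP; rewrite eqb0.
  by apply: contraNneq yx => <-.
by rewrite !one // !porbit_step.
Qed.

(** Conversely, if [q] sits at another vertex, only one edge at the vertex of [p] has an unknown new
    weight, and equality of the two sums determines it. *)
Lemma skip_pair_leg : q \notin porbit s p ->
  (\sum_(y in porbit s' (k (s p))) m' y = \sum_(z in porbit s (s p)) m z)%N ->
  m' (k (s p)) = (m (s p) + m p)%N.
Proof.
move=> qp; rewrite (sum_porbit_skip _ (in2W k_inj) skip_notin k_skip spp).
rewrite [RHS]sum_pair /=.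
have oE : porbit s (s p) = porbit s p by apply: porbit_eq; exact: porbit_self.
rewrite oE porbit_id (negbTE qp) mul1n mul0n addn0.
rewrite (bigD1 (s p)) /=; last by rewrite porbit_self spp.
rewrite [X in _ = (X + _)%N -> _](bigD1 (s p)) /=; last by rewrite porbit_self spp.
have andE (F : T -> nat) : (\sum_(z | (z \in porbit s p) && (z \notin [set p; q]) && (z != s p)) F z =
  \sum_(z in porbit s p | (z \notin [set p; q]) && (z != s p)) F z)%N.
  by apply: eq_bigl => z; rewrite andbA.
rewrite !andE => /eqP.
have -> : (\sum_(z in porbit s p | (z \notin [set p; q]) && (z != s p)) m' (k z) =
  \sum_(z in porbit s p | (z \notin [set p; q]) && (z != s p)) m z)%N.
  apply: eq_bigr => z /and3P[zx zD zp]; rewrite mE //.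
  by apply: contraNneq qp => zq; rewrite -(porbit_step s) -zq.
by rewrite addnAC eqn_add2r => /eqP.
Qed.

End SkipPair.

(** * The square move *)

Section Square.

Variables (n : nat) (G H : plane_bigraph n) (f : 'I_n) (a b c d : edge G).
Variables (k : edge G -> edge H) (a' b' c' d' : edge H).
Notation cb := (ccw G black).
Notation cw := (ccw G white).
Hypothesis fa : face a = Some f.
Hypothesis cwa : cw a = b.
Hypothesis cbb : cb b = c.
Hypothesis cwc : cw c = d.
Hypothesis cbd : cb d = a.
Hypothesis ncb : c \notin porbit cb a.
Hypothesis ncw : c \notin porbit cw a.
Hypothesis degba : (3 <= degree black a)%N.
Hypothesis degwa : (3 <= degree white a)%N.
Hypothesis degbc : (3 <= degree black c)%N.
Hypothesis degwc : (3 <= degree white c)%N.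
Hypothesis k_inj : injective k.
Hypothesis uniq' : uniq [:: a'; b'; c'; d'].
Hypothesis k_codom : forall y, (y \in codom k) = (y \notin [:: a'; b'; c'; d']).
Hypothesis k_black : forall x, x \notin [set b; d] ->
  ccw H black (k x) = k (skip cb [set b; d] x).
Hypothesis k_white : forall x, x \notin [set a; c] ->
  ccw H white (k x) = k (skip cw [set a; c] x).
Hypothesis wd' : ccw H white d' = a'.
Hypothesis wa' : ccw H white a' = k a.
Hypothesis wka : ccw H white (k a) = d'.
Hypothesis wb' : ccw H white b' = c'.
Hypothesis wc' : ccw H white c' = k c.
Hypothesis wkc : ccw H white (k c) = b'.
Hypothesis ba' : ccw H black a' = b'.
Hypothesis bb' : ccw H black b' = k b.
Hypothesis bkb : ccw H black (k b) = a'.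
Hypothesis bc' : ccw H black c' = d'.
Hypothesis bd' : ccw H black d' = k d.
Hypothesis bkd : ccw H black (k d) = c'.
Hypothesis k_face : forall x, x \notin [set a; c] -> face (k x) = face x.
Hypothesis face_ka : face (k a) = face d.
Hypothesis face_kc : face (k c) = face b.
Hypothesis face_a' : face a' = lface a.
Hypothesis face_c' : face c' = lface c.
Hypothesis face_b' : face b' = Some f.
Hypothesis face_d' : face d' = Some f.

Lemma sq_neq : [/\ a != b, a != c, a != d, b != c & (b != d) && (c != d)].
Proof.
have ac : a != c by apply: contraNneq ncb => <-; exact: porbit_id.
split=> //.
- by rewrite eq_sym -cwa; apply: degree_gt1_neq; apply: ltnW.
- apply: contraTneq degba => ad; rewrite -leqNgt; apply: ltnW.
  have : cb a = a by rewrite {1}ad cbd.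
  by move/eqP; rewrite ltnNge; apply: contraL; exact: degree_gt1_neq.
- apply: contraTneq degbc => bc; rewrite -leqNgt; apply: ltnW.
  have : cb c = c by rewrite -{1}bc cbb.
  by move/eqP; rewrite ltnNge; apply: contraL; exact: degree_gt1_neq.
rewrite -{1}cwa -{1}cwc (inj_eq perm_inj) ac /= eq_sym -cwc.
by apply: degree_gt1_neq; apply: ltnW.
Qed.

Lemma sqE : ((a == b) = false) * ((b == a) = false) * ((a == c) = false) * ((c == a) = false)
  * ((a == d) = false) * ((d == a) = false) * ((b == c) = false) * ((c == b) = false)
  * ((b == d) = false) * ((d == b) = false) * ((c == d) = false) * ((d == c) = false).
Proof.
case: sq_neq => ab ac ad bc /andP[bd cd].
have F (x y : edge G) : x != y -> ((x == y) = false) * ((y == x) = false).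
  by move=> xy; rewrite (negbTE xy) eq_sym (negbTE xy).
by rewrite !(F _ _ ab, F _ _ ac, F _ _ ad, F _ _ bc, F _ _ bd, F _ _ cd).
Qed.

Lemma sqE' : ((a' == b') = false) * ((b' == a') = false) * ((a' == c') = false)
  * ((c' == a') = false) * ((a' == d') = false) * ((d' == a') = false)
  * ((b' == c') = false) * ((c' == b') = false)
  * ((b' == d') = false) * ((d' == b') = false) * ((c' == d') = false) * ((d' == c') = false).
Proof.
have F (x y : edge H) : x != y -> ((x == y) = false) * ((y == x) = false).
  by move=> xy; rewrite (negbTE xy) eq_sym (negbTE xy).
move: uniq'; rewrite /= !inE !negb_or.
case/and4P=> /and3P[ab ac ad] /andP[bc bd] cd _.
by rewrite !(F _ _ ab, F _ _ ac, F _ _ ad, F _ _ bc, F _ _ bd, F _ _ cd).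
Qed.

Lemma kE' x : ((k x == a') = false) * ((k x == b') = false) * ((k x == c') = false)
  * ((k x == d') = false) * ((a' == k x) = false) * ((b' == k x) = false)
  * ((c' == k x) = false) * ((d' == k x) = false).
Proof.
have : k x \notin [:: a'; b'; c'; d'] by rewrite -k_codom codom_f.
have F (y : edge H) : k x != y -> ((k x == y) = false) * ((y == k x) = false).
  by move=> xy; rewrite (negbTE xy) eq_sym (negbTE xy).
rewrite !inE !negb_or => /and4P[A B C D].
by rewrite !(F _ A, F _ B, F _ C, F _ D).
Qed.

Lemma sq_caseH y : [\/ exists x, y = k x, y = a' \/ y = b' | y = c' \/ y = d'].
Proof.
case: (boolP (y \in codom k)) => [/codomP[x ->]|]; first by constructor 1; exists x.
rewrite k_codom negbK !inE => /or4P[] /eqP ->; [constructor 2|constructor 2|constructor 3|constructor 3]; auto.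
Qed.

Lemma sq_face z : (face z == Some f) = (z == a) || (z == c).
Proof.
rewrite -fa eq_sym face_eq.
have phia : (cw * cb)%g a = c by rewrite permM cwa cbb.
have phic : (cw * cb)%g c = a by rewrite permM cwc cbd.
apply/idP/orP => [|[/eqP ->|/eqP ->]]; last 2 first.
- exact: porbit_id.
- by rewrite -phia porbit_self.
have /subsetP sub : porbit (cw * cb)%g a \subset [set a; c].
  by apply: porbit_subset => [|y]; rewrite !inE ?eqxx // => /orP[] /eqP ->;
     rewrite ?phia ?phic eqxx ?orbT.
by move/sub; rewrite !inE => /orP.
Qed.

Lemma sq_lface z : (lface z == Some f) = (z == b) || (z == d).
Proof.
rewrite /lface sq_face -(inj_eq (@perm_inj _ cw) _ a) -(inj_eq (@perm_inj _ cw) _ c).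
by rewrite permKV cwa cwc.
Qed.

Lemma sq_skip_black x : x \notin [set b; d] -> skip cb [set b; d] x \notin [set b; d].
Proof.
rewrite !inE negb_or => /andP[xb xd]; rewrite /skip; case: ifP; rewrite !inE; last by move/negbT.
by case/orP=> /eqP ->; rewrite ?cbb ?cbd !sqE.
Qed.

Lemma sq_skip_white x : x \notin [set a; c] -> skip cw [set a; c] x \notin [set a; c].
Proof.
rewrite !inE negb_or => /andP[xb xd]; rewrite /skip; case: ifP; rewrite !inE; last by move/negbT.
by case/orP=> /eqP ->; rewrite ?cwa ?cwc !sqE.
Qed.

Lemma lface_k x : x \notin [set b; d] -> lface (k x) = lface x.
Proof.
move=> xD; rewrite -face_cb k_black // /skip !inE -(face_cb x).
case: (eqVneq (cb x) b) => [->|xb] /=; first by rewrite cbb face_kc.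
case: (eqVneq (cb x) d) => [->|xd] /=; first by rewrite cbd face_ka.
rewrite k_face // !inE -{1}cbd -{1}cbb !(inj_eq perm_inj).
by move: xD; rewrite !inE orbC.
Qed.

Lemma lface_kb : lface (k b) = lface a. Proof. by rewrite -face_cb bkb face_a'. Qed.
Lemma lface_kd : lface (k d) = lface c. Proof. by rewrite -face_cb bkd face_c'. Qed.
Lemma lface_ka : lface (k a) = lface a. Proof. by rewrite lface_k // !inE !sqE. Qed.
Lemma lface_kc : lface (k c) = lface c. Proof. by rewrite lface_k // !inE !sqE. Qed.
Lemma face_kb : face (k b) = face b. Proof. by rewrite k_face // !inE !sqE. Qed.
Lemma face_kd : face (k d) = face d. Proof. by rewrite k_face // !inE !sqE. Qed.
Lemma lface_a' : lface a' = Some f. Proof. by rewrite -face_cb ba'. Qed.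
Lemma lface_b' : lface b' = face b. Proof. by rewrite -face_cb bb' face_kb. Qed.
Lemma lface_c' : lface c' = Some f. Proof. by rewrite -face_cb bc'. Qed.
Lemma lface_d' : lface d' = face d. Proof. by rewrite -face_cb bd' face_kd. Qed.
Lemma face_c : face c = Some f. Proof. by apply/eqP; rewrite sq_face eqxx orbT. Qed.
Lemma lface_b : lface b = Some f. Proof. by apply/eqP; rewrite sq_lface eqxx. Qed.
Lemma lface_d : lface d = Some f. Proof. by apply/eqP; rewrite sq_lface eqxx orbT. Qed.

Definition sq_faces := (fa, face_c, lface_b, lface_d, face_ka, face_kb, face_kc, face_kd,
  lface_ka, lface_kb, lface_kc, lface_kd, face_a', face_b', face_c', face_d',
  lface_a', lface_b', lface_c', lface_d').

Lemma neq_la : lface a != Some f. Proof. by rewrite sq_lface !sqE. Qed.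
Lemma neq_lc : lface c != Some f. Proof. by rewrite sq_lface !sqE. Qed.
Lemma neq_fb : face b != Some f. Proof. by rewrite sq_face !sqE. Qed.
Lemma neq_fd : face d != Some f. Proof. by rewrite sq_face !sqE. Qed.

Definition sq_out : {set edge G} := ~: [set a; b; c; d].

Lemma sq_outP x : x \in sq_out -> [/\ x \notin [set a; c], x \notin [set b; d],
  face x != Some f & lface x != Some f].
Proof.
rewrite sq_face sq_lface !inE !negb_or -!andbA => /and4P[xa xb xc xd].
by rewrite xa xb xc xd.
Qed.

Lemma sq_caseG x : [\/ x \in sq_out, x = a \/ x = b | x = c \/ x = d].
Proof.
case: (boolP (x \in sq_out)) => [|]; first by constructor 1.
rewrite !inE negbK -!orbA => /or4P[] /eqP ->;
 [constructor 2|constructor 2|constructor 3|constructor 3]; auto.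
Qed.

Lemma sq_sumG (F : edge G -> nat) :
  (\sum_x F x = F a + F b + F c + F d + \sum_(x in sq_out) F x)%N.
Proof.
rewrite (bigD1 a) // (bigD1 b) /= ?sqE // (bigD1 c) /= ?sqE //.
rewrite (bigD1 d) /= ?sqE // !addnA; congr (_ + _)%N.
by apply: eq_bigl => x; rewrite !inE !negb_or.
Qed.

Lemma sq_sumH (F : edge H -> nat) :
  (\sum_y F y = F a' + F b' + F c' + F d' +
   (F (k a) + F (k b) + F (k c) + F (k d) + \sum_(x in sq_out) F (k x)))%N.
Proof.
rewrite -(sq_sumG (fun x => F (k x))).
rewrite (bigD1 a') // (bigD1 b') /= ?sqE' // (bigD1 c') /= ?sqE' //.
rewrite (bigD1 d') /= ?sqE' // !addnA; congr (_ + _)%N.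
apply: sum_codom => // y; rewrite k_codom !inE !negb_or.
by case: (y == a'); case: (y == b'); case: (y == c'); case: (y == d').
Qed.

Lemma sq_used g : used H g = used G g.
Proof.
apply/existsP/existsP => [[y /eqP fy]|[z /eqP fz]].
  case: (sq_caseH y) fy => [[x ->]|[->|->]|[->|->]]; rewrite ?sq_faces => fx.
  - case: (boolP (x \in [set a; c])) => [|xac]; last first.
      by exists x; rewrite -k_face ?fx.
    rewrite !inE => /orP[] /eqP xE; rewrite xE sq_faces in fx; [exists d|exists b];
    by rewrite fx.
  - by exists ((cw^-1)%g a); rewrite -[face _]/(lface a) fx.
  - by exists a; rewrite sq_faces fx.
  - by exists ((cw^-1)%g c); rewrite -[face _]/(lface c) fx.
  by exists a; rewrite sq_faces fx.
case: (boolP (z \in [set a; c])) => [|zac]; last by exists (k z); rewrite k_face ?fz.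
by move=> zac; exists b'; rewrite sq_faces -fz eq_sym sq_face; move: zac; rewrite !inE.
Qed.

Lemma sq_arrows_from v : arrows G f v = ((lface a == Some v) + (lface c == Some v))%N.
Proof.
rewrite arrowsE sq_sumG !sq_faces eqxx (negbTE neq_fb) (negbTE neq_fd) /=.
rewrite big1 => [|x /sq_outP[_ _ /negbTE -> _]] //; lia.
Qed.

Lemma sq_arrows_to v : arrows G v f = ((face b == Some v) + (face d == Some v))%N.
Proof.
rewrite arrowsE sq_sumG !sq_faces eqxx (negbTE neq_la) (negbTE neq_lc) !andbT !andbF /=.
rewrite big1 => [|x /sq_outP[_ _ _ /negbTE ->]]; last by rewrite andbF.
lia.
Qed.

Lemma sq_arrowsH_from v : arrows H f v = arrows G v f.
Proof.
rewrite sq_arrows_to arrowsE sq_sumH !sq_faces eqxx.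
rewrite (negbTE neq_la) (negbTE neq_lc) (negbTE neq_fb) (negbTE neq_fd) /=.
rewrite big1 => [|x /sq_outP[xac _ /negbTE xf _]]; last by rewrite k_face // xf.
lia.
Qed.

Lemma sq_arrowsH_to v : arrows H v f = arrows G f v.
Proof.
rewrite sq_arrows_from arrowsE sq_sumH !sq_faces eqxx.
rewrite (negbTE neq_la) (negbTE neq_lc) (negbTE neq_fb) (negbTE neq_fd) !andbT !andbF /=.
rewrite big1 => [|x /sq_outP[_ xbd _ /negbTE xf]]; last by rewrite lface_k // xf andbF.
lia.
Qed.

(** Each leg separates one of [face b], [face d] from one of [lface a], [lface c], and all four
    combinations occur: they are the terms of the product. The deleted edges and the new cycle all
    border [f] and do not count. *)
Lemma sq_arrows u v : u != f -> v != f ->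
  arrows H u v = (arrows G u v + arrows G u f * arrows G f v)%N.
Proof.
move=> uf vf; rewrite sq_arrows_to sq_arrows_from !arrowsE sq_sumH sq_sumG !sq_faces.
have -> : (Some f == Some u) = false by apply/negbTE; apply: contra uf => /eqP[->].
have -> : (Some f == Some v) = false by apply/negbTE; apply: contra vf => /eqP[->].
rewrite !andbF /=.
have -> : (\sum_(x in sq_out) ((face (k x) == Some u) && (lface (k x) == Some v)) =
   \sum_(x in sq_out) ((face x == Some u) && (lface x == Some v)))%N.
  by apply: eq_bigr => x /sq_outP[xac xbd _ _]; rewrite k_face // lface_k.
case: (face b == _); case: (face d == _); case: (lface a == _); case: (lface c == _);
 rewrite /=; lia.
Qed.

(** Agreement away from the square only. A matching without square edges has two partners in [H],
    and a matching without edges of the new cycle may have two partners in [G]. *)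
Definition sq_rel (M : {set edge G}) (M' : {set edge H}) :=
  [forall x, (x \in sq_out) ==> ((k x \in M') == (x \in M))].

Lemma sq_relP (M : {set edge G}) (M' : {set edge H}) :
  reflect {in sq_out, forall x, (k x \in M') = (x \in M)} (sq_rel M M').
Proof.
apply: (iffP forallP) => [Hx x xo|Hx x]; last by apply/implyP => xo; rewrite Hx.
by have /implyP/(_ xo)/eqP := Hx x.
Qed.

(** A leg is taken when one of the two square edges at its old endpoint was. As equations between
    numbers these also say that two adjacent square edges are not both taken. *)
Definition legs (M : {set edge G}) (M' : {set edge H}) : Prop :=
  [/\ (k a \in M' : nat) = ((a \in M) + (d \in M))%N,
      (k b \in M' : nat) = ((b \in M) + (a \in M))%N,
      (k c \in M' : nat) = ((c \in M) + (b \in M))%N &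
      (k d \in M' : nat) = ((d \in M) + (c \in M))%N].

Definition inner (M' : {set edge H}) : Prop :=
  [/\ ((a' \in M') + (b' \in M') + (k b \in M') = 1)%N,
      ((c' \in M') + (d' \in M') + (k d \in M') = 1)%N,
      ((d' \in M') + (a' \in M') + (k a \in M') = 1)%N &
      ((b' \in M') + (c' \in M') + (k c \in M') = 1)%N].

Lemma sq_sum_black M M' x : sq_rel M M' -> legs M M' -> x \notin [set b; d] ->
  (\sum_(y in porbit (ccw H black) (k x)) (y \in M' : nat) =
   \sum_(z in porbit cb x) (z \in M : nat))%N.
Proof.
move=> /sq_relP rel [la lb lc ld] xD.
apply: (@skip_pair_sum _ _ cb _ k b d (fun z => (z \in M) : nat) (fun y => (y \in M') : nat)) => //.
- exact: sq_skip_black.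
- by rewrite sqE.
- by rewrite cbb !inE !sqE.
- by rewrite cbd !inE !sqE.
- move=> z; rewrite cbb cbd !inE negb_or => /andP[zb zd] zc za; rewrite rel //.
  by rewrite !inE !negb_or za zb zc zd.
- by rewrite cbb.
by rewrite cbd.
Qed.

Lemma sq_sum_white M M' x : sq_rel M M' -> legs M M' -> x \notin [set a; c] ->
  (\sum_(y in porbit (ccw H white) (k x)) (y \in M' : nat) =
   \sum_(z in porbit cw x) (z \in M : nat))%N.
Proof.
move=> /sq_relP rel [la lb lc ld] xD.
apply: (@skip_pair_sum _ _ cw _ k a c (fun z => (z \in M) : nat) (fun y => (y \in M') : nat)) => //.
- exact: sq_skip_white.
- by rewrite sqE.
- by rewrite cwa !inE !sqE.
- by rewrite cwc !inE !sqE.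
- move=> z; rewrite cwa cwc !inE negb_or => /andP[za zc] zb zd; rewrite rel //.
  by rewrite !inE !negb_or za zb zc zd.
- by rewrite cwa.
by rewrite cwc.
Qed.

Lemma sum_v1 (M' : {set edge H}) : (\sum_(y in porbit (ccw H black) a') (y \in M' : nat) =
  (a' \in M') + (b' \in M') + (k b \in M'))%N.
Proof. by rewrite (porbit3 ba' bb' bkb) sum_set3 ?sqE' ?kE'. Qed.
Lemma sum_v2 (M' : {set edge H}) : (\sum_(y in porbit (ccw H black) c') (y \in M' : nat) =
  (c' \in M') + (d' \in M') + (k d \in M'))%N.
Proof. by rewrite (porbit3 bc' bd' bkd) sum_set3 ?sqE' ?kE'. Qed.
Lemma sum_u1 (M' : {set edge H}) : (\sum_(y in porbit (ccw H white) d') (y \in M' : nat) =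
  (d' \in M') + (a' \in M') + (k a \in M'))%N.
Proof. by rewrite (porbit3 wd' wa' wka) sum_set3 ?sqE' ?kE'. Qed.
Lemma sum_u2 (M' : {set edge H}) : (\sum_(y in porbit (ccw H white) b') (y \in M' : nat) =
  (b' \in M') + (c' \in M') + (k c \in M'))%N.
Proof. by rewrite (porbit3 wb' wc' wkc) sum_set3 ?sqE' ?kE'. Qed.

Lemma sq_pmH M M' : sq_rel M M' -> legs M M' -> inner M' -> perfect_matching M ->
  perfect_matching M'.
Proof.
move=> rel lg [v1 v2 u1 u2] /perfect_matchingP pM; apply/perfect_matchingP => co y.
have po s (x z : edge H) : z \in porbit s x ->
   (\sum_(w in porbit s z) (w \in M' : nat) = \sum_(w in porbit s x) (w \in M' : nat))%N.
  by move/porbit_eq ->.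
case: co.
  have V1 z : z \in porbit (ccw H black) a' ->
     (\sum_(w in porbit (ccw H black) z) (w \in M' : nat) = 1)%N.
    by move/po->; rewrite sum_v1.
  have V2 z : z \in porbit (ccw H black) c' ->
     (\sum_(w in porbit (ccw H black) z) (w \in M' : nat) = 1)%N.
    by move/po->; rewrite sum_v2.
  case: (sq_caseH y) => [[x ->]|[->|->]|[->|->]].
  - case: (boolP (x \in [set b; d])) => xD; last by rewrite (sq_sum_black rel lg).
    by move: xD; rewrite !inE => /orP[] /eqP ->; [apply: V1|apply: V2];
      rewrite (porbit3 ba' bb' bkb, porbit3 bc' bd' bkd) !inE eqxx !orbT.
  - by apply: V1; rewrite porbit_id.
  - by apply: V1; rewrite -ba' porbit_self.
  - by apply: V2; rewrite porbit_id.
  by apply: V2; rewrite -bc' porbit_self.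
have V1 z : z \in porbit (ccw H white) d' ->
   (\sum_(w in porbit (ccw H white) z) (w \in M' : nat) = 1)%N.
  by move/po->; rewrite sum_u1.
have V2 z : z \in porbit (ccw H white) b' ->
   (\sum_(w in porbit (ccw H white) z) (w \in M' : nat) = 1)%N.
  by move/po->; rewrite sum_u2.
case: (sq_caseH y) => [[x ->]|[->|->]|[->|->]].
- case: (boolP (x \in [set a; c])) => xD; last by rewrite (sq_sum_white rel lg).
  by move: xD; rewrite !inE => /orP[] /eqP ->; [apply: V1|apply: V2];
    rewrite (porbit3 wd' wa' wka, porbit3 wb' wc' wkc) !inE eqxx !orbT.
- by apply: V1; rewrite -wd' porbit_self.
- by apply: V2; rewrite porbit_id.
- by apply: V2; rewrite -wb' porbit_self.
by apply: V1; rewrite porbit_id.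
Qed.

Lemma sq_pmG M M' : sq_rel M M' -> legs M M' -> perfect_matching M' ->
  perfect_matching M.
Proof.
move=> rel lg /perfect_matchingP pM'; apply/perfect_matchingP => co z; case: co.
  have [x xD ->] : exists2 x, x \notin [set b; d] & porbit cb z = porbit cb x.
    case: (boolP (z \in [set b; d])) => zD; last by exists z.
    move: zD; rewrite !inE => /orP[] /eqP ->; [exists c|exists a]; rewrite ?inE ?sqE //;
    by apply/esym/porbit_eq; rewrite -?cbb -?cbd porbit_self.
  by rewrite -(sq_sum_black rel lg).
have [x xD ->] : exists2 x, x \notin [set a; c] & porbit cw z = porbit cw x.
  case: (boolP (z \in [set a; c])) => zD; last by exists z.
  move: zD; rewrite !inE => /orP[] /eqP ->; [exists b|exists d]; rewrite ?inE ?sqE //;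
  by apply/esym/porbit_eq; rewrite -?cwa -?cwc porbit_self.
by rewrite -(sq_sum_white rel lg).
Qed.

Lemma sq_inner M' : perfect_matching M' -> inner M'.
Proof.
by move/perfect_matchingP=> pM'; split; rewrite -?sum_v1 -?sum_v2 -?sum_u1 -?sum_u2 pM'.
Qed.

(** At an old vertex of the square everything except the leg is known to agree, so the condition at
    that vertex decides the leg. Opposite vertices of the square are distinct, so each meets a
    single leg. *)
Lemma sq_legs M M' : sq_rel M M' -> perfect_matching M -> perfect_matching M' -> legs M M'.
Proof.
move=> /sq_relP rel /perfect_matchingP pM /perfect_matchingP pM'.
have relb z : z \notin [set b; d] -> z != cb b -> z != cb d -> (k z \in M' : nat) = (z \in M).
  rewrite cbb cbd !inE negb_or => /andP[zb zd] zc za; rewrite rel //.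
  by rewrite !inE !negb_or za zb zc zd.
have relw z : z \notin [set a; c] -> z != cw a -> z != cw c -> (k z \in M' : nat) = (z \in M).
  rewrite cwa cwc !inE negb_or => /andP[za zc] zb zd; rewrite rel //.
  by rewrite !inE !negb_or za zb zc zd.
pose mG z := (z \in M) : nat; pose mH y := (y \in M') : nat.
have bd : [set b; d] = [set d; b] by rewrite setUC.
have ac : [set a; c] = [set c; a] by rewrite setUC.
have dbn : d \notin porbit cb b.
  rewrite porbit_sym -(porbit_step cb) cbb; move: ncb; rewrite porbit_sym -{1}cbd porbit_step.
  by rewrite porbit_sym.
have sums co x y : (\sum_(z in porbit (ccw H co) y) mH z = \sum_(z in porbit (ccw G co) x) mG z)%N.
  by rewrite pM pM'.
split.
- rewrite -{1 2}cbd.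
  refine (@skip_pair_leg _ _ cb (ccw H black) k d b mG mH k_inj _ _ _ _ _ _ (sums _ _ _));
    rewrite -?bd.
  + exact: sq_skip_black.
  + exact: k_black.
  + by rewrite sqE.
  + by rewrite cbd !inE !sqE.
  + by move=> z zD za zc; exact: relb.
  by rewrite porbit_sym.
- rewrite -{1 2}cwa.
  refine (@skip_pair_leg _ _ cw (ccw H white) k a c mG mH k_inj _ _ _ _ _ _ (sums _ _ _)) => //.
  + exact: sq_skip_white.
  + by rewrite sqE.
  by rewrite cwa !inE !sqE.
- rewrite -{1 2}cbb.
  refine (@skip_pair_leg _ _ cb (ccw H black) k b d mG mH k_inj _ _ _ _ _ _ (sums _ _ _)) => //.
  + exact: sq_skip_black.
  + by rewrite sqE.
  by rewrite cbb !inE !sqE.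
rewrite -{1 2}cwc.
refine (@skip_pair_leg _ _ cw (ccw H white) k c a mG mH k_inj _ _ _ _ _ _ (sums _ _ _));
  rewrite -?ac.
- exact: sq_skip_white.
- exact: k_white.
- by rewrite sqE.
- by rewrite cwc !inE !sqE.
- by move=> z zD za zc; exact: relw.
by rewrite porbit_sym.
Qed.

Lemma sq_mkH M (p q r s : bool) : perfect_matching M ->
  (p + q + ((b \in M) + (a \in M)) = 1)%N -> (r + s + ((d \in M) + (c \in M)) = 1)%N ->
  (s + p + ((a \in M) + (d \in M)) = 1)%N -> (q + r + ((c \in M) + (b \in M)) = 1)%N ->
  exists2 M', perfect_matching M' & sq_rel M M' /\
    [/\ (a' \in M') = p, (b' \in M') = q, (c' \in M') = r & (d' \in M') = s].
Proof.
move=> pM v1 v2 u1 u2.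
pose L := [set x | if x == a then (a \in M) || (d \in M) else
  if x == b then (b \in M) || (a \in M) else
  if x == c then (c \in M) || (b \in M) else
  if x == d then (d \in M) || (c \in M) else x \in M].
pose M' := [set y | if y == a' then p else if y == b' then q else
  if y == c' then r else if y == d' then s else y \in k @: L].
have kM' x : (k x \in M') = (x \in L) by rewrite inE !kE' mem_imset.
have rel : sq_rel M M'.
  apply/sq_relP => x; rewrite !inE !negb_or -!andbA => /and4P[xa xb xc xd].
  by rewrite !kE' mem_imset // inE (negbTE xa) (negbTE xb) (negbTE xc) (negbTE xd).
have lg : legs M M'.
  rewrite /legs !kM' !inE !eqxx !sqE.
  move: v1 v2 u1 u2; case: (a \in M); case: (b \in M); case: (c \in M); case: (d \in M);
  by case: (p); case: (q); case: (r); case: (s).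
have bits : [/\ (a' \in M') = p, (b' \in M') = q, (c' \in M') = r & (d' \in M') = s].
  by rewrite !inE !eqxx !sqE'.
exists M' => //; apply: sq_pmH pM => //.
case: lg bits => la lb lc ld [ea eb ec ed].
by rewrite /inner la lb lc ld ea eb ec ed.
Qed.

Lemma sq_mkG M' (p q r s : bool) : perfect_matching M' ->
  (k a \in M' : nat) = (p + s)%N -> (k b \in M' : nat) = (q + p)%N ->
  (k c \in M' : nat) = (r + q)%N -> (k d \in M' : nat) = (s + r)%N ->
  exists2 M, perfect_matching M & sq_rel M M' /\
    [/\ (a \in M) = p, (b \in M) = q, (c \in M) = r & (d \in M) = s].
Proof.
move=> pM' la lb lc ld.
pose M := [set x | if x == a then p else if x == b then q else
  if x == c then r else if x == d then s else k x \in M'].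
have bits : [/\ (a \in M) = p, (b \in M) = q, (c \in M) = r & (d \in M) = s].
  by rewrite !inE !eqxx !sqE.
have rel : sq_rel M M'.
  apply/sq_relP => x; rewrite !inE !negb_or -!andbA => /and4P[xa xb xc xd].
  by rewrite (negbTE xa) (negbTE xb) (negbTE xc) (negbTE xd).
exists M => //; apply: sq_pmG pM' => //.
by case: bits => ea eb ec ed; rewrite /legs ea eb ec ed.
Qed.

Lemma sq_adj M : perfect_matching M ->
  [/\ ~~ ((a \in M) && (b \in M)), ~~ ((b \in M) && (c \in M)),
      ~~ ((c \in M) && (d \in M)) & ~~ ((d \in M) && (a \in M))].
Proof.
move=> pM.
have adj co (x y : edge G) : ccw G co x = y -> y != x -> ~~ ((x \in M) && (y \in M)).
  move=> xy ne; apply/andP => -[xM yM]; case/eqP: ne.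
  by apply: (matching_uniq pM xM yM (c := co)); rewrite -xy porbit_self.
by split; [apply: adj cwa _|apply: adj cbb _|apply: adj cwc _|apply: adj cbd _]; rewrite sqE.
Qed.

Lemma sq_ex M : perfect_matching M -> exists2 M', perfect_matching M' & sq_rel M M'.
Proof.
move=> pM; have := sq_adj pM.
(* A single square edge puts two legs into the new matching, and the opposite edge of the new cycle
   covers the other two inner vertices. With no square edge the whole cycle is free, and [a'], [c']
   is chosen. *)
pose p := [&& a \notin M, b \notin M & d \notin M].
pose r := [&& c \notin M, b \notin M & d \notin M].
have := @sq_mkH M p ((d \in M) && (b \notin M)) r ((b \in M) && (d \notin M)) pM.
rewrite {}/p {}/r; case: (a \in M); case: (b \in M); case: (c \in M); case: (d \in M) => /= mk [] // _ _ _ _;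
by have [//|//|//|//|M' pM' [rel _]] := mk; exists M'.
Qed.

(** Crossing [a] in [G] leads from [f] to [lface a], and crossing [a'] in [H] leads from there back
    to [f]; the two jumps give the correction. *)
Lemma sq_height M N M' N' : perfect_matching M -> perfect_matching N ->
  perfect_matching M' -> perfect_matching N' -> sq_rel M M' -> sq_rel N N' ->
  height M' N' =1 fun g => if g == f then height M N f -
    (ind M a - ind N a + (ind M' a' - ind N' a')) else height M N g.
Proof.
move=> pM pN pM' pN' rM rN; set h := height M N; set hf := h f - _.
have leg K K' : perfect_matching K -> perfect_matching K' -> sq_rel K K' ->
  [/\ ind K' (k a) = ind K a + ind K d, ind K' (k b) = ind K b + ind K a,
      ind K' (k c) = ind K c + ind K b & ind K' (k d) = ind K d + ind K c].
  move=> pK pK' /(sq_legs)/(_ pK pK')[la lb lc ld].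
  by rewrite /ind la lb lc ld !PoszD.
have inn K K' : perfect_matching K -> perfect_matching K' -> sq_rel K K' ->
  [/\ ind K' a' + ind K' b' + ind K b + ind K a = 1,
      ind K' c' + ind K' d' + ind K d + ind K c = 1,
      ind K' d' + ind K' a' + ind K a + ind K d = 1 &
      ind K' b' + ind K' c' + ind K c + ind K b = 1].
  move=> pK pK' rK; have [la lb lc ld] := sq_legs rK pK pK'.
  have [v1 v2 u1 u2] := sq_inner pK'; rewrite la lb lc ld -!addnA in v1 v2 u1 u2.
  by rewrite /ind -!PoszD -!addnA v1 v2 u1 u2.
have [m1 m2 m3 m4] := leg _ _ pM pM' rM; have [n1 n2 n3 n4] := leg _ _ pN pN' rN.
have [i1 i2 i3 i4] := inn _ _ pM pM' rM; have [j1 j2 j3 j4] := inn _ _ pN pN' rN.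
have ha := heightE a pM pN; have hb := heightE b pM pN.
have hc := heightE c pM pN; have hd := heightE d pM pN.
rewrite !sq_faces -/h /= in ha hb hc hd.
have hE o : o != Some f -> outer_ext (fun g => if g == f then hf else h g) o = outer_ext h o.
  by case: o => //= g; rewrite -[Some g == _]/(g == f) => /negbTE ->.
have hfE : outer_ext (fun g => if g == f then hf else h g) (Some f) = hf by rewrite /= eqxx.
have EA := hE _ neq_la; have EC := hE _ neq_lc; have EB := hE _ neq_fb; have ED := hE _ neq_fd.
apply: height_eq; split=> [y|g]; last first.
  rewrite sq_used => ug; case: eqP => [gf|_]; last exact: height_unused.
  by rewrite gf (used_face fa) in ug.
case: (sq_caseH y) => [[x ->]|[->|->]|[->|->]]; last first.
- by rewrite !sq_faces hfE ED /hf; clear - ha hb hc hd i1 i2 i3 i4 j1 j2 j3 j4; lia.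
- by rewrite !sq_faces hfE EC /hf; clear - ha hb hc hd i1 i2 i3 i4 j1 j2 j3 j4; lia.
- by rewrite !sq_faces hfE EB /hf; clear - ha hb hc hd i1 i2 i3 i4 j1 j2 j3 j4; lia.
- by rewrite !sq_faces hfE EA /hf; clear - ha hb hc hd i1 i2 i3 i4 j1 j2 j3 j4; lia.
case: (sq_caseG x) => [xo|[->|->]|[->|->]]; last first.
- by rewrite !sq_faces ED EC m4 n4; clear - hc hd; lia.
- by rewrite !sq_faces EB EC m3 n3; clear - hc hb; lia.
- by rewrite !sq_faces EB EA m2 n2; clear - ha hb; lia.
- by rewrite !sq_faces ED EA m1 n1; clear - ha hd; lia.
have [xac xbd xf xl] := sq_outP xo.
rewrite k_face // lface_k // !hE // -(heightE x pM pN) /ind.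
by rewrite (sq_relP _ _ rM) // (sq_relP _ _ rN).
Qed.

Lemma sq_bw : bw_edges G f = [set a; c].
Proof. by apply/setP => z; rewrite !inE sq_face. Qed.
Lemma sq_wb : wb_edges G f = [set b; d].
Proof. by apply/setP => z; rewrite !inE sq_lface. Qed.

Section Star.
Hypothesis star : property_star G.

Lemma sq_hvec M : hvec M f = 1 - (ind M a + ind M b + ind M c + ind M d).
Proof.
rewrite ffunE card_matching_face // card_face_edges // sq_bw sq_wb cards2 sqE.
rewrite !sum_set2 ?sqE //=; ring.
Qed.

(** A third edge at the vertex lies in some matching, which omits the two given ones. *)
Lemma sq_avoid_vertex co x y : (3 <= degree co x)%N -> y \in porbit (ccw G co) x ->
  exists2 M, perfect_matching M & x \notin M /\ y \notin M.
Proof.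
move=> deg yx.
have [z zx zn] : exists2 z, z \in porbit (ccw G co) x & z \notin [set x; y].
  apply/subsetPn; apply: contraL deg => /subset_leq_card le; rewrite -ltnNge ltnS.
  by apply: leq_trans le _; rewrite cards2; case: (_ != _).
have [M pM zM] := star z; exists M => //; move: zn; rewrite !inE negb_or => /andP[nx ny].
split; apply/negP => xM.
  by case/eqP: nx; exact: (matching_uniq pM xM zM zx).
case/eqP: ny; apply: (matching_uniq pM xM zM (c := co)).
by apply: porbit_trans zx; rewrite porbit_sym.
Qed.

(* Truncating the height difference at its value on [f] keeps increments in the
   right range, and removes the square edges of both matchings. *)
Lemma sq_combine_bd M N : perfect_matching M -> perfect_matching N ->
  [/\ a \notin M, b \notin M, c \notin M & d \in M] ->
  [/\ a \notin N, b \in N, c \notin N & d \notin N] ->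
  exists2 P, perfect_matching P & [/\ a \notin P, b \notin P, c \notin P & d \notin P].
Proof.
move=> pM pN [Ma Mb Mc Md] [Na Nb Nc Nd]; pose h := height M N.
pose t o := Num.min (outer_ext h o) (h f).
have [e|P pP PE] := matching_of_height (k := t) pN.
  have := heightE e pM pN; have := ind_le1 M e; have := ind_le1 N e.
  rewrite /t -/h; move: (outer_ext h (face e)) (outer_ext h (lface e)) (ind M e) (ind N e) (h f).
  by clear; lia.
have ha := heightE a pM pN; have hb := heightE b pM pN.
have hc := heightE c pM pN; have hd := heightE d pM pN.
rewrite !sq_faces -/h /= in ha hb hc hd.
have pa := PE a; have pb := PE b; have pc := PE c; have pd := PE d.
rewrite /t !sq_faces /= in pa pb pc pd.
rewrite /ind in ha hb hc hd pa pb pc pd.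
rewrite (negbTE Ma) (negbTE Mb) (negbTE Mc) Md (negbTE Na) Nb (negbTE Nc) (negbTE Nd) /= in ha hb hc hd pa pb pc pd.
exists P => //; split; apply/negP => xP.
- by rewrite xP in pa; clear - ha pa; lia.
- by rewrite xP in pb; clear - hb pb; lia.
- by rewrite xP in pc; clear - hc pc; lia.
by rewrite xP in pd; clear - hd pd; lia.
Qed.

(** The mirror image of [sq_combine_bd]: black-white edges have [f] on the right instead of the
    left, so the height is truncated from below, by [Num.max]. *)
Lemma sq_combine_ac M N : perfect_matching M -> perfect_matching N ->
  [/\ a \in M, b \notin M, c \notin M & d \notin M] ->
  [/\ a \notin N, b \notin N, c \in N & d \notin N] ->
  exists2 P, perfect_matching P & [/\ a \notin P, b \notin P, c \notin P & d \notin P].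
Proof.
move=> pM pN [Ma Mb Mc Md] [Na Nb Nc Nd]; pose h := height M N.
pose t o := Num.max (outer_ext h o) (h f).
have [e|P pP PE] := matching_of_height (k := t) pN.
  have := heightE e pM pN; have := ind_le1 M e; have := ind_le1 N e.
  rewrite /t -/h; move: (outer_ext h (face e)) (outer_ext h (lface e)) (ind M e) (ind N e) (h f).
  by clear; lia.
have ha := heightE a pM pN; have hb := heightE b pM pN.
have hc := heightE c pM pN; have hd := heightE d pM pN.
rewrite !sq_faces -/h /= in ha hb hc hd.
have pa := PE a; have pb := PE b; have pc := PE c; have pd := PE d.
rewrite /t !sq_faces /= in pa pb pc pd.
rewrite /ind in ha hb hc hd pa pb pc pd.
rewrite Ma (negbTE Mb) (negbTE Mc) (negbTE Md) (negbTE Na) (negbTE Nb) Nc (negbTE Nd) /= in ha hb hc hd pa pb pc pd.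
exists P => //; split; apply/negP => xP.
- by rewrite xP in pa; clear - ha pa; lia.
- by rewrite xP in pb; clear - hb pb; lia.
- by rewrite xP in pc; clear - hc pc; lia.
by rewrite xP in pd; clear - hd pd; lia.
Qed.

(** Each of the four vertices has a matching avoiding its two square edges, and such a matching
    contains at most one of the other two, as they are adjacent. If none avoids the whole square,
    then two of the four contain just one square edge each, at opposite positions, and these two can
    be combined. *)
Lemma sq_avoid : exists2 P, perfect_matching P &
  [/\ a \notin P, b \notin P, c \notin P & d \notin P].
Proof.
pose avoid (P : {set edge G}) := [&& a \notin P, b \notin P, c \notin P & d \notin P].
suff [P pP /and4P[*]] : exists2 P, perfect_matching P & avoid P by exists P.
have [|M1 p1 [a1 b1]] := @sq_avoid_vertex white a b degwa; first by rewrite -cwa porbit_self.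
have [|M2 p2 [c2 d2]] := @sq_avoid_vertex white c d degwc; first by rewrite -cwc porbit_self.
have [|M3 p3 [a3 d3]] := @sq_avoid_vertex black a d degba.
  by rewrite porbit_sym -cbd porbit_self.
have [|M4 p4 [c4 b4]] := @sq_avoid_vertex black c b degbc.
  by rewrite porbit_sym -cbb porbit_self.
have [_ _ adj1 _] := sq_adj p1; have [adj2 _ _ _] := sq_adj p2.
have [_ adj3 _ _] := sq_adj p3; have [_ _ _ adj4] := sq_adj p4.
case: (boolP (avoid M1)) => [|n1]; first by exists M1.
case: (boolP (avoid M2)) => [|n2]; first by exists M2.
case: (boolP (avoid M3)) => [|n3]; first by exists M3.
case: (boolP (avoid M4)) => [|n4]; first by exists M4.
rewrite /avoid in n1 n2 n3 n4.
have bd M N : perfect_matching M -> perfect_matching N ->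
  [/\ a \notin M, b \notin M, c \notin M & d \in M] ->
  [/\ a \notin N, b \in N, c \notin N & d \notin N] -> exists2 P, perfect_matching P & avoid P.
  move=> pM pN tM tN; have [P pP [*]] := sq_combine_bd pM pN tM tN.
  by exists P => //; apply/and4P; split.
have ac M N : perfect_matching M -> perfect_matching N ->
  [/\ a \in M, b \notin M, c \notin M & d \notin M] ->
  [/\ a \notin N, b \notin N, c \in N & d \notin N] -> exists2 P, perfect_matching P & avoid P.
  move=> pM pN tM tN; have [P pP [*]] := sq_combine_ac pM pN tM tN.
  by exists P => //; apply/and4P; split.
rewrite (negbTE a1) (negbTE b1) in n1; rewrite (negbTE c2) (negbTE d2) in n2.
rewrite (negbTE a3) (negbTE d3) in n3; rewrite (negbTE b4) (negbTE c4) in n4.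
case: (boolP (d \in M1)) => d1.
  have c1 : c \notin M1 by move: adj1; rewrite d1 andbT.
  case: (boolP (b \in M2)) => b2.
    by apply: (bd M1 M2) => //; split=> //; move: adj2; rewrite b2 andbT.
  case: (boolP (b \in M3)) => b3.
    by apply: (bd M1 M3) => //; split=> //; move: adj3; rewrite b3.
  apply: (ac M2 M3) => //; split=> //.
    by move: n2; rewrite b2; case: (a \in M2).
  by move: n3; rewrite b3; case: (c \in M3).
have c1 : c \in M1 by move: n1; rewrite d1; case: (c \in M1).
case: (boolP (a \in M2)) => a2.
  by apply: (ac M2 M1) => //; split=> //; move: adj2; rewrite a2.
have b2 : b \in M2 by move: n2; rewrite a2; case: (b \in M2).
case: (boolP (a \in M4)) => a4.
  by apply: (ac M4 M1) => //; split=> //; move: adj4; rewrite a4 andbT.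
apply: (bd M4 M2) => //; split=> //.
by move: n4; rewrite a4; case: (d \in M4).
Qed.

(** A matching avoiding the square extends by either pair of opposite edges of the new cycle, which
    reaches all of [a'], [b'], [c'], [d']. The other edges are reached by transferring matchings of
    [G]. *)
Lemma sq_star : property_star H.
Proof.
have [P pP [Pa Pb Pc Pd]] := sq_avoid.
have [||||Q1 q1 [_ [qa1 qb1 qc1 qd1]]] := @sq_mkH P true false true false pP;
  rewrite ?(negbTE Pa) ?(negbTE Pb) ?(negbTE Pc) ?(negbTE Pd) //.
have [||||Q2 q2 [_ [qa2 qb2 qc2 qd2]]] := @sq_mkH P false true false true pP;
  rewrite ?(negbTE Pa) ?(negbTE Pb) ?(negbTE Pc) ?(negbTE Pd) //.
move=> y; case: (sq_caseH y) => [[x ->]|[->|->]|[->|->]]; last first.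
- by exists Q2.
- by exists Q1.
- by exists Q2.
- by exists Q1.
have via z : exists2 M, perfect_matching M & exists2 M', perfect_matching M' & legs M M' /\ (z \in sq_out -> k z \in M') /\ z \in M.
  have [M pM zM] := star z; have [M' pM' rel] := sq_ex pM.
  exists M => //; exists M' => //; split; first exact: sq_legs.
  by split=> // zo; rewrite (sq_relP _ _ rel).
case: (sq_caseG x) => [xo|[->|->]|[->|->]].
- by have [M _ [M' pM' [_ [/(_ xo) kM _]]]] := via x; exists M'.
- have [M _ [M' pM' [[la lb lc ld] [_ zM]]]] := via a; exists M' => //.
  by move: la; rewrite zM; case: (k a \in M').
- have [M _ [M' pM' [[la lb lc ld] [_ zM]]]] := via a; exists M' => //.
  by move: lb; rewrite zM addnC; case: (k b \in M').
- have [M _ [M' pM' [[la lb lc ld] [_ zM]]]] := via c; exists M' => //.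
  by move: lc; rewrite zM; case: (k c \in M').
have [M _ [M' pM' [[la lb lc ld] [_ zM]]]] := via c; exists M' => //.
by move: ld; rewrite zM addnC; case: (k d \in M').
Qed.

Lemma sq_hvecH M' : hvec M' f = 1 - (ind M' a' + ind M' b' + ind M' c' + ind M' d').
Proof.
have bwH : bw_edges H f = [set b'; d'].
  apply/setP => y; rewrite !inE.
  case: (sq_caseH y) => [[x ->]|[->|->]|[->|->]];
    rewrite ?sq_faces ?kE' ?sqE' ?eqxx ?(negbTE neq_la) ?(negbTE neq_lc) ?orbT //.
  case: (boolP (x \in [set a; c])) => [|xac]; last first.
    by rewrite k_face // sq_face; move: xac; rewrite !inE => /negbTE.
  by rewrite !inE => /orP[] /eqP ->; rewrite sq_faces (negbTE neq_fd, negbTE neq_fb).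
have wbH : wb_edges H f = [set a'; c'].
  apply/setP => y; rewrite !inE.
  case: (sq_caseH y) => [[x ->]|[->|->]|[->|->]];
    rewrite ?sq_faces ?kE' ?sqE' ?eqxx ?(negbTE neq_fb) ?(negbTE neq_fd) ?orbT //.
  case: (boolP (x \in [set b; d])) => [|xac]; last first.
    by rewrite lface_k // sq_lface; move: xac; rewrite !inE => /negbTE.
  by rewrite !inE => /orP[] /eqP ->; rewrite sq_faces (negbTE neq_la, negbTE neq_lc).
rewrite ffunE card_matching_face ?card_face_edges //; try exact: sq_star.
rewrite bwH wbH cards2 sqE' !sum_set2 ?sqE' //=; ring.
Qed.

Lemma sq_hvec_opp M M' : perfect_matching M -> perfect_matching M' -> sq_rel M M' ->
  hvec M' f = - hvec M f.
Proof.
move=> pM pM' rel; rewrite sq_hvec sq_hvecH.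
have [la lb lc ld] := sq_legs rel pM pM'; have [v1 v2 u1 u2] := sq_inner pM'.
rewrite la lb lc ld in v1 v2 u1 u2; rewrite /ind; clear -v1 v2 u1 u2; lia.
Qed.

(** A 2-cycle would make one of [face b], [face d] equal to one of [lface a], [lface c], and these
    are the two sides of a leg in [H]. *)
Lemma sq_no2 g : arrows G f g = 0%N \/ arrows G g f = 0%N.
Proof.
rewrite sq_arrows_from sq_arrows_to.
have lff := @lface_neq_face _ _ sq_star.
have fb : face b == Some g -> (lface a != Some g) && (lface c != Some g).
  move=> /eqP E; have := lff (k b) g; have := lff (k c) g; rewrite !sq_faces.
  by move=> /(_ E)/eqP -> /(_ E)/eqP ->.
have fd : face d == Some g -> (lface a != Some g) && (lface c != Some g).
  move=> /eqP E; have := lff (k a) g; have := lff (k d) g; rewrite !sq_faces.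
  by move=> /(_ E)/eqP -> /(_ E)/eqP ->.
case: (boolP (face b == Some g)) => [/fb/andP[/negbTE -> /negbTE ->]|_]; first by left.
by case: (boolP (face d == Some g)) => [/fd/andP[/negbTE -> /negbTE ->]|_]; [left|right].
Qed.

(** Matchings are sorted by their square edges. With none there are two partners, of factors [y_f]
    and 1; with one there is one partner, of factor [q 1]. The classes through [a], [c] and through
    [b], [d] lie over the same matchings of [H], so the first weighs [y_f] times the second. Every
    class then yields the common factor [1 + y_f], which is the 1 in the exponent
    [hvec N f = 1 - S N]. *)
Lemma sq_dimer_sum (R : comPzSemiRingType) (pw : 'I_n -> int -> R) (q : int -> R)
    (t : 'I_n -> int) N N' :
  (forall g, exponential (pw g)) -> exponential q -> q 1 = 1 + pw f 1 ->
  (forall g, used G g -> t g = beta G f g) ->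
  perfect_matching N -> perfect_matching N' -> sq_rel N N' ->
  dimer_sum (mut_pw pw q f t) N' =
    pw f (ind N c - ind N' a') * q (hvec N f) * dimer_sum pw N.
Proof.
move=> pw_exp q_exp q1 tE pN pN' rN.
have [p0 pD] := pw_exp f; have [q0 qD] := q_exp.
pose S M := ind M a + ind M b + ind M c + ind M d.
pose K := pw f (ind N c - ind N' a') * q (- S N).
pose w M := \prod_g pw g (height M N g).
pose w' M' := \prod_g mut_pw pw q f t g (height M' N' g).
have wE M M' : perfect_matching M -> perfect_matching M' -> sq_rel M M' ->
    w' M' = K * (pw f (ind M' a' - ind M c) * q (S M) * w M).
  move=> pM pM' rM; have hE := sq_height pM pN pM' pN' rM rN.
  rewrite /w' (mut_weight pw_exp q_exp tE sq_no2 pM pN); last first.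
    by move=> g /negbTE gf; rewrite hE gf.
  rewrite hE eqxx sq_bw sq_wb cards2 sqE !sum_set2 ?sqE //.
  set u := (X in pw f X); set v := (X in q X).
  have -> : u = (ind N c - ind N' a') + (ind M' a' - ind M c) by rewrite /u /=; ring.
  have -> : v = - S N + S M by rewrite /v /S; ring.
  by rewrite -/(w M) pD (qD (- S N)) /K; ring.
pose cnt (M : {set edge G}) := ((a \in M) + (b \in M) + (c \in M) + (d \in M))%N.
pose cnt' (M' : {set edge H}) := ((a' \in M') + (b' \in M') + (c' \in M') + (d' \in M'))%N.
have b2b (x y : bool) : (x : nat) = y -> x = y by case: x; case: y.
have uniql M M1 M2 : perfect_matching M -> perfect_matching M1 -> perfect_matching M2 ->
    sq_rel M M1 -> sq_rel M M2 -> (a' \in M1) = (a' \in M2) -> M1 = M2.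
  move=> pM p1 p2 r1 r2 e.
  have [la1 lb1 lc1 ld1] := sq_legs r1 pM p1; have [v1 v2 v3 v4] := sq_inner p1.
  have [la2 lb2 lc2 ld2] := sq_legs r2 pM p2; have [u1 u2 u3 u4] := sq_inner p2.
  rewrite -la2 in la1; rewrite -lb2 in lb1; rewrite -lc2 in lc1; rewrite -ld2 in ld1.
  have eb : (b' \in M1) = (b' \in M2).
    by apply: b2b; move: v1 u1; rewrite lb1 e; clear; lia.
  have ed : (d' \in M1) = (d' \in M2).
    by apply: b2b; move: v3 u3; rewrite la1 e; clear; lia.
  have ec : (c' \in M1) = (c' \in M2).
    by apply: b2b; move: v2 u2; rewrite ld1 ed; clear; lia.
  apply/setP => y; case: (sq_caseH y) => [[x ->]|[->|->]|[->|->]] //.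
  case: (sq_caseG x) => [xo|[->|->]|[->|->]]; try exact: b2b.
  by rewrite (sq_relP _ _ r1) // (sq_relP _ _ r2).
have uniqr M1 M2 M' : perfect_matching M1 -> perfect_matching M2 -> perfect_matching M' ->
    sq_rel M1 M' -> sq_rel M2 M' -> (c \in M1) = (c \in M2) -> M1 = M2.
  move=> p1 p2 pM' r1 r2 ec.
  have [la1 lb1 lc1 ld1] := sq_legs r1 p1 pM'; have [la2 lb2 lc2 ld2] := sq_legs r2 p2 pM'.
  have eb : (b \in M1) = (b \in M2).
    by apply: b2b; move: lc1 lc2; rewrite ec => ->; clear; lia.
  have ed : (d \in M1) = (d \in M2).
    by apply: b2b; move: ld1 ld2; rewrite ec => ->; clear; lia.
  have ea : (a \in M1) = (a \in M2).
    by apply: b2b; move: lb1 lb2; rewrite eb => ->; clear; lia.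
  apply/setP => x; case: (sq_caseG x) => [xo|[->|->]|[->|->]] //.
  by rewrite -(sq_relP _ _ r1) // (sq_relP _ _ r2).
(* On each class the exponents [j] and [l] are constant. This also makes the relation one-to-one
   there, since they fix the one edge on which two partners could differ. *)
have class_sum (P : pred {set edge G}) (Q : pred {set edge H}) j l :
    (forall M, perfect_matching M -> P M -> exists2 M', perfect_matching M' && Q M' & sq_rel M M') ->
    (forall M', perfect_matching M' -> Q M' -> exists2 M, perfect_matching M && P M & sq_rel M M') ->
    (forall M M', perfect_matching M -> perfect_matching M' -> P M -> Q M' -> sq_rel M M' ->
       ind M' a' - ind M c = j /\ S M = l) ->
    \sum_(M' | perfect_matching M' && Q M') w' M' =
    K * (pw f j * q l * \sum_(M | perfect_matching M && P M) w M).
  move=> exQ exP jl; rewrite !big_distrr /=; apply/esym; apply: (@sum_rel _ _ _ _ _ sq_rel).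
  - by move=> M /andP[pM PM]; exact: exQ.
  - by move=> M' /andP[pM' QM']; exact: exP.
  - move=> M M1 M2 /andP[pM PM] /andP[p1 Q1] /andP[p2 Q2] r1 r2; apply: uniql (r1) (r2) _ => //.
    have [j1 _] := jl _ _ pM p1 PM Q1 r1; have [j2 _] := jl _ _ pM p2 PM Q2 r2.
    by move: j1 j2; rewrite /ind; case: (a' \in M1); case: (a' \in M2); clear; lia.
  - move=> M1 M2 M' /andP[p1 P1] /andP[p2 P2] /andP[pM' QM'] r1 r2; apply: uniqr (r1) (r2) _ => //.
    have [j1 _] := jl _ _ p1 pM' P1 QM' r1; have [j2 _] := jl _ _ p2 pM' P2 QM' r2.
    by move: j1 j2; rewrite /ind; case: (c \in M1); case: (c \in M2); clear; lia.
  by move=> M M' /andP[pM PM] /andP[pM' QM'] rM; have [<- <-] := jl _ _ pM pM' PM QM' rM; apply/esym; exact: wE.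
have K0 : \sum_(M' | perfect_matching M' && ((a' \in M') && (c' \in M'))) w' M' =
    K * (pw f 1 * q 0 * \sum_(M | perfect_matching M && (cnt M == 0%N)) w M).
  apply: class_sum => [M pM /eqP M0|M' pM' /andP[Ma' Mc']|M M' pM pM' /eqP M0 /andP[Ma' Mc'] _].
  - have [||||M' pM' [rel [ea _ ec _]]] := @sq_mkH M true false true false pM;
      try by move: M0; rewrite /cnt; clear; lia.
    by exists M'; rewrite ?pM' ?ea ?ec.
  - have [v1 v2 u1 u2] := sq_inner pM'; rewrite Ma' Mc' in v1 v2 u1 u2.
    have [||||M pM [rel [ea eb ec ed]]] := @sq_mkG M' false false false false pM';
      try by move: v1 v2 u1 u2; clear; lia.
    by exists M; rewrite // pM /cnt ea eb ec ed.
  by rewrite /ind Ma' /S /ind; move: M0; rewrite /cnt; clear; lia.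
have K1 : \sum_(M' | perfect_matching M' && ((b' \in M') && (d' \in M'))) w' M' =
    K * (pw f 0 * q 0 * \sum_(M | perfect_matching M && (cnt M == 0%N)) w M).
  apply: class_sum => [M pM /eqP M0|M' pM' /andP[Mb' Md']|M M' pM pM' /eqP M0 /andP[Mb' Md'] _].
  - have [||||M' pM' [rel [_ eb _ ed]]] := @sq_mkH M false true false true pM;
      try by move: M0; rewrite /cnt; clear; lia.
    by exists M'; rewrite ?pM' ?eb ?ed.
  - have [v1 v2 u1 u2] := sq_inner pM'; rewrite Mb' Md' in v1 v2 u1 u2.
    have [||||M pM [rel [ea eb ec ed]]] := @sq_mkG M' false false false false pM';
      try by move: v1 v2 u1 u2; clear; lia.
    by exists M; rewrite // pM /cnt ea eb ec ed.
  have [v1 _ _ _] := sq_inner pM'; rewrite Mb' in v1.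
  by rewrite /S /ind; move: M0 v1; rewrite /cnt; clear; lia.
have K2 : \sum_(M' | perfect_matching M' && (cnt' M' == 1%N)) w' M' =
    K * (pw f 0 * q 1 * \sum_(M | perfect_matching M && (cnt M == 1%N)) w M).
  apply: class_sum => [M pM /eqP M1|M' pM' /eqP M1|M M' pM pM' /eqP M1 /eqP M1' rel].
  - have [M' pM' rel] := sq_ex pM; exists M' => //; rewrite pM' /=; apply/eqP.
    have [la lb lc ld] := sq_legs rel pM pM'; have [v1 v2 u1 u2] := sq_inner pM'.
    rewrite la lb lc ld in v1 v2 u1 u2.
    by move: M1 v1 v2 u1 u2; rewrite /cnt /cnt'; clear; lia.
  - have [v1 v2 u1 u2] := sq_inner pM'.
    (* A square edge is taken exactly when the legs at both of its endpoints are. *)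
    pose p x y := (k x \in M') && (k y \in M').
    have [||||M pM [rel [ea eb ec ed]]] := @sq_mkG M' (p a b) (p b c) (p c d) (p d a) pM';
      try by move: M1 v1 v2 u1 u2; rewrite /p /cnt'; clear;
        case: (k a \in M'); case: (k b \in M'); case: (k c \in M'); case: (k d \in M');
        case: (a' \in M'); case: (b' \in M'); case: (c' \in M'); case: (d' \in M').
    exists M; rewrite // pM /cnt ea eb ec ed /=.
    move: M1 v1 v2 u1 u2; rewrite /p /cnt'; clear.
    by case: (k a \in M'); case: (k b \in M'); case: (k c \in M'); case: (k d \in M');
      case: (a' \in M'); case: (b' \in M'); case: (c' \in M'); case: (d' \in M').
  have [la lb lc ld] := sq_legs rel pM pM'; have [v1 v2 u1 u2] := sq_inner pM'.
  rewrite la lb lc ld in v1 v2 u1 u2.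
  by move: M1 v1 v2 u1 u2; rewrite /S /ind /cnt; clear; lia.
(* The flag [s] selects the pair [a], [c] or the pair [b], [d]; the left-hand side does not depend
   on it. *)
have K34 (s : bool) (P := fun M : {set edge G} =>
      if s then (a \in M) && (c \in M) else (b \in M) && (d \in M)) :
    \sum_(M' | perfect_matching M' && (cnt' M' == 0%N)) w' M' =
    K * (pw f (- (s : nat)%:Z) * q 2 * \sum_(M | perfect_matching M && P M) w M).
  have bits M : perfect_matching M -> P M ->
      [/\ (a \in M) = s, (b \in M) = ~~ s, (c \in M) = s & (d \in M) = ~~ s].
    move=> pM; have [] := sq_adj pM; rewrite /P; clear.
    by case: s; case: (a \in M); case: (b \in M); case: (c \in M); case: (d \in M).
  apply: class_sum => [M pM PM|M' pM' /eqP M0|M M' pM pM' PM /eqP M0 rel].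
  - have [ea eb ec ed] := bits M pM PM.
    have [M' pM' rel] := sq_ex pM; exists M' => //; rewrite pM' /=; apply/eqP.
    have [la lb lc ld] := sq_legs rel pM pM'; have [v1 v2 u1 u2] := sq_inner pM'.
    rewrite la lb lc ld ea eb ec ed in v1 v2 u1 u2.
    by move: v1 v2 u1 u2; rewrite /cnt'; clear; case: s; lia.
  - have [v1 v2 u1 u2] := sq_inner pM'.
    have [||||M pM [rel [ea eb ec ed]]] := @sq_mkG M' s (~~ s) s (~~ s) pM';
      try by move: M0 v1 v2 u1 u2; rewrite /cnt'; clear; case: s; lia.
    by exists M; rewrite // pM /P ea eb ec ed; case: (s).
  have [ea eb ec ed] := bits M pM PM; rewrite /S /ind ea eb ec ed.
  have a'0 : (a' \in M') = false by move: M0; rewrite /cnt'; case: (a' \in M').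
  by rewrite a'0; case: (s).
have sumG : dimer_sum pw N = \sum_(M | perfect_matching M && (cnt M == 0%N)) w M
    + \sum_(M | perfect_matching M && (cnt M == 1%N)) w M
    + \sum_(M | perfect_matching M && ((a \in M) && (c \in M))) w M
    + \sum_(M | perfect_matching M && ((b \in M) && (d \in M))) w M.
  rewrite /dimer_sum !big_mkcondr /= -!big_split /=; apply: eq_bigr => M pM; rewrite -/(w M) /cnt.
  have [] := sq_adj pM.
  by case: (a \in M); case: (b \in M); case: (c \in M); case: (d \in M); rewrite //= ?addr0 ?add0r.
have sumH : dimer_sum (mut_pw pw q f t) N' =
    \sum_(M' | perfect_matching M' && ((a' \in M') && (c' \in M'))) w' M'
    + \sum_(M' | perfect_matching M' && ((b' \in M') && (d' \in M'))) w' M'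
    + \sum_(M' | perfect_matching M' && (cnt' M' == 1%N)) w' M'
    + \sum_(M' | perfect_matching M' && (cnt' M' == 0%N)) w' M'.
  rewrite /dimer_sum !big_mkcondr /= -!big_split /=; apply: eq_bigr => M' pM'; rewrite -/(w' M') /cnt'.
  have [] := sq_inner pM'.
  by case: (a' \in M'); case: (b' \in M'); case: (c' \in M'); case: (d' \in M');
     rewrite //= ?addr0 ?add0r.
rewrite sumH sumG K0 K1 K2.
have := K34 true; have := K34 false; rewrite /=.
set Y0 := \sum_(M : {set edge G} | _ && (cnt M == 0%N)) w M.
set Y1 := \sum_(M : {set edge G} | _ && (cnt M == 1%N)) w M.
set Yac := \sum_(M : {set edge G} | _ && ((a \in M) && (c \in M))) w M.
set Ybd := \sum_(M : {set edge G} | _ && ((b \in M) && (d \in M))) w M.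
move=> -> KE; rewrite oppr0 in KE *.
pose Ki := pw f (ind N' a' - ind N c) * q (S N).
have KK : Ki * K = 1.
  rewrite /K /Ki mulrACA -pD -qD subrr.
  have -> : ind N' a' - ind N c + (ind N c - ind N' a') = 0 by ring.
  by rewrite p0 q0 mulr1.
have pp : pw f 1 * pw f (-1) = 1 by rewrite -pD subrr.
have qq : q (-2) * q 2 = 1 by rewrite -qD addNr.
have q2 : q 2 = q 1 * q 1 by rewrite -qD.
have Yac_bd : Yac = pw f 1 * Ybd.
  transitivity (Ki * K * (pw f 1 * pw f (-1)) * (q (-2) * q 2) * Yac).
    by rewrite KK pp qq !mul1r.
  transitivity (Ki * pw f 1 * q (-2) * (K * (pw f (-1) * q 2 * Yac))); first by ring.
  rewrite -KE p0 mul1r.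
  transitivity (Ki * K * (q (-2) * q 2) * (pw f 1 * Ybd)); first by ring.
  by rewrite KK qq !mul1r.
have -> : q (hvec N f) = q (- S N) * q 1.
  by rewrite -qD; congr q; rewrite sq_hvec /S addrC.
by rewrite [pw f _ * (q _ * q 1)]mulrA -/K p0 q0 Yac_bd q2 q1; ring.
Qed.

Lemma sq_step (N : {set edge G}) : perfect_matching N -> exists (N' : {set edge H}) c0,
  [/\ perfect_matching N', mutation_step f N N' c0, hvec N' f = - hvec N f, used H f &
    forall v, arrows H f v = arrows G v f /\ arrows H v f = arrows G f v].
Proof.
move=> pN; have [N' pN' rN] := sq_ex pN; exists N', (ind N c - ind N' a'); split=> //.
- split.
  + exact: sq_star.
  + exact: used_face fa.
  + by move=> g _; rewrite sq_used.
  + exact: sq_no2.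
  + exact: sq_arrows.
  by move=> *; apply: sq_dimer_sum.
- exact: sq_hvec_opp.
- by rewrite sq_used; exact: used_face fa.
by move=> v; rewrite sq_arrowsH_from sq_arrowsH_to.
Qed.

End Star.

End Square.

Lemma contraction_invariance n (G H : plane_bigraph n) : contraction G H ->
  [/\ forall f, used G f = used H f, forall f g, beta G f g = beta H f g,
      property_star G <-> property_star H &
      exists r, @matching_corr n G H r].
Proof.
case=> c [e1 [e2 [i [[orb ne df d1 d2] [ii ic] sE tE ifc]]]].
split; last exists (@contraction_rel n G H i).
- by apply: contraction_used; eassumption.
- by apply: contraction_beta; eassumption.
- by apply: contraction_star; eassumption.
by apply: contraction_corr; eassumption.
Qed.

Lemma square_step n (f : 'I_n) (G H : plane_bigraph n) (N : {set edge G}) :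
  square_move f G H -> property_star G -> perfect_matching N ->
  exists (N' : {set edge H}) c0, [/\ perfect_matching N', @mutation_step n f G H N N' c0,
    hvec N' f = - hvec N f, used H f &
    forall v, arrows H f v = arrows G v f /\ arrows H v f = arrows G f v].
Proof.
case=> a [b [c [d [k [a' [b' [c' [d' [[fa cwa cbb cwc cbd] [ncb ncw [dba dwa dbc dwc]]
  [ki un kc] [kb kw [wd wa wka [wb wc wkc]] [ba bb bkb [bc bd bkd]]]
  [kf fka fkc [fa' fc' fb' fd']]]]]]]]]]].
by move=> star pN; apply: sq_step; eassumption.
Qed.

Lemma bigon_removal_step n (f : 'I_n) (G H : plane_bigraph n) (N : {set edge G}) :
  bigon_removal f G H -> property_star G -> perfect_matching N ->
  exists (N' : {set edge H}) c0 e', [/\ perfect_matching N', @mutation_step n f G H N N' c0,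
    hvec N f = - ind N' e', ~~ used H f &
    forall M', perfect_matching M' ->
      \sum_g - beta G f g * height M' N' g = ind M' e' - ind N' e'].
Proof.
case=> e [e' [i [[fe nee' cwe cbe'] [db dw] [ii ic] iccw ifc]]] star pN.
have [k ik ki] : exists2 k : edge G -> edge H, cancel i k & forall z, z != e -> i (k z) = z.
  by apply: bigon_inv; eassumption.
have [N' pN' rN] : exists2 N', perfect_matching N' & bigon_rel e e' i k N N'.
  by apply: bigon_ex; eassumption.
exists N', (ind N e), (k e'); split=> //.
- by apply: bigon_step; eassumption.
- have -> : hvec N f = - (ind N e + ind N e') by apply: bigon_hvec; eassumption.
  by congr (- _); apply/esym; apply: ind_bigon; eassumption.
- have -> : used H f = (f != f) && used G f by apply: bigon_used; eassumption.
  by rewrite eqxx.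
by move=> M' pM'; apply: bigon_height_sum; eassumption.
Qed.

(** Contractions in both directions preserve the bounded faces, and a single edge has none. *)
Lemma reduction_nil_unused n (G : plane_bigraph n) r f :
  reduction_seq G r -> r = [::] -> ~~ used G f.
Proof.
elim=> {G r} [G|G H r ctr _ IH|G H r ctr _ IH|//|//].
  move=> E1 _; apply/existsP => -[e /eqP fe]; have [e0 fe0] := outer_face G.
  have /cards1P[x Ex] : #|[set: edge G]| == 1%N by rewrite cardsT E1.
  have eE z : z = x by have := in_setT z; rewrite Ex inE => /eqP.
  by rewrite (eE e) -(eE e0) fe0 in fe.
- by have [uE _ _ _] := contraction_invariance ctr; rewrite uE.
by have [uE _ _ _] := contraction_invariance ctr; rewrite -uE.
Qed.

(** No move starts from a single edge. For an uncontraction, the degree conditions provide the two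
    distinct edges [t e1] and [t e2] that survive in the contracted graph. *)
Lemma reduction_single_nil n (G : plane_bigraph n) r :
  reduction_seq G r -> #|edge G| = 1%N -> r = [::].
Proof.
have two (G' : plane_bigraph n) (x y : edge G') : x != y -> #|edge G'| != 1%N.
  move=> xy; rewrite -cardsT; apply: contra xy => /cards1P[z zE].
  by apply/eqP; have := in_setT x; have := in_setT y; rewrite zE !inE => /eqP -> /eqP ->.
case=> {G r} [//|G H r ctr _|G H r ctr _|f G H r sq _|f G H r bg _] /eqP E1.
- by case: ctr => c [e1 [e2 [i [[_ ne _ _ _] _ _ _ _]]]]; have := two _ _ _ ne; rewrite E1.
- case: ctr => c [e1 [e2 [i [[orb ne df d1 d2] [ii ic] sE tE ifc]]]].
  have n1 : ccw H (~~ c) e1 \notin [set e1; e2] by apply: t_e1; eassumption.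
  have n2 : ccw H (~~ c) e2 \notin [set e1; e2] by apply: t_e2; eassumption.
  have [x xE] : exists x, ccw H (~~ c) e1 = i x by apply: codom_iP; eassumption.
  have [y yE] : exists x, ccw H (~~ c) e2 = i x by apply: codom_iP; eassumption.
  case: (eqVneq x y) => [xy|xy]; last by have := two _ _ _ xy; rewrite E1.
  by case/eqP: ne; apply: (@perm_inj _ (ccw H (~~ c))); rewrite xE yE xy.
- case: sq => a [b [c [d [k [a' [b' [c' [d' [_ [ncb _ _] _ _ _]]]]]]]]].
  have ac : a != c by apply: contraNneq ncb => <-; exact: porbit_id.
  by have := two _ _ _ ac; rewrite E1.
by case: bg => e [e' [i [[_ ne _ _] _ _ _ _]]]; have := two _ _ _ ne; rewrite E1.
Qed.

(* The (min, +) semiring, with [None] as the infinite element. *)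
Definition trop := option int.

Definition trop_add (x y : trop) : trop :=
  match x, y with
  | Some i, Some j => Some (Num.min i j)
  | Some i, None => Some i
  | None, _ => y
  end.

Definition trop_mul (x y : trop) : trop :=
  match x, y with Some i, Some j => Some (i + j) | _, _ => None end.

Lemma trop_addA : associative trop_add.
Proof. by move=> [i|] [j|] [l|] //=; rewrite minA. Qed.
Lemma trop_addC : commutative trop_add.
Proof. by move=> [i|] [j|] //=; rewrite minC. Qed.
Lemma trop_add0 : left_id None trop_add. Proof. by case. Qed.
Lemma trop_mulA : associative trop_mul.
Proof. by move=> [i|] [j|] [l|] //=; rewrite addrA. Qed.
Lemma trop_mulC : commutative trop_mul.
Proof. by move=> [i|] [j|] //=; rewrite addrC. Qed.
Lemma trop_mul1 : left_id (Some 0) trop_mul.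
Proof. by case=> //= i; rewrite add0r. Qed.
Lemma trop_mulDl : left_distributive trop_mul trop_add.
Proof. by move=> [i|] [j|] [l|] //=; rewrite addr_minl. Qed.
Lemma trop_mul0 : left_zero None trop_mul. Proof. by []. Qed.

HB.instance Definition _ := Choice.on trop.
HB.instance Definition _ := GRing.isNmodule.Build trop trop_addA trop_addC trop_add0.
HB.instance Definition _ := GRing.Nmodule_isComPzSemiRing.Build trop
  trop_mulA trop_mulC trop_mul1 trop_mulDl trop_mul0.

Lemma trop_prod (I : finType) (F : I -> int) :
  \prod_i (Some (F i) : trop) = Some (\sum_i F i) :> trop.
Proof.
pose S z : trop := Some z.
have SD : {morph S : x y / x + y >-> x * y} by [].
have S0 : S 0 = 1 by [].
by rewrite -[RHS]/(S _) (big_morph S SD S0).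
Qed.

Lemma trop_sum (I : finType) (P : pred I) (F : I -> int) i0 : P i0 ->
  (forall i, P i -> F i0 <= F i) -> \sum_(i | P i) (Some (F i) : trop) = Some (F i0) :> trop.
Proof.
move=> Pi0 Fmin; rewrite (bigD1 i0) //=.
elim/big_rec: _ => [//|i x /andP[Pi _] IH].
rewrite addrCA IH; change (Some (Num.min (F i) (F i0)) = Some (F i0)); congr Some.
by have := Fmin i Pi; lia.
Qed.

Section TropMin.

Variables (n : nat) (G : plane_bigraph n).
Implicit Types (b : 'I_n -> int) (N M : {set edge G}).

Definition trop_pw b (g : 'I_n) (k : int) : trop := Some (b g * k).

(** The least value of [\sum_g b g * height M N g] over the matchings [M]. When [N] is a perfect
    matching the default 0 is never taken, by [trop_min_Some]. *)
Definition trop_min b N : int := odflt 0 (dimer_sum (trop_pw b) N).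

Lemma trop_minE b N M : perfect_matching M ->
  (forall P, perfect_matching P ->
     \sum_g b g * height M N g <= \sum_g b g * height P N g) ->
  dimer_sum (trop_pw b) N = Some (\sum_g b g * height M N g).
Proof.
move=> pM Mmin; rewrite /dimer_sum (eq_bigr (fun P => Some (\sum_g b g * height P N g) : trop)).
  exact: (trop_sum (P := @perfect_matching n G) (F := fun P => \sum_g b g * height P N g)).
by move=> P _; rewrite /trop_pw (trop_prod (fun g => b g * height P N g)).
Qed.

Lemma trop_min_Some b N : perfect_matching N ->
  dimer_sum (trop_pw b) N = Some (trop_min b N).
Proof.
move=> pN; have [M pM Mmin] := @exists_minimizer _ (@perfect_matching n G)
  (fun M => \sum_g b g * height M N g) N pN.
by rewrite /trop_min (trop_minE pM).
Qed.

Lemma trop_min_eq b N M : perfect_matching M ->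
  (forall P, perfect_matching P ->
     \sum_g b g * height M N g <= \sum_g b g * height P N g) ->
  trop_min b N = \sum_g b g * height M N g.
Proof. by move=> pM Mmin; rewrite /trop_min (trop_minE pM). Qed.

End TropMin.

(** * Seeds *)

Section SeedMutation.

Variables (V : finType) (K : fieldType).
Implicit Types (x : V -> K) (a b : V -> int) (Q : quiver V) (u v j k : V).

Definition monom x a : K := \prod_v x v ^ a v.

Definition sgn Q u v : int := (Q u v)%:Z - (Q v u)%:Z.

Definition no_2cycle Q := forall u v, Q u v = 0%N \/ Q v u = 0%N.

Definition yh x Q j : K := monom x (fun u => sgn Q u j).

Lemma no_2cycle_cancel Q : no_2cycle (cancel_2cycles Q).
Proof. by move=> u v; rewrite /cancel_2cycles; lia. Qed.

Lemma no_2cycle_diag Q v : no_2cycle Q -> Q v v = 0%N.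
Proof. by move/(_ v v) => []. Qed.

Lemma sgn_opp Q u v : sgn Q v u = - sgn Q u v.
Proof. by rewrite /sgn opprB. Qed.

Lemma sgn_cancel Q u v : sgn (cancel_2cycles Q) u v = sgn Q u v.
Proof. by rewrite /sgn /cancel_2cycles; lia. Qed.

Lemma no_2cycleE Q u v : no_2cycle Q -> (Q u v)%:Z = Num.max 0 (sgn Q u v).
Proof. by move/(_ u v); rewrite /sgn => -[] ->; lia. Qed.

Lemma sgn_mutate_at Q k u : sgn (mutate_quiver k Q) k u = - sgn Q k u.
Proof. by rewrite sgn_cancel /sgn !eqxx orbT opprB. Qed.

Lemma sgn_mutate_at' Q k u : sgn (mutate_quiver k Q) u k = - sgn Q u k.
Proof. by rewrite sgn_opp sgn_mutate_at (sgn_opp Q u k) !opprK. Qed.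

Lemma sgn_mutate Q k u v : u != k -> v != k -> sgn (mutate_quiver k Q) u v =
  sgn Q u v + (Q u k)%:Z * (Q k v)%:Z - (Q v k)%:Z * (Q k u)%:Z.
Proof.
move=> /negbTE uk /negbTE vk; rewrite sgn_cancel /sgn uk vk /=.
rewrite !PoszD !PoszM; ring.
Qed.

Section Monom.
Variable x : V -> K.
Hypothesis x_nz : forall v, x v != 0.

Lemma monomD a b : monom x a * monom x b = monom x (fun v => a v + b v).
Proof. by rewrite -big_split; apply: eq_bigr => v _; rewrite expfzDr. Qed.

Lemma monomX a (m : int) : monom x a ^ m = monom x (fun v => a v * m).
Proof.
rewrite /monom (big_morph (fun y : K => y ^ m) (fun y z => expfzMl y z m) (exp1rz _ m)).
by apply: eq_bigr => v _; rewrite exprz_exp.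
Qed.

Lemma monom_ext a b : a =1 b -> monom x a = monom x b.
Proof. by move=> ab; apply: eq_bigr => v _; rewrite ab. Qed.

Lemma monom0 : monom x (fun=> 0) = 1.
Proof. by rewrite /monom big1. Qed.

Lemma monom_delta k : monom x (fun v => (v == k : nat)%:Z) = x k.
Proof.
rewrite /monom (bigD1 k) //= eqxx big1 ?mulr1 // => v /negbTE ->; exact: expr0z.
Qed.

Lemma monom_neq0 a : monom x a != 0.
Proof. by rewrite prodf_seq_neq0; apply/allP => v _; rewrite expfz_neq0. Qed.

End Monom.

Section Step.
Variables (x : V -> K) (Q : quiver V) (k : V).
Hypothesis x_nz : forall v, x v != 0.
Hypothesis Q2 : no_2cycle Q.
Notation S' := (mutate (Seed x Q) k).
Notation x' := (cluster S').
Notation z := (x' k).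
Hypothesis z_nz : z != 0.

Lemma monom_mutate a :
  monom x' a = z ^ a k * monom x (fun v => if v == k then 0 else a v).
Proof.
have : forall v, v != k -> x' v = x v by move=> v /negbTE /= ->.
move: (x') => y yE.
rewrite /monom (bigD1 k) //= [in RHS](bigD1 k) //= eqxx expr0z mul1r; congr (_ * _).
by apply: eq_bigr => v vk; rewrite yE // (negbTE vk).
Qed.

(** The exchange relation divided by the product over the arrows leaving [k]. *)
Lemma exchange_yh : 1 + yh x Q k =
  z * monom x (fun u => (u == k : nat)%:Z - (Q k u)%:Z).
Proof.
rewrite /= eqxx.
have -> : \prod_u x u ^+ Q u k = monom x (fun u => (Q u k)%:Z) by [].
have -> : \prod_u x u ^+ Q k u = monom x (fun u => (Q k u)%:Z) by [].
rewrite -(monomD x_nz (fun u => (u == k : nat)%:Z) (fun u => - (Q k u)%:Z)).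
rewrite monom_delta mulrA divfK // mulrDl !monomD // addrC; congr (_ + _).
by rewrite -(monom0 x); apply: monom_ext => v; rewrite subrr.
Qed.

Lemma yh_mutate_at : yh x' (seed_quiver S') k = (yh x Q k)^-1.
Proof.
rewrite /yh monom_mutate sgn_mutate_at {1}/sgn subrr oppr0 expr0z mul1r.
rewrite -exprN1 monomX; apply: monom_ext => v; rewrite sgn_mutate_at' mulrN1.
by case: eqP => // ->; rewrite /sgn subrr oppr0.
Qed.

Lemma yh_mutate j : j != k -> yh x' (seed_quiver S') j =
  yh x Q j * yh x Q k ^ Num.max 0 (sgn Q k j) * (1 + yh x Q k) ^ (- sgn Q k j).
Proof.
move=> jk; rewrite exchange_yh expfzMl {1}/yh monom_mutate sgn_mutate_at.
rewrite mulrCA; congr (_ * _); rewrite /yh !monomX !monomD //.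
apply: monom_ext => v; rewrite -(no_2cycleE k j Q2).
case: (eqVneq v k) => [->|vk]; last first.
  rewrite sgn_mutate // /sgn /=; case: (Q2 k j) => ->; ring.
rewrite (no_2cycle_diag k Q2) /sgn (no_2cycle_diag k Q2) /=; ring.
Qed.

(** The rule for [a'] away from [k] lets the monomial absorb the powers of [yh x Q k] and
    [1 + yh x Q k] created by the mutation of coefficients. The exponents at [k] stay free and
    survive as a power of [z]. *)
Lemma monom_step (a a' : V -> int) (c : int) (Z : K) :
  (forall v, v != k -> a' v = a v - (c * sgn Q v k + a k * Num.min 0 (sgn Q v k))) ->
  monom x' a' * (yh x Q k ^ c * (1 + yh x Q k) ^ a k * Z) =
  z ^ (a' k + a k) * (monom x a * Z).
Proof.
move=> aE; rewrite exchange_yh expfzMl /yh monom_mutate !monomX expfzDr //.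
set A := monom x _; set B := monom x _; set C := monom x _; set D := monom x a.
suff <- : A * B * C = D by ring.
rewrite /A /B /C !monomD //; apply: monom_ext => v.
have minE : Num.min 0 (sgn Q v k) = - (Q k v)%:Z.
  by rewrite (no_2cycleE k v Q2) (sgn_opp Q v k); lia.
case: (eqVneq v k) => [->|vk] /=; last by rewrite aE // minE; ring.
by rewrite /sgn (no_2cycle_diag k Q2); ring.
Qed.

End Step.

End SeedMutation.

(** * Invariance of the normalised dimer sum under moves and mutations *)

Section ClusterFormula.

Variables (n : nat) (V : finType) (iota : 'I_n -> V) (K : fieldType).
Hypothesis iota_inj : injective iota.
Variable pos : K -> Prop.
Hypothesis pos_neq0 : forall y, pos y -> y != 0.
Hypothesis posD : forall y z, pos y -> pos z -> pos (y + z).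
Hypothesis posM : forall y z, pos y -> pos z -> pos (y * z).
Hypothesis posV : forall y, pos y -> pos y^-1.
Hypothesis pos1 : pos 1.

Implicit Types (G H : plane_bigraph n) (S : seed V K).

Lemma pos_mutate S k : (forall v, pos (cluster S v)) ->
  forall v, pos (cluster (mutate S k) v).
Proof.
move=> px v /=; case: eqP => // _.
have posX y m : pos y -> pos (y ^+ m).
  by move=> py; elim: m => [|m IH]; rewrite ?expr0 // exprS; exact: posM.
have posP (m : V -> nat) : pos (\prod_u cluster S u ^+ m u).
  by elim/big_rec: _ => // u y _ py; apply: posM => //; exact: posX.
by apply: posM; [exact: posD | exact: posV].
Qed.

(** Arrows are prescribed between used faces only, so deleted and frozen vertices may remain in the
    seed. Membership in the semifield [pos] passes to all later clusters and keeps every denominator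
    nonzero. *)
Definition compatible G S :=
  [/\ forall v, pos (cluster S v), no_2cycle (seed_quiver S) &
      forall f g, used G f -> used G g ->
        sgn (seed_quiver S) (iota f) (iota g) = beta G f g].

Definition in_used G (v : V) := [exists g, used G g && (v == iota g)].

(* Normalised so that, in [dimer_value], the least exponent of a cluster variable
   is -1 at the faces of [G] and 0 at deleted or frozen vertices. *)
Definition expo G S (N : {set edge G}) (v : V) : int :=
  - (in_used G v : nat)%:Z - trop_min (fun g => sgn (seed_quiver S) v (iota g)) N.

Definition dimer_value G S (N : {set edge G}) : K :=
  monom (cluster S) (expo S N) *
  dimer_sum (fun g m => yh (cluster S) (seed_quiver S) (iota g) ^ m) N.

Lemma in_used_iota G g : in_used G (iota g) = used G g.
Proof.
apply/existsP/idP => [[g' /andP[ug /eqP/iota_inj ->]] //|ug].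
by exists g; rewrite ug eqxx.
Qed.

Lemma dimer_sum_ext (R : comPzSemiRingType) (pw pw' : 'I_n -> int -> R) G (N : {set edge G}) :
  (forall g m, pw g m = pw' g m) -> dimer_sum pw N = dimer_sum pw' N.
Proof. by move=> E; apply: eq_bigr => M _; apply: eq_bigr => g _. Qed.

Lemma sum_used (b b' : 'I_n -> int) G (M N : {set edge G}) :
  perfect_matching M -> perfect_matching N -> (forall g, used G g -> b g = b' g) ->
  \sum_g b g * height M N g = \sum_g b' g * height M N g.
Proof.
move=> pM pN E; apply: eq_bigr => g _.
by case: (boolP (used G g)) => [/E -> //|ug]; rewrite height_unused // !mulr0.
Qed.

(** By [hvec_height] the tropical minimum is that of [hvec M f - hvec N f]. The least [hvec M f] is
    -1, attained where [f] can be flipped, and the shift by 1 in [expo] compensates for it. *)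
Lemma expo_used G S (N : {set edge G}) f : property_star G -> compatible G S ->
  perfect_matching N -> used G f -> expo S N (iota f) = hvec N f.
Proof.
move=> star [_ _ sE] pN uf; rewrite /expo in_used_iota uf.
have sumE M : perfect_matching M ->
    \sum_g sgn (seed_quiver S) (iota f) (iota g) * height M N g = hvec M f - hvec N f.
  move=> pM; rewrite hvec_height //; apply: sum_used => // g ug; exact: sE.
have [M pM hM] := hvec_min star uf.
rewrite (trop_min_eq pM) ?sumE // ?hM; first by move=> /=; ring.
by move=> P pP; rewrite sumE // lerD2r; exact: hvec_ge.
Qed.

Lemma exponential_exprz (y : K) : y != 0 -> exponential (fun m => y ^ m).
Proof. by move=> y0; split=> [|i j]; [exact: expr0z | exact: expfzDr]. Qed.

Lemma exponential_trop (m : int) : exponential (fun i => Some (m * i) : trop).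
Proof. by split=> [|i j]; rewrite ?mulr0 // mulrDr. Qed.

Section Step.
Variables (f : 'I_n) (G H : plane_bigraph n) (N : {set edge G}) (N' : {set edge H}).
Variables (c : int) (S : seed V K).
Hypothesis star : property_star G.
Hypothesis step : mutation_step f N N' c.
Hypothesis comp : compatible G S.
Hypothesis pN : perfect_matching N.
Hypothesis pN' : perfect_matching N'.
Notation S' := (mutate S (iota f)).
Notation Q := (seed_quiver S).
Notation x := (cluster S).

Lemma x_neq0 v : x v != 0.
Proof. by case: comp => px _ _; exact: pos_neq0. Qed.

Lemma x'_neq0 v : cluster S' v != 0.
Proof. by apply: pos_neq0; apply: pos_mutate; case: comp. Qed.

Lemma sgn_step g : used G g -> sgn Q (iota f) (iota g) = beta G f g.
Proof. by case: comp => _ _ sE ug; rewrite sE // (step_used step). Qed.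

Lemma yh_pos j : yh x Q j != 0.
Proof. exact: monom_neq0 x_neq0 _. Qed.

Lemma yh1_neq0 : 1 + yh x Q (iota f) != 0.
Proof.
case: S comp x_neq0 x'_neq0 => y R [_ R2 _] /= y0 y'0.
rewrite (exchange_yh R (iota f) y0) mulf_neq0 ?monom_neq0 //; exact: (y'0 (iota f)).
Qed.

(** This is [step_sum] in the (min, +) semiring: [y_g] becomes the exponent [sgn Q v (iota g)] of
    the variable at [v] in [yh], and [1 + y_f] becomes [Num.min 0 B]. Quiver mutation at [v] then
    reads as mutation of tropical coefficients. *)
Lemma trop_min_step v : v != iota f ->
  trop_min (fun g => sgn (seed_quiver S') v (iota g)) N' =
  trop_min (fun g => sgn Q v (iota g)) N
  + (c * sgn Q v (iota f) + hvec N f * Num.min 0 (sgn Q v (iota f))).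
Proof.
move=> vf; set B := sgn Q v (iota f).
pose q i : trop := Some (Num.min 0 B * i).
have q1 : q 1 = 1 + trop_pw (fun g => sgn Q v (iota g)) f 1.
  by rewrite /q /trop_pw !mulr1.
have E := step_sum step (pw := trop_pw (fun g => sgn Q v (iota g))) (q := q)
  (t := fun g => sgn Q (iota f) (iota g)) (fun g => exponential_trop _) (exponential_trop _) q1 sgn_step.
have Q2 : no_2cycle Q by case: comp.
have : dimer_sum (trop_pw (fun g => sgn (seed_quiver S') v (iota g))) N' =
   trop_pw (fun g => sgn Q v (iota g)) f c * q (hvec N f) *
   dimer_sum (trop_pw (fun g => sgn Q v (iota g))) N.
  rewrite -E; apply: dimer_sum_ext => g m; rewrite /trop_pw /mut_pw.
  case: (eqVneq g f) => [->|gf].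
    by rewrite [seed_quiver _]/= sgn_mutate_at' mulrN mulNr.
  have gf' : iota g != iota f by rewrite (inj_eq iota_inj).
  change (Some (sgn (mutate_quiver (iota f) Q) v (iota g) * m) =
    Some (sgn Q v (iota g) * m + B * (m * Num.max 0 (sgn Q (iota f) (iota g)))
      + Num.min 0 B * (- (m * sgn Q (iota f) (iota g))))).
  congr Some; rewrite sgn_mutate // -(no_2cycleE (iota f) (iota g) Q2).
  have minE : Num.min 0 B = - (Q (iota f) v)%:Z.
    by rewrite (no_2cycleE (iota f) v Q2) (sgn_opp Q v (iota f)) -/B; lia.
  rewrite minE /B /sgn; ring.
rewrite !trop_min_Some //.
move=> /(congr1 (odflt 0)) /= ->.
change (B * c + Num.min 0 B * hvec N f + trop_min (fun g => sgn Q v (iota g)) N =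
  trop_min (fun g => sgn Q v (iota g)) N + (c * B + hvec N f * Num.min 0 B)).
ring.
Qed.

(** The identity [step_sum] in the field creates powers of [yh] and [1 + yh] at [f]; the change of
    exponents found tropically is the one that [monom_step] needs to absorb them. *)
Lemma dimer_value_step : dimer_value S' N' =
  cluster S' (iota f) ^ (expo S' N' (iota f) + hvec N f) * dimer_value S N.
Proof.
rewrite /dimer_value -(expo_used star comp pN (step_used step)).
have z0 := x'_neq0 (iota f); have Q2 : no_2cycle Q by case: comp.
have q1 : (1 + yh x Q (iota f)) ^ 1 = 1 + yh x Q (iota f) ^ 1 by rewrite !expr1z.
have E := step_sum step (pw := fun g m => yh x Q (iota g) ^ m)
  (q := fun m => (1 + yh x Q (iota f)) ^ m) (t := fun g => sgn Q (iota f) (iota g))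
  (fun g => exponential_exprz (yh_pos _)) (exponential_exprz yh1_neq0) q1 sgn_step.
rewrite -(expo_used star comp pN (step_used step)) in E.
have -> : dimer_sum (fun g m => yh (cluster S') (seed_quiver S') (iota g) ^ m) N' =
    yh x Q (iota f) ^ c * (1 + yh x Q (iota f)) ^ expo S N (iota f) *
    dimer_sum (fun g m => yh x Q (iota g) ^ m) N.
  rewrite -E; apply: dimer_sum_ext => g m; rewrite /mut_pw.
  move: (x_neq0) z0 Q2; case: (S) => y R /= y0 z0 Q2.
  case: (eqVneq g f) => [->|gf]; first by rewrite yh_mutate_at // exprz_inv.
  have gf' : iota g != iota f by rewrite (inj_eq iota_inj).
  rewrite yh_mutate // !expfzMl !exprz_exp; congr (_ * _ * _).
    by rewrite [m * _]mulrC.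
  by rewrite mulNr mulrC.
have EE v : v != iota f -> expo S' N' v = expo S N v -
    (c * sgn Q v (iota f) + expo S N (iota f) * Num.min 0 (sgn Q v (iota f))).
  move=> vf; rewrite (expo_used star comp pN (step_used step)) /expo trop_min_step //.
  have -> : in_used H v = in_used G v.
    apply/existsP/existsP => -[g /andP[ug /eqP vg]]; exists g; rewrite vg eqxx andbT;
    by move: ug; rewrite (step_used_other step) //; apply: contraNneq vf => <-; rewrite vg.
  ring.
move: EE z0 Q2 (x_neq0); move: (expo S N) (expo S' N').
case: (S) => y R /= e e' EE z0 Q2 y0.
exact: monom_step.
Qed.

(** Away from [f] the rule for the arrows is that of mutation. The premise concerns a square, which
    reverses the arrows at [f]; for a bigon it is vacuous, since [f] is no longer used. *)
Lemma compatible_step :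
  (used H f -> forall v, arrows H f v = arrows G v f /\ arrows H v f = arrows G f v) ->
  compatible H S'.
Proof.
move=> Hf; have [px Q2 sE] := comp; split.
- exact: pos_mutate.
- exact: no_2cycle_cancel.
have uf := step_used step.
have no2 := step_no2 step.
move=> g h; case: (eqVneq g f) => [->|gf] ug uh; rewrite [seed_quiver _]/=.
  rewrite sgn_mutate_at; case: (eqVneq h f) => [->|hf]; first by rewrite /sgn /beta !subrr oppr0.
  rewrite sE // -?(step_used_other step) // /beta; have [-> ->] := Hf ug h; ring.
have ugG : used G g by rewrite -(step_used_other step).
case: (eqVneq h f) uh => [->|hf] uh.
  by rewrite sgn_mutate_at' sE // /beta; have [-> ->] := Hf uh g; ring.
have uhG : used G h by rewrite -(step_used_other step).
rewrite sgn_mutate ?(inj_eq iota_inj) // !no_2cycleE // !sE // /beta.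
rewrite !(step_arrows step) //.
have pm0 u : Num.max 0 ((arrows G u f)%:Z - (arrows G f u)%:Z) = (arrows G u f)%:Z.
  by case: (no2 u) => ->; lia.
have pm1 u : Num.max 0 ((arrows G f u)%:Z - (arrows G u f)%:Z) = (arrows G f u)%:Z.
  by case: (no2 u) => ->; lia.
rewrite !pm0 !pm1 !PoszD !PoszM; ring.
Qed.

End Step.

Lemma dimer_value_corr G H S r (N : {set edge G}) (N' : {set edge H}) :
  (forall f, used G f = used H f) -> matching_corr r -> perfect_matching N ->
  perfect_matching N' -> r N N' -> dimer_value S N = dimer_value S N'.
Proof.
move=> uE corr pN pN' rN; rewrite /dimer_value (dimer_sum_corr _ corr pN pN' rN).
congr (_ * _); apply: monom_ext => v.
rewrite /expo /trop_min (dimer_sum_corr _ corr pN pN' rN).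
by congr (- (nat_of_bool _)%:Z - _); apply: eq_existsb => g; rewrite uE.
Qed.

Lemma compatible_eq G H S : (forall f, used G f = used H f) ->
  (forall f g, beta G f g = beta H f g) -> compatible G S -> compatible H S.
Proof.
by move=> uE bE [px Q2 sE]; split=> // f g; rewrite -!uE -bE; exact: sE.
Qed.

(** The seed and the reference matching vary in the induction. Reductions are consumed from the
    front while the variable belongs to the last face, hence the equation [s = rcons r fq]. For a
    square the exponents of [z] before and after are opposite values of [hvec] and cancel. *)
Theorem cluster_dimer G s : reduction_seq G s -> forall r fq, s = rcons r fq ->
  property_star G -> forall S, compatible G S -> forall N : {set edge G}, perfect_matching N ->
  cluster (mutate_seq S (map iota s)) (iota fq) = dimer_value S N.
Proof.
elim=> {G s} [G _|G H s ctr _ IH|G H s ctr _ IH|f G H s sq red IH|f G H s bg red IH] r fq.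
- by case: r.
- move=> sE star S comp N pN; have [uE bE st [rr corr]] := contraction_invariance ctr.
  have [exH _ _] := corr; have [N' pN' rN] := exH N pN.
  rewrite (dimer_value_corr S uE corr pN pN' rN).
  by apply: (IH r fq) => //; [apply/st | exact: compatible_eq uE bE comp].
- move=> sE star S comp N pN; have [uE bE st [rr corr]] := contraction_invariance ctr.
  have [_ exG _] := corr; have [N' pN' rN] := exG N pN.
  rewrite -(dimer_value_corr S uE corr pN' pN rN).
  apply: (IH r fq) => //; first by apply/st.
  by apply: compatible_eq comp => *; rewrite ?uE ?bE.
- move=> sE star S comp N pN; have [N' [c [pN' step hE uH aH]]] := square_step sq star pN.
  case/lastP: s red IH sE => [|s f'] red IH sE.
    (* After a square [f] is still bounded, so the sequence cannot stop there. *)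
    by have := reduction_nil_unused f red erefl; rewrite uH.
  have ff' : f' = fq by have := congr1 (last f) sE; rewrite /= !last_rcons.
  have comp' : compatible H (mutate S (iota f)).
    by apply: (compatible_step step comp pN pN') => _; exact: aH.
  have star' := step_star step.
  rewrite -[LHS]/(cluster (mutate_seq (mutate S (iota f)) (map iota (rcons s f'))) (iota fq)).
  rewrite (IH s fq _ star' _ comp' _ pN') ?ff' // (dimer_value_step star step comp pN pN').
  by rewrite (expo_used star' comp' pN' uH) hE addNr expr0z mul1r.
move=> sE star S comp N pN.
have [N' [c [e' [pN' step hE uH sumE]]]] := bigon_removal_step bg star pN.
have star' := step_star step.
have valE := dimer_value_step star step comp pN pN'.
have tropE : trop_min (fun g => sgn (seed_quiver (mutate S (iota f))) (iota f) (iota g)) N' =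
    trop_min (fun g => - beta G f g) N'.
  rewrite /trop_min; congr odflt; apply: eq_bigr => M' pM'.
  rewrite /trop_pw !trop_prod; congr Some.
  apply: sum_used => // g ug; rewrite [seed_quiver _]/= sgn_mutate_at.
  rewrite (sgn_step step comp) // -(step_used_other step) //.
  by apply: contraTneq ug => ->.
(* For an [M'] that minimises the indicator of the surviving edge, the normalisation turns the
   contribution of [N'] into a difference of two indicators. Since [hvec N f] is [- ind N' e'], only
   [- ind M' e'] is left as the power of [z]. *)
have expoE M' : perfect_matching M' -> (forall P, perfect_matching P -> ind M' e' <= ind P e') ->
    expo (mutate S (iota f)) N' (iota f) = ind N' e' - ind M' e'.
  move=> pM' Mmin; rewrite /expo in_used_iota (negbTE uH) oppr0 add0r tropE.
  rewrite (trop_min_eq pM') ?sumE ?opprB // => P pP; rewrite sumE //.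
  by rewrite lerD2r; exact: Mmin.
(* With a single edge left this is the last bigon: the value for [H] is 1 and [e'] is forced, so the
   power of [z] is -1. *)
case: (eqVneq #|edge H| 1%N) => [H1|H1].
  have sN := reduction_single_nil red H1; rewrite sN in sE *.
  have [rN fE] : r = [::] /\ f = fq.
    by case: r sE => [|a r] /= []; [move=> -> | case: r].
  have /cards1P[x0 x0E] : #|[set: edge H]| == 1%N by rewrite cardsT H1.
  have eE (z z' : edge H) : z = z'.
    by have := in_setT z; have := in_setT z'; rewrite x0E !inE => /eqP -> /eqP ->.
  have uniqM (M' : {set edge H}) : perfect_matching M' -> M' = [set: edge H].
    move=> pM'; apply/setP => z; rewrite inE.
    by have [z' _] := matching_ex black z pM'; rewrite (eE z' z) => ->.
  have sum1 (R : comPzSemiRingType) (pw : 'I_n -> int -> R) :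
      (forall g, pw g 0 = 1) -> dimer_sum pw N' = 1.
    move=> pw0; rewrite /dimer_sum (big_pred1 N') => [|M' /=].
      by rewrite big1 // => g _; rewrite height_refl.
    by apply/idP/eqP => [pM'|-> //]; rewrite (uniqM _ pM') (uniqM _ pN').
  have unused g : ~~ used H g by apply: reduction_nil_unused red sN.
  have expo0 v : expo (mutate S (iota f)) N' v = 0.
    rewrite /expo /trop_min sum1 => [|g]; last by rewrite /trop_pw mulr0.
    rewrite (_ : in_used H v = false) //; apply/existsP => -[g /andP[ug _]].
    by have := unused g; rewrite ug.
  have indN' : ind N' e' = 1 by rewrite /ind (uniqM _ pN') inE.
  move: valE; rewrite expo0 hE indN' /dimer_value.
  rewrite (monom_ext _ (b := fun=> 0)) // monom0 sum1 => [|g]; last exact: expr0z.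
  rewrite mulr1 add0r => /esym/(congr1 (fun y => cluster (mutate S (iota f)) (iota f) * y)).
  rewrite mulr1 mulrA exprN1 divff ?mul1r; last exact: (x'_neq0 f comp).
  by rewrite fE => ->.
case/lastP: s red IH sE => [|s f'] red IH sE.
  have unused g : ~~ used H g by apply: reduction_nil_unused red erefl.
  by rewrite (no_used_single star' unused) in H1.
have ff' : f' = fq by have := congr1 (last f) sE; rewrite /= !last_rcons.
have comp' : compatible H (mutate S (iota f)).
  by apply: (compatible_step step comp pN pN') => uH'; rewrite uH' in uH.
rewrite -[LHS]/(cluster (mutate_seq (mutate S (iota f)) (map iota (rcons s f'))) (iota fq)).
rewrite (IH s fq _ star' _ comp' _ pN') ?ff' // valE hE.
(* With more edges [e'] cannot be forced, so the minimum of its indicator is 0 and the value does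
   not change. *)
have [M' pM' M'e] : exists2 M' : {set edge H}, perfect_matching M' & e' \notin M'.
  case: (boolP [exists M' : {set edge H}, perfect_matching M' && (e' \notin M')]).
    by case/existsP=> M' /andP[pM' nM']; exists M'.
  rewrite negb_exists => /forallP F.
  have forced := @forced_single _ _ star' e' _; case/eqP: H1.
  rewrite -cardsT; apply/eqP/cards1P; exists e'; apply/setP => z; rewrite !inE.
  apply/esym/eqP; apply: forced => M' pM'.
  by have := F M'; rewrite pM' negbK.
rewrite (expoE M') // => [|P pP]; last first.
  by rewrite {1}/ind (negbTE M'e); case/andP: (ind_le1 P e').
by rewrite {2}/ind (negbTE M'e) subr0 subrr expr0z mul1r.
Qed.

End ClusterFormula.

(** * The F-polynomial and the g-vector *)

Section Positive.

Variables (m : nat) (K : fieldType) (phi : {rmorphism {mpoly int[m]} -> K}).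
Hypothesis phi_inj : forall p, phi p = 0 -> p = 0.

(* Quotients of polynomials that are positive at (1, ..., 1): a semifield
   avoiding 0 that contains the cluster variables. *)
Definition positive (y : K) : Prop := exists p q : {mpoly int[m]},
  [/\ y = phi p / phi q, 0 < p.@[fun=> 1] & 0 < q.@[fun=> 1]].

Lemma positive_phi_neq0 p : 0 < p.@[fun=> 1 : int] -> phi p != 0.
Proof. by move=> p1; apply/eqP => /phi_inj p0; rewrite p0 meval0 ltxx in p1. Qed.

Lemma positive_neq0 y : positive y -> y != 0.
Proof.
by case=> p [q [-> p1 q1]]; rewrite mulf_neq0 ?invr_eq0 ?positive_phi_neq0.
Qed.

Lemma positiveD y z : positive y -> positive z -> positive (y + z).
Proof.
case=> p [q [-> p1 q1]] [p' [q' [-> p1' q1']]].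
exists (p * q' + p' * q), (q * q'); split.
- by rewrite addf_div ?positive_phi_neq0 // rmorphD !rmorphM.
- by rewrite mevalD !mevalM addr_gt0 // mulr_gt0.
by rewrite mevalM mulr_gt0.
Qed.

Lemma positiveM y z : positive y -> positive z -> positive (y * z).
Proof.
case=> p [q [-> p1 q1]] [p' [q' [-> p1' q1']]].
exists (p * p'), (q * q'); split; first by rewrite !rmorphM mulf_div.
  by rewrite mevalM mulr_gt0.
by rewrite mevalM mulr_gt0.
Qed.

Lemma positiveV y : positive y -> positive y^-1.
Proof. by case=> p [q [-> p1 q1]]; exists q, p; rewrite invf_div. Qed.

Lemma positive1 : positive 1.
Proof. by exists 1, 1; rewrite meval1 rmorph1 divr1. Qed.

Lemma positiveX i : positive (phi 'X_i).
Proof. by exists 'X_i, 1; rewrite mevalXU meval1 rmorph1 divr1. Qed.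

End Positive.

Section DualQuiver.

Variables (n : nat) (G : plane_bigraph n).

Lemma sgn_dual_quiver f g : sgn (dual_quiver G) f g = beta G f g.
Proof.
rewrite sgn_cancel /sgn /beta /= -/(arrows G f g) -/(arrows G g f) [g == f]eq_sym.
by case: (eqVneq f g) => [->|//]; rewrite !subrr.
Qed.

Lemma no_2cycle_dual : no_2cycle (dual_quiver G).
Proof. exact: no_2cycle_cancel. Qed.

End DualQuiver.

Lemma yhatE n (K : fieldType) (x : 'I_n -> K) (Q : quiver 'I_n) j :
  (forall v, x v != 0) -> yhat x Q j = yh x Q j.
Proof.
move=> x0; rewrite /yhat /yh /sgn.
rewrite -(monomD x0 (fun u => (Q u j)%:Z) (fun u => - (Q j u)%:Z)); congr (_ * _).
have -> : \prod_i x i ^+ Q j i = monom x (fun u => (Q j u)%:Z) by [].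
by rewrite -exprN1 monomX; apply: monom_ext => u; rewrite mulrN1.
Qed.

Lemma exprz_abs (K : fieldType) (y : K) (k : int) : 0 <= k -> y ^+ absz k = y ^ k.
Proof. by case: k. Qed.

(** * The cluster variable in the given seed and its g-vector *)

Section Unframed.

Variables (n : nat) (G : plane_bigraph n).
Hypothesis star : property_star G.
Hypothesis names : forall f : 'I_n, is_bounded_face G f.

Lemma all_used f : used G f.
Proof. by have [e fe] := names f; exact: used_face fe. Qed.

Variables (r : seq 'I_n) (fq : 'I_n).
Hypothesis red : reduction_seq G (rcons r fq).
Variables (K : fieldType) (x : 'I_n -> K).
Hypothesis indep : alg_independent x.

Let phi : {rmorphism {mpoly int[n]} -> K} := mmap intr x.
Let pos := positive phi.

Lemma phi_inj p : phi p = 0 -> p = 0. Proof. exact: indep. Qed.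

Lemma phiX i : phi 'X_i = x i.
Proof. by rewrite /phi /= mmapX mmap1U. Qed.

Lemma x_pos v : pos (x v).
Proof. by rewrite -phiX; exact: positiveX. Qed.

Lemma x_nz v : x v != 0. Proof. exact: (positive_neq0 phi_inj (x_pos v)). Qed.

Lemma compatible_dual : compatible id pos G (Seed x (dual_quiver G)).
Proof.
split=> [v||f g _ _] /=; [exact: x_pos | exact: no_2cycle_dual | exact: sgn_dual_quiver].
Qed.

Lemma mmap_dimer_poly : mmap intr (yhat x (dual_quiver G)) (dimer_poly G) =
  dimer_sum (fun g k => yh x (dual_quiver G) g ^ k) (hat0 G).
Proof.
rewrite dimer_polyE // /dimer_sum raddf_sum /=; apply: eq_bigr => M pM.
rewrite /height_monom rmorph_prod /=; apply: eq_bigr => g _.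
by rewrite rmorphXn /= mmapX mmap1U yhatE ?exprz_abs //; [exact: hat0_height | exact: x_nz].
Qed.

Lemma cluster_unframed :
  cluster (mutate_seq (Seed x (dual_quiver G)) (rcons r fq)) fq =
  (\prod_j x j ^ hvec (hat0 G) j) * mmap intr (yhat x (dual_quiver G)) (dimer_poly G).
Proof.
have inj_id : injective (id : 'I_n -> 'I_n) by [].
have := cluster_dimer inj_id (positive_neq0 phi_inj) (positiveD phi_inj)
  (@positiveM _ _ phi) (@positiveV _ _ phi) (positive1 phi) red erefl star compatible_dual
  (hat0_pm star).
rewrite map_id => ->; rewrite /dimer_value mmap_dimer_poly; congr (_ * _).
apply: eq_bigr => v _; congr (_ ^ _).
exact: (expo_used inj_id star compatible_dual (hat0_pm star) (all_used v)).
Qed.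

Lemma cluster_unframed_neq0 :
  cluster (mutate_seq (Seed x (dual_quiver G)) (rcons r fq)) fq != 0.
Proof.
apply: (positive_neq0 phi_inj).
have : forall v, pos (cluster (Seed x (dual_quiver G)) v) by exact: x_pos.
move: (Seed x _) fq (rcons r fq) => S f s; elim: s S => [|g s IH] S px; first exact: px.
apply: IH; apply: pos_mutate => //.
- exact: (positiveD phi_inj).
- exact: (@positiveM _ _ phi).
- exact: (@positiveV _ _ phi).
exact: (positive1 phi).
Qed.

(** Subtracting the entrywise minimum of the two exponent vectors leaves honest monomials, which the
    independence of the variables separates. *)
Lemma monom_inj (g g' : {ffun 'I_n -> int}) :
  \prod_j x j ^ g j = \prod_j x j ^ g' j -> g = g'.
Proof.
move=> E; pose l j := Num.min (g j) (g' j).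
have mE (k : 'I_n -> int) : (forall j, 0 <= k j) ->
    monom x k = phi 'X_[[multinom absz (k j) | j < n]].
  move=> k0; rewrite mpolyXE_id rmorph_prod; apply: eq_bigr => j _.
  by rewrite rmorphXn /= -/phi phiX mnmE exprz_abs.
have : monom x (fun j => g j - l j) = monom x (fun j => g' j - l j).
  by rewrite -!(monomD x_nz _ (fun j => - l j)); congr (_ * _).
rewrite !mE; try by move=> j; rewrite /l; lia.
move/eqP; rewrite -subr_eq0 -rmorphB => /eqP/phi_inj/eqP; rewrite subr_eq0 => /eqP.
move/(congr1 (mcoeff [multinom absz (g j - l j) | j < n])).
rewrite !mcoeffX eqxx; case: eqP => // mE' _; apply/ffunP => j.
have := congr1 (fun mm : 'X_{1..n} => mm j) mE'; rewrite /= !mnmE /l; lia.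
Qed.

End Unframed.

Section Divisibility.

Variable m : nat.
Implicit Types (P Q : {mpoly int[m]}) (i : 'I_m).

Lemma dvd_var P i : (forall k, k \in msupp P -> k i != 0%N) -> exists P', P = 'X_i * P'.
Proof.
move=> Hk; exists (\sum_(k <- msupp P) P@_k *: 'X_[(k - U_(i))%MM]).
rewrite mulr_sumr [LHS]mpolyE; apply: eq_big_seq => k /Hk ki.
rewrite -scalerAr -mpolyXD addmC submK //; by rewrite lep1mP.
Qed.

Lemma dvd_var_cancel P Q (a b : 'X_{1..m}) i :
  P * 'X_[a] = Q * 'X_[b] -> a i != 0%N -> b i = 0%N -> exists Q', Q = 'X_i * Q'.
Proof.
move=> E ai bi; apply: dvd_var => k kQ.
have : (b + k)%MM \in msupp (P * 'X_[a]).
  by rewrite E (perm_mem (msuppMX Q b)) map_f.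
rewrite (perm_mem (msuppMX P a)) => /mapP[k' _ /(congr1 (fun mm : 'X_{1..m} => mm i))].
by rewrite /= !mnmDE bi add0n => ->; rewrite addn_eq0 negb_and ai.
Qed.

End Divisibility.

Lemma cross_mul (F : fieldType) (p a b c : F) :
  a != 0 -> p / a * (a * b * c) = p * (b * c).
Proof. by move=> a0; field. Qed.

(** * The framed seed and the F-polynomial *)

Section Framed.

Variable n : nat.
Implicit Types (Q : quiver 'I_n) (d : 'I_n -> int).
Notation fv := (@framed_var n).

Lemma framed_var_neq0 v : fv v != 0.
Proof.
rewrite /framed_var tofrac_eq0; apply/eqP => /(congr1 (meval (fun=> 1 : int))).
by rewrite mevalXU meval0.
Qed.

Lemma prod_framed_var d : (forall i, 0 <= d i) ->
  \prod_i fv (inl i) ^ d i =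
  tofrac 'X_[[multinom (if split j is inl i then absz (d i) else 0%N) | j < n + n]].
Proof.
move=> d0; rewrite mpolyXE_id big_split_ord /= rmorphM /=.
rewrite [X in _ = _ * tofrac X]big1 => [|i _]; last first.
  by rewrite mnmE -[rshift n i]/(unsplit (inr i)) unsplitK.
rewrite rmorph1 mulr1 rmorph_prod; apply: eq_bigr => i _.
rewrite mnmE -[lshift n i]/(unsplit (inl i)) unsplitK rmorphXn /= -exprz_abs //.
Qed.

(** Two numerators of the same element differ by a Laurent monomial in the [x_i]. Once the common
    part [l] of the denominators is removed, a positive exponent left on one side would force that
    variable to divide the numerator on the other. *)
Lemma is_Fpoly_unique Q s k F F' : is_Fpoly Q s k F -> is_Fpoly Q s k F' -> F = F'.
Proof.
case=> P [d [zE ndP ->]] [P' [d' [zE' ndP' ->]]].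
suff -> : P = P' by [].
pose l i := Num.min (d i) (d' i).
have fv_nz i : fv (inl i) != 0 by exact: framed_var_neq0.
have mD := monomD fv_nz; rewrite /monom in mD.
pose X (e : 'I_n -> int) := \prod_i fv (inl i) ^ e i.
have XD e1 e2 : X e1 * X e2 = X (fun i => e1 i + e2 i) by exact: mD.
have X0 e : X e != 0 by exact: monom_neq0 fv_nz _.
have E : tofrac P * X (fun i => d' i - l i) = tofrac P' * X (fun i => d i - l i).
  have : tofrac P / X d = tofrac P' / X d' by rewrite /X -zE -zE'.
  move/(congr1 (fun y => y * (X d * X d' * X (fun i => - l i)))).
  rewrite -(XD d') -(XD d).
  by rewrite (cross_mul _ (X d') _ (X0 d)) [X d * X d']mulrC (cross_mul _ (X d) _ (X0 d')).
rewrite /X !prod_framed_var in E; try by move=> i; rewrite /l; lia.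
move: E; rewrite -!rmorphM => /eqP; rewrite tofrac_eq => /eqP E.
have d'l i : d' i - l i = 0.
  apply/eqP; apply: contraT => ne.
  have [|| P'' PE] := @dvd_var_cancel _ _ _ _ _ (lshift n i) E.
  - by rewrite mnmE -[lshift n i]/(unsplit (inl i)) unsplitK absz_eq0.
  - rewrite mnmE -[lshift n i]/(unsplit (inl i)) unsplitK; apply/eqP; rewrite absz_eq0.
    by move: ne; rewrite /l; lia.
  by case: (ndP' (lshift n i) P'').
have dl i : d i - l i = 0.
  apply/eqP; apply: contraT => ne.
  have [|| P'' PE] := @dvd_var_cancel _ _ _ _ _ (lshift n i) (esym E).
  - by rewrite mnmE -[lshift n i]/(unsplit (inl i)) unsplitK absz_eq0.
  - rewrite mnmE -[lshift n i]/(unsplit (inl i)) unsplitK; apply/eqP; rewrite absz_eq0.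
    by move: ne; rewrite /l; lia.
  by case: (ndP (lshift n i) P'').
have X1 (e : 'I_n -> int) : (forall i, e i = 0) ->
   [multinom (if split j is inl i then absz (e i) else 0%N) | j < n + n] = 0%MM.
  move=> e0; apply/mnmP => j; rewrite mnmE mnm0E.
  by case: (split j) => // i; rewrite e0.
by move: E; rewrite !X1 // mpolyX0 !mulr1.
Qed.

Variable G : plane_bigraph n.
Hypothesis star : property_star G.
Hypothesis names : forall f : 'I_n, is_bounded_face G f.
Variables (r : seq 'I_n) (fq : 'I_n).
Hypothesis red : reduction_seq G (rcons r fq).

Let phi : {rmorphism {mpoly int[n + n]} -> {fraction {mpoly int[n + n]}}} :=
  @tofrac {mpoly int[n + n]}.
Let pos := positive phi.

Lemma tofrac_inj p : phi p = 0 -> p = 0.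
Proof. by move/eqP; rewrite tofrac_eq0 => /eqP. Qed.

Lemma framed_pos v : pos (fv v).
Proof. exact: (positiveX phi (unsplit v)). Qed.

Lemma compatible_framed : compatible inl pos G (framed_seed (dual_quiver G)).
Proof.
split=> [v|u v|f g _ _].
- exact: framed_pos.
- case: u v => [i|i] [j|j] /=; try by [left | right].
  exact: no_2cycle_dual.
exact: sgn_dual_quiver.
Qed.

(* Exponents, shifted by one on the mutable variables to clear denominators. *)
Definition framed_expo (M : {set edge G}) (v : 'I_n + 'I_n) : nat :=
  match v with
  | inl i => absz (hvec M i + 1)
  | inr i => absz (height M (hat0 G) i)
  end.

Definition framed_poly : {mpoly int[n + n]} :=
  \sum_(M | perfect_matching M) \prod_v 'X_(unsplit v) ^+ framed_expo M v.

Lemma expo_framed v : expo inl (framed_seed (dual_quiver G)) (hat0 G) v =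
  if v is inl i then hvec (hat0 G) i else 0.
Proof.
have p0 := hat0_pm star.
have inj : injective (inl : 'I_n -> 'I_n + 'I_n) by move=> i j [].
case: v => [i|i].
  exact: (expo_used inj star compatible_framed p0 (all_used names i)).
rewrite /expo (_ : in_used _ _ _ = false) ?sub0r; last first.
  by apply/existsP => -[g]; rewrite andbF.
have sumE M : \sum_g sgn (seed_quiver (framed_seed (dual_quiver G))) (inr i) (inl g)
    * height M (hat0 G) g = height M (hat0 G) i.
  rewrite (bigD1 i) //= {1}/sgn /= eqxx mul1r big1 ?addr0 // => g /negbTE gi.
  by rewrite /sgn /= eq_sym gi mul0r.
rewrite (trop_min_eq p0) ?sumE ?height_refl // => P pP.
by rewrite sumE; exact: hat0_height.
Qed.

(** Each matching contributes the monomial with exponents [hvec M] in the [x_i] and its heights in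
    the [y_i]. As [hvec] is at least -1, the product of all the [x_i] clears the denominators. *)
Lemma cluster_framed :
  cluster (mutate_seq (framed_seed (dual_quiver G)) (map inl (rcons r fq))) (inl fq) =
  tofrac framed_poly / \prod_i fv (inl i) ^ (1 : int).
Proof.
have p0 := hat0_pm star.
have inj : injective (inl : 'I_n -> 'I_n + 'I_n) by move=> i j [].
rewrite (cluster_dimer inj (positive_neq0 tofrac_inj) (positiveD tofrac_inj)
  (@positiveM _ _ phi) (@positiveV _ _ phi) (positive1 phi) red erefl star compatible_framed p0).
have fv_nz := framed_var_neq0.
rewrite /dimer_value /=.
have one_nz : \prod_i fv (inl i) ^ (1 : int) != 0.
  by rewrite prodf_seq_neq0; apply/allP => i _; rewrite expfz_neq0.
apply: (mulIf one_nz); rewrite divfK //.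
have -> : \prod_i fv (inl i) ^ (1 : int) = monom fv (fun v => if v is inl _ then 1 else 0).
  by rewrite /monom big_sumType /= [X in _ * X]big1 ?mulr1.
rewrite /framed_poly raddf_sum /= mulrAC /dimer_sum mulr_sumr; apply: eq_bigr => M pM.
have -> : \prod_g yh fv (framed_quiver (dual_quiver G)) (inl g) ^ height M (hat0 G) g =
   monom fv (fun v => \sum_g sgn (framed_quiver (dual_quiver G)) v (inl g) * height M (hat0 G) g).
  rewrite /yh; under eq_bigr do rewrite monomX.
  rewrite /monom exchange_big /=; apply: eq_bigr => v _.
  by rewrite (big_morph (fun k => fv v ^ k) (fun i j => expfzDr i j (fv_nz v)) (expr0z _)).
rewrite !monomD // rmorph_prod; apply: eq_bigr => v _.
rewrite rmorphXn /= -[tofrac _]/(fv v) expo_framed.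
case: v => [i|i].
  have -> : \sum_g sgn (framed_quiver (dual_quiver G)) (inl i) (inl g) * height M (hat0 G) g =
     hvec M i - hvec (hat0 G) i.
    rewrite (hvec_height star) //; apply: eq_bigr => g _; congr (_ * _); exact: sgn_dual_quiver.
  have hM := hvec_ge star i pM.
  rewrite /framed_expo exprz_abs; last by lia.
  by congr (_ ^ _); ring.
have -> : \sum_g sgn (framed_quiver (dual_quiver G)) (inr i) (inl g) * height M (hat0 G) g =
    height M (hat0 G) i.
  rewrite (bigD1 i) //= {1}/sgn /= eqxx mul1r big1 ?addr0 // => g /negbTE gi.
  by rewrite /sgn /= eq_sym gi mul0r.
rewrite /framed_expo exprz_abs; last exact: hat0_height.
by congr (_ ^ _); rewrite addr0 add0r.
Qed.

(** Setting one variable to 0 and the others to 1 counts the matchings whose exponent there is 0, so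
    one such matching suffices: [hat0] for a [y_i], and for an [x_i] a matching with [hvec] equal to
    -1. *)
Lemma framed_poly_prime i P' : framed_poly <> 'X_i * P'.
Proof.
pose e j : int := if j == i then 0 else 1.
move/(congr1 (meval e)); rewrite mevalM mevalXU {2}/e eqxx mul0r /framed_poly raddf_sum /=.
have termE (M : {set edge G}) : (\prod_v 'X_(unsplit v) ^+ framed_expo M v).@[e] =
    (framed_expo M (split i) == 0%N : nat)%:Z.
  rewrite rmorph_prod (bigD1 (split i)) //= big1 ?mulr1.
    by rewrite rmorphXn /= mevalXU /e splitK eqxx expr0n; case: (_ == _).
  move=> v vi; rewrite rmorphXn /= mevalXU /e; case: eqP => [vE|_]; last by rewrite expr1n.
  by rewrite -vE unsplitK eqxx in vi.
under eq_bigr do rewrite termE.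
suff [M pM M0] : exists2 M : {set edge G}, perfect_matching M & framed_expo M (split i) = 0%N.
  rewrite (bigD1 M) //= M0 eqxx /=.
  have : 0 <= \sum_(N | perfect_matching N && (N != M)) (framed_expo N (split i) == 0%N : nat)%:Z.
    by apply: sumr_ge0.
  by move=> s0 /eqP; rewrite gt_eqF // ltr_pwDl.
case: (split i) => j; last first.
  by exists (hat0 G); [exact: hat0_pm | rewrite /= height_refl].
have [M pM hM] := hvec_min star (all_used names j).
by exists M => //=; rewrite hM.
Qed.

Lemma subst_framed_poly : subst_x1 framed_poly = dimer_poly G.
Proof.
rewrite dimer_polyE // /subst_x1 /framed_poly raddf_sum /=; apply: eq_bigr => M pM.
rewrite rmorph_prod big_sumType /= [X in X * _]big1 ?mul1r => [|i _].
  apply: eq_bigr => i _; rewrite rmorphXn /= comp_mpolyXU -tnth_nth tnth_mktuple.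
  by rewrite -[rshift n i]/(unsplit (inr i)) unsplitK.
rewrite rmorphXn /= comp_mpolyXU -tnth_nth tnth_mktuple.
by rewrite -[lshift n i]/(unsplit (inl i)) unsplitK expr1n.
Qed.

Lemma dimer_poly_is_Fpoly : is_Fpoly (dual_quiver G) (rcons r fq) fq (dimer_poly G).
Proof.
exists framed_poly, (fun=> 1); split.
- exact: cluster_framed.
- exact: framed_poly_prime.
by rewrite subst_framed_poly.
Qed.

End Framed.

Theorem theorem6p8 (n : nat) (G : plane_bigraph n)
    (star : property_star G)
    (names : forall f : 'I_n, is_bounded_face G f)
    (r : seq 'I_n) (fq : 'I_n)
    (red : reduction_seq G (rcons r fq))
    (K : fieldType) (x : 'I_n -> K) (indep : alg_independent x) :
  unique (is_Fpoly (dual_quiver G) (rcons r fq) fq) (dimer_poly G) /\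
  unique (is_gvector x (dual_quiver G) (rcons r fq) fq) (hvec (hat0 G)).
Proof.
have FD := dimer_poly_is_Fpoly star names red.
have clE := cluster_unframed star names red indep.
split; split=> //.
- by move=> F; exact: is_Fpoly_unique FD.
- by exists (dimer_poly G).
(* A g-vector may come with any witness [F]; uniqueness replaces it by [dimer_poly G]. The cluster
   variable is nonzero, so the common factor cancels and only monomials are compared. *)
move=> g [F FF]; rewrite -(is_Fpoly_unique FD FF) clE => /mulIf gE.
apply: (monom_inj indep); apply: gE.
have := cluster_unframed_neq0 G r fq indep; rewrite clE.
by rewrite mulf_eq0 negb_or => /andP[].
Qed.
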